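(* Let $\beta>1$, $\gamma>0$, $\alpha>\beta-2$, let $g\in H(\mathbb D)$ and let $\phi$ be an analytic self-map of $\mathbb D$ such that $T_g^\phi:\mathcal B_\beta\to\mathcal B_\gamma$ is bounded. Then the following statements are equivalent. (a) $T_g^\phi:\mathcal B^0_\beta\to\mathcal B_\gamma$ is nuclear. (b) $T_g^\phi:\mathcal B_\beta\to\mathcal B_\gamma$ is nuclear. (c) $$\int_{\mathbb D}\left[\sup_{z\in\mathbb D}\frac{(1-|z|^2)^\gamma|g'(z)|}{|1-\bar\zeta\phi(z)|^{\alpha+2}}\right](1-|\zeta|^2)^{\alpha-\beta+1}\,dA(\zeta)<\infty.$$
   Context: $\mathbb D$ is the open unit disk in $\mathbb C$, $H(\mathbb D)$ the space of analytic functions on $\mathbb D$, and $dA$ normalized Lebesgue measure on $\mathbb D$. For $g\in H(\mathbb D)$ and an analytic map $\phi:\mathbb D\to\mathbb D$, $(T_g^\phi f)(z)=\int_0^z f(\phi(\zeta))g'(\zeta)\,d\zeta$ for $f\in H(\mathbb D)$, $z\in\mathbb D$. For $\beta>0$, the Bloch space of order $\beta$ is $\mathcal B_\beta=\{f\in H(\mathbb D):\sup_{z\in\mathbb D}(1-|z|^2)^\beta|f'(z)|<\infty\}$ with norm $|f(0)|+\sup_{z\in\mathbb D}(1-|z|^2)^\beta|f'(z)|$, and $\mathcal B^0_\beta=\{f\in H(\mathbb D):\lim_{|z|\to1^-}(1-|z|^2)^\beta|f'(z)|=0\}$ with the same norm. A linear operator $T:X\to Y$ between Banach spaces is nuclear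 if there are sequences $(x_k')\subset X'$ (the dual of $X$) and $(y_k)\subset Y$ with $\sum_k\|x_k'\|\|y_k\|<\infty$ and $Tx=\sum_k x_k'(x)y_k$ for all $x\in X$. *)

(* Defs.v *)
From HB Require Import structures.
From mathcomp Require Import all_boot all_order all_algebra complex.
From mathcomp Require Import all_classical all_reals all_analysis.

Set Implicit Arguments.
Unset Strict Implicit.
Unset Printing Implicit Defensive.

Import Order.TTheory GRing.Theory Num.Theory numFieldNormedType.Exports.

Local Open Scope classical_set_scope.
Local Open Scope ring_scope.
Local Open Scope complex_scope.

(* The field R[i], packaged so that it carries the topology and the normed
   module structure of an abstract numFieldType. Norms of normed modules over
   Cx R are elements of Cx R (with zero imaginary part); normc is the
   real-valued modulus. *)
Definition Cx (R : realType) : numClosedFieldType := R[i].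

Notation normc := ComplexField.Normc.normc.

Section analytic.
Context {R : realType}.
Local Notation C := (Cx R).

Definition disk : set C := [set z | normc z < 1].

(* An element of H(D) is represented by a total function on C of which only the
   values on the disk matter. Analytic means continuously complex
   differentiable; by Goursat's theorem the continuity of the derivative is
   automatic, and taking it as part of the definition (as in Conway's
   "Functions of One Complex Variable") gives the inclusion of the little Bloch
   space in the Bloch space by compactness alone. *)
Definition analytic (f : C -> C) :=
  forall z, disk z -> derivable f z 1 /\ {for z, continuous (derive1 f)}.

Definition bloch_weight (b : R) (f : C -> C) (z : C) : R :=
  (1 - normc z ^+ 2) `^ b * normc (derive1 f z).

(* Requiring f to vanish off the disk selects one representative of each
   analytic function on the disk, so that the norm below separates points. *)
Definition bloch_pred (b : R) : {pred C -> C} := [pred f |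
  `[< [/\ analytic f, has_ubound [set bloch_weight b f z | z in disk] &
          forall z, ~ disk z -> f z = 0] >]].

Definition little_bloch_pred (b : R) : {pred C -> C} := [pred f |
  `[< [/\ analytic f,
          forall e : R, 0 < e -> \forall r \near 1^'-,
            forall z, normc z = r -> bloch_weight b f z < e &
          forall z, ~ disk z -> f z = 0] >]].

End analytic.

Section theory.
Context {R : realType}.
Local Notation C := (Cx R).
Implicit Types (f g : C -> C) (z : C).

Lemma normE z : `|z| = (normc z)%:C. Proof. by []. Qed.

Lemma normc_ge0 z : 0 <= normc z.
Proof. by rewrite -ler0c -normE. Qed.

Lemma disk0 : disk (0 : C).
Proof. by rewrite /disk /mkset -ltcR -normE normr0 ltcR. Qed.

Lemma derive1_lin (a : C) f g z : derivable f z 1 -> derivable g z 1 ->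
  derive1 (a *: f + g) z = a * derive1 f z + derive1 g z.
Proof.
move=> df dg; rewrite !derive1E (deriveD (derivableZ (k := a) df) dg).
by rewrite (deriveZ a df).
Qed.

Lemma open_disk : open (@disk R).
Proof.
rewrite openE => z dz.
have e0 : 0 < ((1 - normc z)%:C : C) by rewrite ltcR subr_gt0.
apply/nbhs_ballP; exists ((1 - normc z)%:C : C) => //= w.
rewrite /ball /= normE ltcR => zw; rewrite /disk /mkset.
have -> : w = z - (z - w) by rewrite opprB addrC subrK.
apply: le_lt_trans (le_normcD _ _) _.
by rewrite normcN -ltrBrDl.
Qed.

Lemma near_disk z : disk z -> \forall w \near z, disk w.
Proof. by move=> dz; exact: (open_disk dz). Qed.

Lemma derive1_0 z : derive1 (0 : C -> C) z = 0.
Proof. by rewrite derive1E; exact: derive_cst. Qed.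

Lemma analytic0 : analytic (0 : C -> C).
Proof.
have d0 : derive1 (0 : C -> C) = cst 0 by apply: boolp.funext => w; rewrite derive1_0.
by move=> z _; split; [exact: derivable_cst | rewrite d0; exact: cst_continuous].
Qed.

Lemma analytic_lin (a : C) f g : analytic f -> analytic g ->
  analytic (a *: f + g).
Proof.
move=> af ag z dz; have [df cf] := af z dz; have [dg cg] := ag z dz.
split; first exact: (derivableD (derivableZ (k := a) df) dg).
rewrite /prop_for /continuous_at (derive1_lin a df dg).
have e : \forall w \near z,
    a * derive1 f w + derive1 g w = derive1 (a *: f + g) w.
  near=> w; have dw : disk w by near: w; exact: near_disk.
  by rewrite (derive1_lin a (af w dw).1 (ag w dw).1).
apply: (cvg_trans (near_eq_cvg e)); apply: cvgD cg.
by apply: cvgM cf; exact: cvg_cst.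
Unshelve. all: by end_near. Qed.

Lemma weight_ge0 b f z : 0 <= bloch_weight b f z.
Proof. by rewrite mulr_ge0 ?powR_ge0 ?normc_ge0. Qed.

Lemma weight_lin b (a : C) f g z : derivable f z 1 -> derivable g z 1 ->
  bloch_weight b (a *: f + g) z <= normc a * bloch_weight b f z + bloch_weight b g z.
Proof.
move=> df dg; rewrite /bloch_weight (derive1_lin a df dg) mulrCA -mulrDr.
rewrite ler_wpM2l ?powR_ge0// -ComplexField.Normc.normcM.
exact: le_normcD.
Qed.

Lemma weight0 b z : bloch_weight b 0 z = 0.
Proof. by rewrite /bloch_weight derive1_0 ComplexField.Normc.normc0 mulr0. Qed.

Lemma weight_scale b (a : C) f z : derivable f z 1 ->
  bloch_weight b (a *: f) z = normc a * bloch_weight b f z.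
Proof.
move=> df; rewrite /bloch_weight !derive1E (deriveZ a df).
by rewrite ComplexField.Normc.normcM mulrCA.
Qed.

Lemma bloch_closed b : GRing.submod_closed (@bloch_pred R b).
Proof.
split.
  apply/asboolP; split => //; first exact: analytic0.
  by exists 0 => _ [z _ <-]; rewrite weight0.
move=> a f g /asboolP[af [M fM] f0] /asboolP[ag [N gN] g0].
apply/asboolP; split; first exact: analytic_lin.
  exists (normc a * M + N) => _ [z dz <-].
  apply: (le_trans (weight_lin _ _ (af z dz).1 (ag z dz).1)).
  rewrite lerD//; last by apply: gN; exists z.
  by rewrite ler_wpM2l ?normc_ge0//; apply: fM; exists z.
by move=> z dz; rewrite !fctE f0// g0// scaler0 addr0.
Qed.

Lemma little_bloch_closed b : GRing.submod_closed (@little_bloch_pred R b).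
Proof.
split.
  apply/asboolP; split => //; first exact: analytic0.
  by move=> e e0; near=> r => z _; rewrite weight0.
move=> a f g /asboolP[af lf f0] /asboolP[ag lg g0].
apply/asboolP; split; first exact: analytic_lin.
  move=> e e0; pose e' := e / (normc a + 1 + 1).
  have a1 : 0 < normc a + 1 + 1 by rewrite addr_gt0// ltr_wpDl ?normc_ge0.
  have e'0 : 0 < e' by rewrite divr_gt0.
  have r1 : \forall r \near (1 : R)^'-, r < 1 by exact: nbhs_left_lt.
  apply: filterS3 r1 (lf e' e'0) (lg e' e'0) => r r1 lfr lgr z zr.
  have dz : disk z by rewrite /disk /mkset zr.
  have [fe ge] := (lfr z zr, lgr z zr).
  apply: (le_lt_trans (weight_lin _ _ (af z dz).1 (ag z dz).1)).
  apply: (@le_lt_trans _ _ (normc a * e' + bloch_weight b g z)).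
    by rewrite lerD2r; apply: ler_wpM2l (normc_ge0 a) _ _ (ltW fe).
  apply: (@lt_trans _ _ (normc a * e' + e')); first by rewrite ltrD2l; exact: ge.
  have -> : e = normc a * e' + e' + e'.
    have : (normc a + 1 + 1) * e' = e by rewrite mulrC divfK// gt_eqF.
    by rewrite !mulrDl !mul1r.
  by rewrite ltrDl.
by move=> z dz; rewrite !fctE f0// g0// scaler0 addr0.
Unshelve. all: by end_near. Qed.

End theory.
Section zero_derivative.
Context {R : realType}.
Local Notation C := (Cx R).
Implicit Types (f g : C -> C) (z : C).

Lemma complex_gt0 (d : C) : 0 < d -> exists2 r : R, 0 < r & d = r%:C.
Proof.
case: d => x y; rewrite ltcE /= => /andP[/eqP -> x0].
by exists x.
Qed.

Lemma derive1_eps f w (e : R) : derivable f w 1 -> derive1 f w = 0 -> 0 < e ->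
  exists2 d : R, 0 < d & forall k : C, k != 0 -> normc k < d ->
    normc (k^-1 * (f (k + w) - f w)) < e.
Proof.
move=> df f0 e0.
have H : _ --> 'D_1 f w := df.
rewrite -derive1E f0 in H.
have e0C : 0 < (e%:C : C) by rewrite ltcR.
have N := @cvgr0_norm_lt _ _ _ _ _ _ H (e%:C : C) e0C.
case: (proj1 (@nbhs_ballP _ _ _ _) (N _)) => d /= /complex_gt0[r r0 ->] dH.
exists r => // k k0 kr.
have := dH k; rewrite /ball /= sub0r normrN normE ltcR => /(_ kr k0).
rewrite normE ltcR; congr (normc _ < _).
by congr (_ * (f (_ + _) - _)); exact: mulr1.
Qed.

Variable L : C -> R.
Hypothesis LB : forall v w, L (v - w) = L v - L w.
Hypothesis LZ : forall (r : R) w, L (r%:C * w) = r * L w.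
Hypothesis Ln : forall w, `|L w| <= normc w.

Lemma slice_derive f z (t : R) : z != 0 ->
  derivable f (t%:C * z) 1 -> derive1 f (t%:C * z) = 0 ->
  is_derive t 1 (fun s : R => L (f (s%:C * z))) 0.
Proof.
move=> z0 df f0; set F := fun s : R => _.
have nz0 : 0 < normc z by rewrite -ltcR -normE normr_gt0.
have H : (fun h : R => h^-1 *: (F (h *: 1 + t) - F t)) @ 0^' --> (0 : R).
  apply/cvgrPdist_lt => e e0.
  have e'0 : 0 < e / normc z by rewrite divr_gt0.
  have [d d0 dH] := derive1_eps df f0 e'0.
  apply/nbhs_ballP; exists (d / normc z); first by rewrite /= divr_gt0.
  move=> h /=; rewrite /ball /= sub0r normrN => hd h0.
  have hC0 : (h%:C : C) * z != 0.
    by rewrite mulf_neq0//; apply: contra_neq h0 => -[].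
  have nh : normc (h%:C : C) = `|h|.
    by apply: complexI; rewrite -normE /= normc_def /= expr0n/= addr0 sqrtr_sqr.
  have := dH _ hC0; rewrite ComplexField.Normc.normcM nh -ltr_pdivlMr// => /(_ hd).
  rewrite -mulrDl -rmorphD invfM mulrAC -mulrA => lt.
  rewrite sub0r normrN /F -LB.
  rewrite {1}/GRing.scale /= -LZ.
  apply: (le_lt_trans (Ln _)).
  rewrite -[ltRHS](divfK (lt0r_neq0 nz0)) -ltr_pdivrMr//.
  apply: le_lt_trans lt.
  rewrite [h%:A]mulr1 !ComplexField.Normc.normcM ComplexField.Normc.normcV.
  have -> : normc ((h^-1)%:C : C) = (normc (h%:C : C))^-1.
    rewrite -ComplexField.Normc.normcV; congr normc.
    by have := fmorphV (real_complex R) h.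
  by rewrite -mulrA ComplexField.Normc.normcV; exact: lexx.
apply: DeriveDef; first by apply/cvg_ex; exists 0.
exact/cvg_lim.
Qed.

Lemma disk_scale (t : R) z : 0 <= t <= 1 -> disk z -> disk (t%:C * z).
Proof.
move=> /andP[t0 t1]; rewrite /disk /mkset ComplexField.Normc.normcM => z1.
have -> : normc (t%:C : C) = t.
  apply: complexI; rewrite -normE /= normc_def /= expr0n/= addr0 sqrtr_sqr.
  by rewrite ger0_norm.
by apply: le_lt_trans z1; apply: ler_piMl t1; exact: normc_ge0.
Qed.

Lemma slice_const f z : analytic f -> (forall w, disk w -> derive1 f w = 0) ->
  disk z -> L (f z) = L (f 0).
Proof.
move=> af f0 dz; have [->//|z0] := eqVneq z 0.
set F := fun s : R => L (f (s%:C * z)).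
have dF (t : R) : 0 <= t <= 1 -> is_derive t 1 F 0.
  move=> t01; have dt := disk_scale t01 dz.
  exact: slice_derive z0 (af _ dt).1 (f0 _ dt).
have cF : {within `[0, 1], continuous F}.
  apply: derivable_within_continuous => t; rewrite in_itv /= => t01.
  by have [] := dF t t01.
have [] := @MVT_segment R F (cst 0) 0 1 ler01 _ cF.
  by move=> t; rewrite in_itv /= => /andP[t0 t1]; apply: dF; rewrite !ltW.
move=> c _; rewrite mul0r /F mul1r mul0r => /eqP; rewrite subr_eq0 => /eqP.
exact.
Qed.

End zero_derivative.

Section norm.
Context {R : realType}.
Local Notation C := (Cx R).
Implicit Types (f g : C -> C) (z : C).

Lemma normc_ge_Re' (w : C) : `|complex.Re w| <= normc w.
Proof. by rewrite -lecR; exact: normc_ge_Re. Qed.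

Lemma normc_ge_Im' (w : C) : `|complex.Im w| <= normc w.
Proof.
case: w => x y /=; rewrite -sqrtr_sqr ler_sqrt ?lerDr ?sqr_ge0//.
by rewrite addr_ge0 ?sqr_ge0.
Qed.

Lemma derive0_cst f z : analytic f -> (forall w, disk w -> derive1 f w = 0) ->
  disk z -> f z = f 0.
Proof.
move=> af f0 dz; apply/eqP; rewrite eq_complex; apply/andP; split; apply/eqP.
- apply: (@slice_const R (@complex.Re R)) af f0 dz.
  + by case=> ? ? [].
  + by move=> r [x y] /=; rewrite mul0r subr0.
  + exact: normc_ge_Re'.
- apply: (@slice_const R (@complex.Im R)) af f0 dz.
  + by case=> ? ? [].
  + by move=> r [x y] /=; rewrite mul0r addr0.
  + exact: normc_ge_Im'.
Qed.

End norm.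

Section bloch.
Context {R : realType}.
Local Notation C := (Cx R).

HB.instance Definition _ (b : R) :=
  GRing.isSubmodClosed.Build C (C -> C) (bloch_pred b) (bloch_closed b).
HB.instance Definition _ (b : R) :=
  GRing.isSubmodClosed.Build C (C -> C) (little_bloch_pred b) (little_bloch_closed b).

Record bloch (b : R) :=
  Bloch { bloch_fun :> C -> C ; bloch_funP : bloch_fun \in bloch_pred b }.

HB.instance Definition _ (b : R) := [isSub for @bloch_fun b].
HB.instance Definition _ (b : R) := [Choice of bloch b by <:].
HB.instance Definition _ (b : R) := [SubChoice_isSubLmodule of bloch b by <:].

Definition bloch_sup (b : R) (f : C -> C) : R :=
  sup [set bloch_weight b f z | z in disk].

Definition bloch_norm (b : R) (f : C -> C) : C :=
  `|f 0| + (bloch_sup b f)%:C.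

Lemma analytic_bloch b (f : bloch b) : analytic f.
Proof. by have /asboolP[] := bloch_funP f. Qed.

Lemma bloch_bound b (f : bloch b) :
  has_ubound [set bloch_weight b f z | z in disk].
Proof. by have /asboolP[] := bloch_funP f. Qed.

Lemma bloch_out b (f : bloch b) z : ~ disk z -> f z = 0.
Proof. by have /asboolP[_ _] := bloch_funP f; exact. Qed.

Lemma bloch_supP b (f : bloch b) z : disk z ->
  bloch_weight b f z <= bloch_sup b f.
Proof. by move=> dz; apply: (ub_le_sup (bloch_bound f)); exists z. Qed.

Lemma bloch_sup_ge0 b (f : bloch b) : 0 <= bloch_sup b f.
Proof. exact: le_trans (weight_ge0 b f 0) (bloch_supP f (@disk0 R)). Qed.

Lemma bloch_sup_le b (f : C -> C) (M : R) :
  (forall z, disk z -> bloch_weight b f z <= M) -> bloch_sup b f <= M.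
Proof.
move=> fM; apply: ge_sup; first by exists (bloch_weight b f 0), 0 => //; exact: disk0.
by move=> _ [z dz <-]; exact: fM.
Qed.

Lemma bloch_funD b (f g : bloch b) : (f + g : bloch b) = f + g :> (C -> C).
Proof. by []. Qed.

Lemma bloch_funZ b a (f : bloch b) : (a *: f : bloch b) = a *: (f : C -> C) :> (C -> C).
Proof. by []. Qed.

Lemma bloch_normD b (f g : bloch b) :
  bloch_norm b (f + g : bloch b) <= bloch_norm b f + bloch_norm b g.
Proof.
rewrite /bloch_norm addrACA lerD ?bloch_funD ?ler_normD//.
rewrite -rmorphD lecR; apply: bloch_sup_le => z dz.
have := weight_lin b 1 (analytic_bloch f dz).1 (analytic_bloch g dz).1.
rewrite scale1r ComplexField.Normc.normc1 mul1r => /le_trans; apply.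
exact: lerD (bloch_supP f dz) (bloch_supP g dz).
Qed.

Lemma bloch_supZ_le b a (f : bloch b) :
  bloch_sup b (a *: f : bloch b) <= normc a * bloch_sup b f.
Proof.
apply: bloch_sup_le => z dz; rewrite bloch_funZ.
rewrite (weight_scale b a (analytic_bloch f dz).1).
exact: ler_wpM2l (normc_ge0 a) _ _ (bloch_supP f dz).
Qed.

Lemma bloch_normZ b (a : C) (f : bloch b) :
  bloch_norm b (a *: f : bloch b) = `|a| * bloch_norm b f.
Proof.
rewrite /bloch_norm mulrDr -normrM; congr (_ + _).
rewrite (normE a) -rmorphM; congr (_%:C); apply: le_anti.
rewrite bloch_supZ_le /=.
have [->|a0] := eqVneq a 0.
  rewrite ComplexField.Normc.normc0 mul0r; exact: (bloch_sup_ge0 (0 *: f)).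
have na0 : 0 < normc a by rewrite -ltcR -normE normr_gt0.
rewrite -ler_pdivlMl// -ComplexField.Normc.normcV.
have e : a^-1 *: (a *: f) = f by rewrite scalerA (mulVf a0) scale1r.
by have := bloch_supZ_le a^-1 (a *: f); rewrite e.
Qed.

Lemma bloch_norm0_eq0 b (f : bloch b) : bloch_norm b f = 0 -> f = 0.
Proof.
move=> /eqP; rewrite /bloch_norm paddr_eq0//; last by rewrite ler0c bloch_sup_ge0.
rewrite normr_eq0 => /andP[/eqP f00 /eqP[s0]].
apply: val_inj; apply: boolp.funext => z /=.
have [dz|] := pselect (disk z); last by move=> /(bloch_out f).
rewrite (derive0_cst (analytic_bloch f) _ dz)// => w dw.
have := bloch_supP f dw; rewrite s0 /bloch_weight => w0.
have p0 : 0 < (1 - normc w ^+ 2) `^ b.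
  by rewrite powR_gt0// subr_gt0 expr_lt1// normc_ge0.
rewrite pmulr_rle0// in w0.
by apply: ComplexField.Normc.eq0_normc; apply: le_anti; rewrite w0 normc_ge0.
Qed.

HB.instance Definition _ (b : R) := Lmodule_isNormed.Build C (bloch b)
  (@bloch_normD b) (@bloch_normZ b) (@bloch_norm0_eq0 b).

Lemma bloch_normE b (f : bloch b) : `|f| = bloch_norm b f. Proof. by []. Qed.

End bloch.

Section little_bloch.
Context {R : realType}.
Local Notation C := (Cx R).

Lemma normc_re (x : R) : normc (x%:C : C) = `|x|.
Proof. by apply: complexI; rewrite -normE /= normc_def /= expr0n/= addr0 sqrtr_sqr. Qed.

Lemma normc_im (x : R) : normc ((x *i)%C : C) = `|x|.
Proof. by apply: complexI; rewrite -normE /= normc_def /= expr0n/= add0r sqrtr_sqr. Qed.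

Lemma continuous_pair : continuous (fun p : R * R => (p.1 +i* p.2 : C)).
Proof.
move=> [x y]; apply/cvgrPdist_lt => _ /complex_gt0[e e0 ->].
have e20 : 0 < e / 2 by rewrite divr_gt0.
apply: filterS (@nbhsx_ballx _ (R * R)%type (x, y) (e / 2) e20) => p [/= px py].
have -> : (x +i* y : C) - (p.1 +i* p.2) = (x - p.1)%:C + ((y - p.2) *i)%C.
  by apply/eqP; rewrite eq_complex /= !(addr0, add0r) !eqxx.
rewrite normE ltcR; apply: (le_lt_trans (le_normcD _ _)).
rewrite normc_re normc_im [ltRHS]splitr; exact: ltrD px py.
Qed.

Lemma continuous_normc : continuous (fun z : C => normc z : R).
Proof.
move=> z; apply/(@cvgrPdist_lt _ R _ (nbhs z)) => e e0.
have e0C : 0 < (e%:C : C) by rewrite ltcR.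
apply: filterS (@nbhsx_ballx _ C z (e%:C : C) e0C) => w.
rewrite /ball /= normE ltcR; apply: le_lt_trans.
rewrite ler_norml; apply/andP; split.
  rewrite lerNl opprB lerBlDr.
  have -> : normc (z - w) = normc (w - z) by rewrite -normcN opprB.
  by rewrite -{1}(subrK z w); exact: le_normcD.
by rewrite lerBlDr -{1}(subrK w z); exact: le_normcD.
Qed.

Lemma closed_disk_bounded (F : C -> R) (r : R) :
  (forall z, normc z <= r -> {for z, continuous F}) ->
  exists M : R, forall z, normc z <= r -> F z <= M.
Proof.
move=> cF; pose e (p : R * R) : C := p.1 +i* p.2.
pose K := [set p : R * R | normc (e p) <= r].
have clK : closed K.
  apply: (@closed_comp _ _ (fun p => normc (e p)) [set x | x <= r]).
    move=> p _; apply: (@continuous_comp _ _ _ e (fun z => normc z)).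
      exact: continuous_pair.
    exact: continuous_normc.
  exact: closed_le.
have cK : compact K.
  apply: (@subclosed_compact _ _ (`[-r, r] `*` `[-r, r])) => //.
    by apply: compact_setX; exact: segment_compact.
  move=> [x y]; rewrite /K /mkset /e /= => xyr; split; rewrite /= in_itv /= -ler_norml.
    exact: le_trans (normc_ge_Re' (x +i* y)) xyr.
  exact: le_trans (normc_ge_Im' (x +i* y)) xyr.
have cG : {within K, continuous (fun p => F (e p))}.
  apply: continuous_in_subspaceT => p /[!inE] Kp.
  apply: (@continuous_comp _ _ _ e F); first exact: continuous_pair.
  exact: cF.
have /compact_bounded[M [_ MP]] := continuous_compact cG cK.
exists (M + 1) => z zr; apply: le_trans (ler_norm _) _.
apply: (MP (M + 1)); first by rewrite ltrDl.
by exists (complex.Re z, complex.Im z) => /=; rewrite /K /e /=; case: z zr.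
Qed.

Lemma little_bloch_sub b (f : C -> C) :
  f \in little_bloch_pred b -> f \in bloch_pred b.
Proof.
move=> /asboolP[af lf f0]; apply/asboolP; split => //.
have [d /= d0 dP] := lf 1 ltr01.
pose r := 1 - (Num.min d 1) / 2.
have m0 : 0 < Num.min d 1 by rewrite lt_min d0 ltr01.
have r1 : r < 1 by rewrite /r ltrBlDr ltrDl divr_gt0.
have r0 : 0 < r.
  rewrite /r subr_gt0 ltr_pdivrMr// mul1r.
  by apply: (@le_lt_trans _ _ 1); rewrite ?ge_min ?lexx ?orbT// ltr1n.
have [|M MP] := @closed_disk_bounded (fun z => normc (derive1 f z)) r.
  move=> z zr; have dz : disk z by exact: le_lt_trans zr r1.
  apply: (@continuous_comp _ _ _ (derive1 f) (fun w => normc w)).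
    exact: (af z dz).2.
  exact: continuous_normc.
pose c := expR (`|b| * - ln (1 - r ^+ 2)).
exists (Num.max 1 (c * Num.max M 0)) => _ [z dz <-].
rewrite le_max; have [zr|rz] := leP (normc z) r; last first.
  apply/orP; left; apply/ltW/(dP (normc z)) => //.
  change (`|1 - normc z| < d).
  rewrite gtr0_norm ?subr_gt0// ltrBlDr -ltrBlDl; apply: le_lt_trans rz.
  rewrite lerB// ler_pdivrMr// ?ge_min mulr_natr mulr2n.
  by apply/orP; left; rewrite lerDl ltW.
apply/orP; right; rewrite /bloch_weight.
have r21 : 0 < 1 - r ^+ 2 by rewrite subr_gt0 expr_lt1// ltW.
have lez : 1 - r ^+ 2 <= 1 - normc z ^+ 2.
  by rewrite lerB// ler_sqr ?nnegrE ?normc_ge0// ltW.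
have z21 : 0 < 1 - normc z ^+ 2 := lt_le_trans r21 lez.
apply: ler_pM; rewrite ?powR_ge0 ?normc_ge0//; last first.
  by rewrite le_max MP.
rewrite /powR gt_eqF// ler_expR.
apply: le_trans (ler_norm _) _; rewrite normrM ler_wpM2l//.
have lz0 : ln (1 - normc z ^+ 2) <= 0.
  by apply: ln_le0; rewrite gerBl exprn_ge0// normc_ge0.
by rewrite ler0_norm// lerN2 ler_ln.
Qed.

End little_bloch.

Section little_bloch_type.
Context {R : realType}.
Local Notation C := (Cx R).

Record little_bloch (b : R) := LittleBloch {
  little_bloch_fun :> C -> C ;
  little_bloch_funP : little_bloch_fun \in little_bloch_pred b }.

HB.instance Definition _ (b : R) := [isSub for @little_bloch_fun b].
HB.instance Definition _ (b : R) := [Choice of little_bloch b by <:].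
HB.instance Definition _ (b : R) :=
  [SubChoice_isSubLmodule of little_bloch b by <:].

(* The little Bloch space is normed by the same formula as the Bloch space, so
   this inclusion is isometric. *)
Definition little_incl (b : R) (f : little_bloch b) : bloch b :=
  Bloch (little_bloch_sub (little_bloch_funP f)).

Lemma little_incl_is_linear b : linear (@little_incl b).
Proof. by move=> a f g; exact: val_inj. Qed.

HB.instance Definition _ (b : R) :=
  GRing.isLinear.Build C (little_bloch b) (bloch b) _ (@little_incl b)
    (@little_incl_is_linear b).

Lemma little_normD b (f g : little_bloch b) :
  bloch_norm b (f + g : little_bloch b) <= bloch_norm b f + bloch_norm b g.
Proof. exact: (bloch_normD (little_incl f) (little_incl g)). Qed.

Lemma little_normZ b (a : C) (f : little_bloch b) :
  bloch_norm b (a *: f : little_bloch b) = `|a| * bloch_norm b f.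
Proof. exact: (bloch_normZ a (little_incl f)). Qed.

Lemma little_norm0_eq0 b (f : little_bloch b) : bloch_norm b f = 0 -> f = 0.
Proof.
move=> f0; apply: val_inj; change (little_incl f = 0 :> (C -> C)).
by rewrite (@bloch_norm0_eq0 _ b (little_incl f) f0).
Qed.

HB.instance Definition _ (b : R) := Lmodule_isNormed.Build C (little_bloch b)
  (@little_normD b) (@little_normZ b) (@little_norm0_eq0 b).

Lemma little_incl_norm b (f : little_bloch b) : `|little_incl f| = `|f|.
Proof. by []. Qed.

End little_bloch_type.

Section nuclear.
Context {R : realType}.
Local Notation C := (Cx R).
Implicit Types X Y : normedModType C.

Definition dual_norm X (x' : X -> C) : \bar R :=
  ereal_sup [set (normc (x' x))%:E | x in [set x : X | `|x| <= 1]].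

(* No linearity is asked of T: the expansion forces it. The duals are the
   continuous linear forms, and the expansion converges in the norm of Y. *)
Definition nuclear X Y (T : X -> Y) :=
  exists (x' : nat -> {linear X -> C}) (y : nat -> Y),
    [/\ forall k, continuous (x' k),
        (\sum_(0 <= k <oo) (dual_norm (x' k) * (complex.Re `|y k|)%:E) < +oo)%E &
        forall x, series (fun k => x' k x *: y k) @ \oo --> T x].

End nuclear.

Section volterra.
Context {R : realType}.
Local Notation C := (Cx R).

Definition cintegral01 (h : R -> C) : C :=
  (\int[lebesgue_measure]_(t in `[0, 1]) complex.Re (h t)) +i*
  (\int[lebesgue_measure]_(t in `[0, 1]) complex.Im (h t)).

(* int_0^z f(phi(w)) g'(w) dw, along the segment w = t z with 0 <= t <= 1; the
   integrand is analytic, so the path is immaterial. *)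
Definition volterra (g phi f : C -> C) (z : C) : C :=
  z * cintegral01 (fun t => f (phi (t%:C * z)) * derive1 g (t%:C * z)).

(* Integral over the disk against dA = dx dy / pi. *)
Definition disk_integral (F : C -> \bar R) : \bar R :=
  ((pi^-1)%:E * \int[lebesgue_measure \x lebesgue_measure]_(p in
     [set p : R * R | disk (p.1 +i* p.2 : C)]) F (p.1 +i* p.2))%E.

End volterra.

(* Main.v *)
Require Import Defs.
From HB Require Import structures.
From mathcomp Require Import all_boot all_order all_algebra complex.
From mathcomp Require Import all_classical all_reals all_analysis.
From mathcomp Require Import measurable_realfun ring lra zify.
Set Implicit Arguments.
Unset Strict Implicit.
Unset Printing Implicit Defensive.
Import Order.TTheory GRing.Theory Num.Theory numFieldNormedType.Exports.
Local Open Scope classical_set_scope.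
Local Open Scope ring_scope.
Local Open Scope complex_scope.

(* Since (T f)' = f(phi) g', bounds for T are bounds for w |f(phi)| with
   w(z) = (1 - |z|^2)^gamma |g'(z)|. For dyadic points zeta_(n,l) on the circle of
   radius 1 - 2^-n put S_a(v) = sup_z w(z) / |1 - conj(v) phi(z)|^a. Up to constants,
   (c) says that sum_n 2^(n (beta - 1 - a)) sum_l S_a(zeta_(n,l)) is finite for
   a = alpha + 2, and this does not depend on a > beta, so a may be an integer A.

   (a) gives the dyadic condition: sums of the functions (1 - conj(zeta_(n,l)) v)^-A
   with the coefficients 2^(n (beta - 1 - A)) and arbitrary unimodular factors are
   bounded in the little Bloch space (a discrete Forelli-Rudin estimate), so pairing
   them with the functionals of a nuclear expansion bounds the dyadic sum by
   sum_k |x'_k| |y_k|.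

   The dyadic condition gives (b): a Richardson combination L_n f of dilations of f
   converges to f, and L_n f - L_(n-1) f is the integral of f over a circle of
   radius about 1 - 2^-n against a kernel of size 2^n (2^n |1 - conj(xi) v|)^-A.
   Replacing these Cauchy integrals by means over 2^m-th roots of unity, and
   telescoping in m, expands T into point evaluations tensored with images of
   kernels, which is summable by the dyadic condition. Means over roots of unity
   also serve to prove Cauchy's formula. *)

(** Dilations of a Bloch function need not converge to it in norm, since they lie in the closed
    subspace of little Bloch functions. They converge pointwise, and this suffices: the terms of the
    expansion of T are absolutely summable in the target, and pointwise convergence at the points
    phi(z) identifies the sum. The difference of two plain dilations has a kernel with only two
    Cauchy factors, while f grows like 2^(n (beta - 1)) on the n-th circle and S_A with A > beta has
    to appear. Richardson extrapolation supplies A = N + 2 factors; A is an integer so that the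
    kernels are plain powers. Refining the mean on the n-th circle j more times gains a factor 2^-j,
    because f and the kernel are Lipschitz at scale 2^-n; this makes the double sum over circles and
    refinements converge. The condition alpha > beta - 2 enters in lowering the exponent from A to
    alpha + 2, through a geometric series of ratio 2^(beta - alpha - 2). The supremum in (c) is
    never shown to be measurable: its integral is only compared with those of step functions on
    squares around the dyadic points. *)

(** * Moduli and conjugates of complex numbers *)

Section modulus.
Context {R : realType}.
Local Notation C := (Cx R).
Implicit Types (x y z : C).

Lemma cmodM x y : normc (x * y) = normc x * normc y.
Proof. exact: ComplexField.Normc.normcM. Qed.

Lemma cmod0 : normc (0 : C) = 0. Proof. exact: ComplexField.Normc.normc0. Qed.

Lemma cmod1 : normc (1 : C) = 1. Proof. exact: ComplexField.Normc.normc1. Qed.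

Lemma cmodV x : normc x^-1 = (normc x)^-1.
Proof. exact: ComplexField.Normc.normcV. Qed.

Lemma cmodX x n : normc (x ^+ n) = normc x ^+ n.
Proof. by elim: n => [|n ih]; rewrite ?expr0 ?cmod1// !exprS cmodM ih. Qed.

Lemma cmodN x : normc (- x) = normc x. Proof. exact: normcN. Qed.

Lemma cmodD x y : normc (x + y) <= normc x + normc y. Proof. exact: le_normcD. Qed.

Lemma cmodB x y : normc (x - y) <= normc x + normc y.
Proof. by rewrite -(cmodN y) cmodD. Qed.

Lemma cmodBC x y : normc (x - y) = normc (y - x).
Proof. by rewrite -cmodN opprB. Qed.

Lemma cmod_triangle z x y : normc (x - y) <= normc (x - z) + normc (z - y).
Proof. by have := cmodD (x - z) (z - y); rewrite addrA subrK. Qed.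

Lemma cmod_ge_sub x y : normc x - normc y <= normc (x - y).
Proof. by rewrite lerBlDr -{1}(subrK y x) cmodD. Qed.

Lemma cmod_gt0 x : (0 < normc x) = (x != 0).
Proof. by rewrite -ltcR -normE normr_gt0. Qed.

Lemma cmod_eq0 x : (normc x == 0) = (x == 0).
Proof. by apply/idP/idP => [/eqP/ComplexField.Normc.eq0_normc->|/eqP->]; rewrite ?cmod0. Qed.

Lemma cmod_sum I (r : seq I) (P : pred I) (F : I -> C) :
  normc (\sum_(i <- r | P i) F i) <= \sum_(i <- r | P i) normc (F i).
Proof.
elim/big_ind2 : _ => [|x1 x2 y1 y2 h1 h2|//]; first by rewrite cmod0.
exact: le_trans (cmodD _ _) (lerD h1 h2).
Qed.

Lemma cmod_nat n : normc (n%:R : C) = n%:R.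
Proof. by have := normc_re (n%:R : R); rewrite rmorph_nat => ->; rewrite ger0_norm. Qed.

Definition cj x : C := x^*.

Lemma cmodJ x : normc (cj x) = normc x.
Proof. by apply: complexI; exact: normcJ. Qed.

Lemma cjD x y : cj (x + y) = cj x + cj y. Proof. exact: rmorphD. Qed.

Lemma cjB x y : cj (x - y) = cj x - cj y. Proof. exact: rmorphB. Qed.

Lemma cjM x y : cj (x * y) = cj x * cj y. Proof. exact: rmorphM. Qed.

Lemma cjK x : cj (cj x) = x. Proof. exact: conjcK. Qed.

Lemma cj0 : cj 0 = 0. Proof. exact: rmorph0. Qed.

Lemma cj1 : cj 1 = 1. Proof. exact: rmorph1. Qed.

Lemma cjV x : cj x^-1 = (cj x)^-1. Proof. exact: conjc_inv. Qed.

Lemma cjX x n : cj (x ^+ n) = cj x ^+ n.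
Proof. by elim: n => [|n ih]; rewrite ?expr0 ?cj1// !exprS cjM ih. Qed.

Lemma cj_nat n : cj n%:R = n%:R. Proof. exact: rmorph_nat. Qed.

Lemma cj_sum I (r : seq I) (P : pred I) (F : I -> C) :
  cj (\sum_(i <- r | P i) F i) = \sum_(i <- r | P i) cj (F i).
Proof. by elim/big_rec2 : _ => [|i y x _ <-]; rewrite ?cj0 ?cjD. Qed.

Lemma ReM_conj x : complex.Re (cj x * x : C) = normc x ^+ 2.
Proof.
case: x => a b /=; rewrite sqr_sqrtr ?addr_ge0 ?sqr_ge0//.
by rewrite !expr2 mulNr opprK.
Qed.

Lemma ReD x y : complex.Re (x + y : C) = complex.Re x + complex.Re y.
Proof. by case: x y => ? ? []. Qed.

Lemma ReB x y : complex.Re (x - y : C) = complex.Re x - complex.Re y.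
Proof. by case: x y => ? ? []. Qed.

Lemma Re_realM (r : R) x : complex.Re (r%:C * x : C) = r * complex.Re x.
Proof. by case: x => a b /=; rewrite mul0r subr0. Qed.

Lemma cmod_split x y z (e : R) :
  normc (x - y) < e / 2 -> normc (x - z) < e / 2 -> normc (y - z) < e.
Proof.
move=> xy xz; apply: le_lt_trans (cmod_triangle x _ _) _.
by rewrite cmodBC [ltRHS]splitr ltrD.
Qed.

Lemma Re_le_cmod x : complex.Re x <= normc x.
Proof. exact: le_trans (ler_norm _) (normc_ge_Re' x). Qed.

(** Reduces estimates of moduli to estimates of real parts, and supplies the unimodular factors of
    the test functions. *)
Lemma cmod_rotate x : exists2 u : C, normc u = 1 & u * x = (normc x)%:C.
Proof.
have [->|x0] := eqVneq x 0; first by exists 1; rewrite ?cmod1// cmod0 mulr0.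
have nx : normc x != 0 by rewrite cmod_eq0.
exists ((normc x)^-1%:C * cj x).
  by rewrite cmodM cmodJ normc_re ger0_norm ?invr_ge0 ?normc_ge0// mulVf.
rewrite -mulrA; have -> : cj x * x = ((normc x) ^+ 2)%:C :> C.
  apply/eqP; rewrite eq_complex -(ReM_conj x) eqxx /=.
  by case: (x) => a b /=; apply/eqP; ring.
by rewrite -rmorphM expr2 mulrA mulVf// mul1r.
Qed.

End modulus.

(** * Differentiation along paths and the mean value inequality *)

Section path_calculus.
Context {R : realType}.
Local Notation C := (Cx R).
Implicit Types (f : C -> C) (h : R -> C) (z d : C).

Lemma derivable_eps f z (e : R) : derivable f z 1 -> 0 < e ->
  exists2 r : R, 0 < r & forall k, normc k < r ->
    normc (f (z + k) - f z - derive1 f z * k) <= e * normc k.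
Proof.
move=> df e0.
have H : _ --> 'D_1 f z := df.
rewrite -derive1E in H.
have e0C : 0 < (e%:C : C) by rewrite ltcR.
have N : \forall k \near 0^', normc (derive1 f z - k^-1 * (f (k + z) - f z)) < e.
  move/cvgrPdist_lt : H => /(_ _ e0C); apply: filterS => k.
  rewrite normE ltcR; congr (normc (_ - _ * (f (_ + _) - _)) < _).
  exact: mulr1.
case: (proj1 (@nbhs_ballP _ _ _ _) N) => _ /= /complex_gt0[r r0 ->] rP.
exists r => // k kr; have [->|k0] := eqVneq k 0.
  by rewrite addr0 subrr mulr0 subrr cmod0 mulr0.
have := rP k; rewrite /ball /= sub0r normrN normE ltcR => /(_ kr k0) /ltW.
rewrite -(@ler_pM2r _ (normc k)) ?cmod_gt0// -cmodM mulrBl mulrAC mulVf// mul1r.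
by rewrite cmodBC [k + z]addrC.
Qed.

(** An explicit estimate, because the variable is real while the values lie in C, taken here as a
    normed module over itself. *)
Definition path_deriv h (t : R) d := forall e : R, 0 < e -> exists2 r : R, 0 < r &
  forall s : R, `|s| < r -> normc (h (t + s) - h t - d * s%:C) <= e * `|s|.

Lemma path_deriv_comp f (a v : C) (t : R) : derivable f (a + t%:C * v) 1 ->
  path_deriv (fun s => f (a + s%:C * v)) t (v * derive1 f (a + t%:C * v)).
Proof.
move=> df e e0; have V0 : 0 < normc v + 1 by rewrite ltr_wpDl ?normc_ge0.
have [r r0 rP] := derivable_eps df (divr_gt0 e0 V0).
exists (r / (normc v + 1)) => [|s sr]; first by rewrite divr_gt0.
have nk : normc (s%:C * v : C) <= `|s| * (normc v + 1).
  by rewrite cmodM normc_re ler_wpM2l// lerDl.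
have := rP (s%:C * v); rewrite rmorphD mulrDl addrA.
set D := derive1 f _; rewrite -[D * _]/(D * (s%:C * v)).
rewrite (_ : v * D * s%:C = D * (s%:C * v)); last by ring.
move=> /(_ _)/le_trans; apply.
  by apply: le_lt_trans nk _; rewrite -ltr_pdivlMr.
apply: le_trans (_ : e / (normc v + 1) * (`|s| * (normc v + 1)) <= _).
  by rewrite ler_wpM2l// divr_ge0 ?ltW.
by rewrite [`|s| * _]mulrC mulrA divfK ?lt0r_neq0.
Qed.

Lemma path_derivZ (c : C) h t d : path_deriv h t d ->
  path_deriv (fun s => c * h s) t (c * d).
Proof.
move=> hd e e0; have c0 : 0 < normc c + 1 by rewrite ltr_wpDl ?normc_ge0.
have [r r0 rP] := hd _ (divr_gt0 e0 c0).
exists r => // s /rP sP; rewrite -!mulrBr -mulrA -mulrBr cmodM.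
apply: le_trans (_ : (normc c + 1) * (e / (normc c + 1) * `|s|) <= _).
  by apply: ler_pM; rewrite ?normc_ge0// lerDl.
by rewrite mulrA mulrCA divff ?lt0r_neq0// mulr1.
Qed.

Lemma path_derivD h1 h2 t d1 d2 : path_deriv h1 t d1 -> path_deriv h2 t d2 ->
  path_deriv (fun s => h1 s + h2 s) t (d1 + d2).
Proof.
move=> hd1 hd2 e e0; have e20 : 0 < e / 2 by rewrite divr_gt0.
have [r1 r10 rP1] := hd1 _ e20; have [r2 r20 rP2] := hd2 _ e20.
exists (Num.min r1 r2) => [|s]; first by rewrite lt_min r10.
rewrite lt_min => /andP[/rP1 s1 /rP2 s2].
have -> : h1 (t + s) + h2 (t + s) - (h1 t + h2 t) - (d1 + d2) * s%:C =
  (h1 (t + s) - h1 t - d1 * s%:C) + (h2 (t + s) - h2 t - d2 * s%:C) :> C.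
  by ring.
apply: le_trans (cmodD _ _) _.
by apply: le_trans (lerD s1 s2) _; rewrite -mulrDl -splitr.
Qed.

Lemma path_deriv_sum (I : Type) (r : seq I) (h : I -> R -> C) t (d : I -> C) :
  (forall i, path_deriv (h i) t (d i)) ->
  path_deriv (fun s => \sum_(i <- r) h i s) t (\sum_(i <- r) d i).
Proof.
move=> hd; elim: r => [|i r ih].
  move=> e e0; exists 1 => // s _.
  by rewrite !big_nil mul0r !subrr cmod0 mulr_ge0// ltW.
rewrite big_cons => e e0; have [r' r'0 rP] := path_derivD (hd i) ih e0.
by exists r' => // s /rP; rewrite !big_cons.
Qed.

Lemma path_deriv_Re h t d : path_deriv h t d ->
  is_derive t 1 (fun s => complex.Re (h s)) (complex.Re d).
Proof.
move=> hd.
have H : (fun s : R => s^-1 *: (complex.Re (h (s *: 1 + t)) - complex.Re (h t))) @ 0^'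
    --> complex.Re d.
  apply/cvgrPdist_le => e e0; have [r r0 rP] := hd _ e0.
  apply/nbhs_ballP; exists r => //= s; rewrite /ball /= sub0r normrN => sr s0.
  rewrite -(@ler_pM2r _ `|s|) ?normr_gt0//; apply: le_trans (rP s sr).
  rewrite -normrM mulrBl -[_ *: _ in leLHS]/(_ * _) mulrAC mulVf// mul1r.
  rewrite distrC [_ * s]mulrC -Re_realM -!ReB [s *: 1]mulr1 [s + t]addrC mulrC.
  exact: normc_ge_Re'.
by apply: DeriveDef; [apply/cvg_ex; exists (complex.Re d) | exact/cvg_lim].
Qed.

(** The real mean value theorem applies to Re (u h), where u is unimodular and u (h 1 - h 0) is the
    modulus of the increment. *)
Lemma path_mean_value h (d : R -> C) (M : R) :
  (forall t, 0 <= t <= 1 -> path_deriv h t (d t)) ->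
  (forall t, 0 < t < 1 -> normc (d t) <= M) -> normc (h 1 - h 0) <= M.
Proof.
move=> hd dM; have [u u1 ux] := cmod_rotate (h 1 - h 0).
pose F t := complex.Re (u * h t).
have dF (t : R) : 0 <= t <= 1 -> is_derive t 1 F (complex.Re (u * d t)).
  by move=> t01; apply: path_deriv_Re; exact: path_derivZ (hd t t01).
have cF : {within `[0, 1], continuous F}.
  apply: derivable_within_continuous => t; rewrite in_itv /= => t01.
  by have [] := dF t t01.
have [] := @MVT R F (fun t => complex.Re (u * d t)) 0 1 ltr01 _ cF.
  by move=> t; rewrite in_itv /= => /andP[t0 t1]; apply: dF; rewrite !ltW.
move=> t; rewrite in_itv /= => t01; rewrite subr0 mulr1 /F -ReB -mulrBr ux /= => ->.
by apply: le_trans (Re_le_cmod _) _; rewrite cmodM u1 mul1r dM.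
Qed.

Lemma disk_segment (a b : C) (r t : R) : normc a <= r -> normc b <= r ->
  0 <= t <= 1 -> normc (a + t%:C * (b - a)) <= r.
Proof.
move=> ar br /andP[t0 t1].
have -> : a + t%:C * (b - a) = (1 - t)%:C * a + t%:C * b :> C.
  by rewrite rmorphB rmorph1; ring.
apply: le_trans (cmodD _ _) _; rewrite !cmodM !normc_re (ger0_norm t0).
rewrite ger0_norm ?subr_ge0//.
apply: le_trans (_ : (1 - t) * r + t * r <= _); last by rewrite -mulrDl subrK mul1r.
by rewrite lerD// ler_wpM2l// subr_ge0.
Qed.

(** The mean value inequality for f(z) - c z along the segment from a to b. With c = 0 it is a
    Lipschitz bound, with c = f'(a) a first order Taylor bound. *)
Lemma analytic_taylor1 f (a b c : C) (r e : R) : analytic f -> r < 1 ->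
  normc a <= r -> normc b <= r ->
  (forall z, normc z <= r -> normc (z - a) <= normc (b - a) ->
     normc (derive1 f z - c) <= e) ->
  normc (f b - f a - c * (b - a)) <= e * normc (b - a).
Proof.
move=> af r1 ar br fe.
have dt t : 0 <= t <= 1 -> normc (a + t%:C * (b - a)) <= r by exact: disk_segment.
have := @path_mean_value (fun t => f (a + t%:C * (b - a)) + (- c * (b - a)) * t%:C)
   (fun t => (b - a) * derive1 f (a + t%:C * (b - a)) + (- c * (b - a)) * 1) (e * normc (b - a)).
rewrite mul1r mul0r addr0 addrCA subrr addr0 mulr0 addr0 mulr1 addrAC !mulNr; apply.
  move=> t t01; apply: path_derivD.
    by apply: path_deriv_comp; exact: (af _ (le_lt_trans (dt t t01) r1)).1.
  rewrite -[X in path_deriv _ _ X]mulr1.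
  apply: (@path_derivZ _ (fun s : R => s%:C : C) t 1) => e' e'0; exists 1 => // s _.
  by rewrite rmorphD mul1r [_%:C + _]addrC addrK subrr cmod0 mulr_ge0// ltW.
move=> t /andP[t0 t1].
have t01 : 0 <= t <= 1 by rewrite !ltW.
rewrite [c * _]mulrC -mulrBr cmodM mulrC ler_wpM2r ?normc_ge0//.
apply: fe; first exact: dt.
rewrite addrAC subrr add0r cmodM normc_re (ger0_norm (ltW t0)).
by apply: ler_piMl; [exact: normc_ge0 | exact: ltW].
Qed.

Lemma analytic_mean_value f (a b : C) (r M : R) : analytic f -> r < 1 ->
  normc a <= r -> normc b <= r ->
  (forall z, normc z <= r -> normc (derive1 f z) <= M) ->
  normc (f b - f a) <= M * normc (b - a).
Proof.
move=> af r1 ar br fM; have := @analytic_taylor1 f a b 0 r M af r1 ar br.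
by rewrite mul0r subr0; apply => z zr _; rewrite subr0 fM.
Qed.

End path_calculus.

(** * Roots of unity of order 2^n *)

Section roots_of_unity.
Context {R : realType}.
Local Notation C := (Cx R).
Implicit Types (x y z : C).

Definition cis (t : R) : C := cos t +i* sin t.

Lemma cisD s t : cis (s + t) = cis s * cis t.
Proof.
by apply/eqP; rewrite eq_complex /= cosD sinD [cos s * sin t + _]addrC !eqxx.
Qed.

Lemma cis0 : cis 0 = 1.
Proof. by apply/eqP; rewrite eq_complex /= cos0 sin0 !eqxx. Qed.

Lemma cisX t n : cis t ^+ n = cis (t * n%:R).
Proof.
elim: n => [|n ih]; first by rewrite expr0 mulr0 cis0.
by rewrite exprS ih -cisD -natr1 mulrDr mulr1 addrC.
Qed.

Lemma cis_pi : cis pi = -1.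
Proof. by apply/eqP; rewrite eq_complex /= cospi sinpi oppr0 !eqxx. Qed.

Lemma cmod_cis t : normc (cis t) = 1.
Proof. by rewrite /= cos2Dsin2 sqrtr1. Qed.

Lemma sin_le_abs (t : R) : `|sin t| <= `|t|.
Proof.
have h (s : R) : 0 <= s -> `|sin s| <= s.
  move=> s0; have [] := @MVT_segment R sin cos 0 s s0.
    by apply: continuous_subspaceT => u; exact: continuous_sin.
  move=> c _; rewrite sin0 !subr0 => ->; rewrite normrM (ger0_norm s0).
  by rewrite ler_piMl// ler_norml cos_geN1 cos_le1.
have [t0|t0] := leP 0 t; first by rewrite (ger0_norm t0) h.
by rewrite -normrN -sinN (ltr0_norm t0) h// oppr_ge0 ltW.
Qed.

Lemma cos_sub1_le_abs (t : R) : `|cos t - 1| <= `|t|.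
Proof.
have h (s : R) : 0 <= s -> `|cos s - 1| <= s.
  move=> s0; have [] := @MVT_segment R cos (- sin) 0 s s0.
    by apply: continuous_subspaceT => u; exact: continuous_cos.
  move=> c _; rewrite cos0 !subr0 => ->; rewrite normrM (ger0_norm s0).
  by rewrite ler_piMl// fctE normrN ler_norml sin_geN1 sin_le1.
have [t0|t0] := leP 0 t; first by rewrite (ger0_norm t0) h.
by rewrite -cosN (ltr0_norm t0) h// oppr_ge0 ltW.
Qed.

Lemma cis_sub1_le t : normc (cis t - 1) <= 2 * `|t|.
Proof.
have -> : cis t - 1 = (cos t - 1)%:C + ((sin t) *i)%C.
  by apply/eqP; rewrite eq_complex /= add0r addr0 subr0 !eqxx.
apply: le_trans (cmodD _ _) _; rewrite normc_re normc_im mulrDl !mul1r.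
exact: lerD (cos_sub1_le_abs t) (sin_le_abs t).
Qed.

Lemma cis_surj x : normc x = 1 -> exists2 t, - pi <= t <= pi & x = cis t.
Proof.
case: x => a b /= ab1.
have ab : a ^+ 2 + b ^+ 2 = 1.
  by rewrite -[LHS]sqr_sqrtr ?addr_ge0 ?sqr_ge0// ab1 expr1n.
have a1 : -1 <= a <= 1.
  by rewrite -ler_norml -(@expr_le1 _ 2)// -normrX ger0_norm ?sqr_ge0// -ab lerDl sqr_ge0.
have sb : Num.sqrt (1 - a ^+ 2) = `|b|.
  by rewrite -sqrtr_sqr; congr Num.sqrt; lra.
have /andP[p0 p1] : 0 <= acos a <= pi by rewrite acos_ge0// acos_lepi.
have [b0|b0] := leP 0 b.
  exists (acos a); first by rewrite p1 andbT; lra.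
  by apply/eqP; rewrite eq_complex /= acosK ?in_itv//= sin_acos// sb ger0_norm// !eqxx.
exists (- acos a); first by apply/andP; split; lra.
apply/eqP; rewrite eq_complex /= cosN sinN acosK ?in_itv//= sin_acos// sb ltr0_norm//.
by rewrite opprK !eqxx.
Qed.

(** Orders are powers of two so that the roots of one level are among those of every finer level,
    see [omega_pow]. *)
Definition omega n : C := cis (2 * pi / 2 ^+ n).

Lemma omega_pow n j : omega (n + j) ^+ (2 ^ j) = omega n.
Proof.
rewrite cisX; congr cis; rewrite natrX exprD invfM mulrA mulfVK//.
Qed.

Lemma omega0 : omega 0 = 1.
Proof.
by rewrite /omega expr0 divr1 [2 * pi]mulr_natl mulr2n cisD cis_pi mulrNN mulr1.
Qed.

Lemma omega1 : omega 1 = -1.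
Proof. by rewrite /omega expr1 mulrC mulrA mulVf ?mul1r ?cis_pi// pnatr_eq0. Qed.

Lemma omegaX n : omega n ^+ (2 ^ n) = 1.
Proof. by have := omega_pow 0 n; rewrite omega0. Qed.

Lemma cmod_omega n : normc (omega n) = 1. Proof. exact: cmod_cis. Qed.

Lemma omega_neq0 n : omega n != 0.
Proof. by rewrite -cmod_gt0 cmod_omega. Qed.

Lemma cmod_omegaX n l : normc (omega n ^+ l) = 1.
Proof. by rewrite cmodX cmod_omega expr1n. Qed.

Lemma conj_unimodular x : normc x = 1 -> cj x = x^-1.
Proof.
move=> x1; have x0 : x != 0 by rewrite -cmod_gt0 x1.
apply: (mulIf x0); rewrite mulVf//; apply/eqP; rewrite eq_complex ReM_conj x1 expr1n eqxx /=.
by case: (x) => a b /=; apply/eqP; ring.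
Qed.

Lemma pi_le4 : (pi : R) <= 4.
Proof. by have := @pihalf_lt2 R; lra. Qed.

(** The constant is 2 * 2 * 4: |cis t - 1| <= 2 |t| at t = 2 pi / 2^n, with pi <= 4. *)
Lemma omega_sub1_le n : normc (omega n - 1) <= 16 / 2 ^+ n.
Proof.
apply: le_trans (cis_sub1_le _) _; have p0 := @pi_ge0 R.
rewrite ger0_norm ?divr_ge0 ?mulr_ge0 ?exprn_ge0//.
by rewrite mulrA ler_pM2r ?invr_gt0 ?exprn_gt0//; have := pi_le4; lra.
Qed.

Lemma unimodularX_sub1_le x k : normc x = 1 -> normc (x ^+ k - 1) <= k%:R * normc (x - 1).
Proof.
move=> x1; elim: k => [|k ih]; first by rewrite expr0 subrr cmod0 mul0r.
have -> : x ^+ k.+1 - 1 = x * (x ^+ k - 1) + (x - 1) by rewrite exprS; ring.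
apply: le_trans (cmodD _ _) _.
by rewrite cmodM x1 mul1r -natr1 mulrDl mul1r lerD2r.
Qed.

Lemma omegaX_dist n l k : (l <= k)%N ->
  normc (omega n ^+ k - omega n ^+ l) <= (k - l)%:R * (16 / 2 ^+ n).
Proof.
move=> lk; have -> : omega n ^+ k - omega n ^+ l = omega n ^+ l * (omega n ^+ (k - l) - 1).
  by rewrite mulrBr mulr1 -exprD subnKC.
rewrite cmodM cmod_omegaX mul1r.
apply: le_trans (unimodularX_sub1_le _ (cmod_omega n)) _.
by rewrite ler_wpM2l// omega_sub1_le.
Qed.

(* Some power of a nontrivial 2^n-th root of unity is -1, at distance 2 from 1. *)
Lemma omegaX_sep1 n k : (0 < k < 2 ^ n)%N -> 4 / 2 ^+ n <= normc (omega n ^+ k - 1).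
Proof.
move=> /andP[k0 kn]; pose i := logn 2 k; pose q := (k %/ 2 ^ i)%N.
have kE : k = (q * 2 ^ i)%N by rewrite divnK// pfactor_dvdnn.
have oq : odd q.
  by have := @pfactor_coprime 2 k isT k0 => -[m m1 mE]; rewrite /q /i {1}mE mulnK ?expn_gt0//; rewrite coprime2n in m1.
have q0 : (0 < q)%N by case: (q) oq.
have i_n : (i < n)%N.
  rewrite -(ltn_exp2l _ _ (ltnSn 1)); apply: leq_ltn_trans kn.
  by rewrite kE leq_pmull.
have E : (omega n ^+ k) ^+ (2 ^ (n - i.+1)) = -1.
  rewrite -exprM kE -mulnA -expnD addnBA// addnC subnS addnK.
  rewrite mulnC exprM -[in omega n](@ltn_predK i n i_n) -[n.-1.+1]add1n omega_pow omega1.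
  by rewrite -signr_odd oq.
have := @unimodularX_sub1_le (omega n ^+ k) (2 ^ (n - i.+1)) (cmod_omegaX _ _).
rewrite E -opprD cmodN -[1 + 1]/(2%:R) cmod_nat => h.
have pn0 : 0 < (2 ^+ n : R) by rewrite exprn_gt0.
rewrite ler_pdivrMr//.
have : (2 ^ (n - i.+1))%:R * 2 <= 2 ^+ n :> R.
  by rewrite natrX -exprSr ler_eXn2l ?ltr1n// -subSn// subSS leq_subr.
have := normc_ge0 (omega n ^+ k - 1); nra.
Qed.

Lemma omegaX_sep n l k : (l < 2 ^ n)%N -> (k < 2 ^ n)%N -> l != k ->
  4 / 2 ^+ n <= normc (omega n ^+ l - omega n ^+ k).
Proof.
wlog lk : l k / (l < k)%N => [hw|] ln kn lk'.
  have [lk|kl|lk] := ltngtP l k; first exact: hw.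
    by rewrite cmodBC; apply: hw => //; rewrite eq_sym.
  by rewrite lk eqxx in lk'.
have -> : omega n ^+ l - omega n ^+ k = - (omega n ^+ l * (omega n ^+ (k - l) - 1)).
  by rewrite mulrBr mulr1 -exprD subnKC ?opprB// ltnW.
rewrite cmodN cmodM cmod_omegaX mul1r omegaX_sep1// subn_gt0 lk.
by rewrite (leq_ltn_trans (leq_subr _ _)).
Qed.

Lemma omega_dense n x : normc x = 1 ->
  exists2 l, (l < 2 ^ n)%N & normc (x - omega n ^+ l) <= 16 / 2 ^+ n.
Proof.
move=> /cis_surj[t0 /andP[t0p t0m] ->].
have pi0 : 0 < (pi : R) := pi_gt0 R.
have [t [/andP[t1 t2] ->]] : exists t : R, 0 <= t <= 2 * pi /\ cis t0 = cis t.
  have [h|h] := leP 0 t0; first by exists t0; split => //; apply/andP; split; lra.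
  exists (t0 + 2 * pi); split; first by apply/andP; split; lra.
  by rewrite cisD [2 * pi]mulr_natl mulr2n cisD cis_pi mulrNN mulr1 mulr1.
have P0 : 0 < (2 ^+ n : R) by rewrite exprn_gt0.
pose s := t / (2 * pi) * 2 ^+ n.
have tE : t = 2 * pi / 2 ^+ n * s.
  have h : forall a b c : R, a != 0 -> b != 0 -> c = a / b * (c / a * b).
    by move=> a b c a0 b0; field; rewrite a0.
  by apply: h; rewrite gt_eqF// mulr_gt0.
have s0 : 0 <= s by rewrite mulr_ge0 ?divr_ge0// ltW// mulr_gt0.
have sn : s <= 2 ^+ n.
  by rewrite /s -[leRHS]mul1r ler_wpM2r ?(ltW P0)// ler_pdivrMr ?mul1r// mulr_gt0.
pose k := Num.truncn s.
have /andP[k1 k2] : k%:R <= s < k.+1%:R by rewrite /k truncn_itv.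
have D : normc (cis t - omega n ^+ k) <= 16 / 2 ^+ n.
  have -> : cis t - omega n ^+ k = omega n ^+ k * (cis (2 * pi / 2 ^+ n * (s - k%:R)) - 1).
    rewrite mulrBr mulr1 cisX -cisD; congr (cis _ - _); rewrite {1}tE; ring.
  rewrite cmodM cmod_omegaX mul1r; apply: le_trans (cis_sub1_le _) _.
  have c0 : 0 <= 2 * pi / 2 ^+ n :> R by rewrite divr_ge0 ?mulr_ge0 ?ltW.
  rewrite normrM !ger0_norm ?subr_ge0//.
  apply: le_trans (_ : 2 * (2 * pi / 2 ^+ n * 1) <= _).
    by rewrite ler_pM2l// ler_wpM2l// lerBlDr addrC natr1 ltW.
  by rewrite mulr1 mulrA ler_pM2r ?invr_gt0//; have := pi_le4; lra.
(* At the angle 2 pi the truncation is 2^n itself, just out of range; the exponent 0 then gives the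
   same root. *)
have [kn|kn] := ltnP k (2 ^ n); first by exists k.
have kE : k = (2 ^ n)%N.
  by apply/eqP; rewrite eqn_leq kn andbT -(ler_nat R) natrX; exact: le_trans sn.
by exists 0; [rewrite expn_gt0 | move: D; rewrite kE omegaX expr0].
Qed.

Lemma sum_omega n k : (0 < k < 2 ^ n)%N -> \sum_(l < 2 ^ n) (omega n ^+ l) ^+ k = 0.
Proof.
move=> kn; have x1 : omega n ^+ k - 1 != 0.
  rewrite -cmod_gt0; apply: lt_le_trans (omegaX_sep1 kn).
  by rewrite divr_gt0// exprn_gt0.
apply: (mulfI x1); rewrite mulr0.
under eq_bigr do rewrite exprAC.
by rewrite -subrX1 exprAC omegaX expr1n subrr.
Qed.

(** Since (a w)^M = a^M for M = 2^n, each term is a geometric sum of M powers of a w divided by 1 -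
    a^M, and averaging over the roots w kills every power except the zeroth. *)
Lemma mean_geometric n (a : C) : normc a < 1 ->
  (2 ^+ n)^-1 * \sum_(l < 2 ^ n) (1 - a * omega n ^+ l)^-1 = (1 - a ^+ (2 ^ n))^-1.
Proof.
move=> a1; set M := (2 ^ n)%N.
have aM : 1 - a ^+ M != 0.
  rewrite subr_eq0; apply/eqP => /(congr1 (fun x : C => normc x)).
  rewrite cmod1 cmodX => /esym/eqP; rewrite pexpr_eq1 ?normc_ge0 ?expn_gt0//.
  by rewrite lt_eqF.
have E l : (1 - a * omega n ^+ l)^-1 =
    (1 - a ^+ M)^-1 * \sum_(k < M) a ^+ k * (omega n ^+ l) ^+ k.
  have u0 : 1 - a * omega n ^+ l != 0.
    rewrite subr_eq0; apply/eqP => /(congr1 (fun x : C => normc x)).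
    by rewrite cmod1 cmodM cmod_omegaX mulr1 => /eqP; rewrite gt_eqF.
  apply: (mulfI u0); rewrite mulfV// mulrCA.
  under eq_bigr do rewrite -exprMn.
  have := subrX1 (a * omega n ^+ l) M; rewrite exprMn exprAC omegaX expr1n mulr1.
  rewrite -opprB => /eqP; rewrite eqr_oppLR => /eqP H.
  by rewrite -mulNr opprB in H; rewrite -H mulVf.
under eq_bigr do rewrite E.
rewrite -mulr_sumr exchange_big /=.
under eq_bigr do rewrite -mulr_sumr.
have M0 : (0 < M)%N by rewrite expn_gt0.
rewrite (bigD1 (Ordinal M0))//= [X in _ * (_ * (_ + X))]big1 ?addr0; last first.
  move=> k k0; rewrite sum_omega ?mulr0// ltn_ord andbT lt0n.
  by apply: contra k0 => /eqP h; apply/eqP/val_inj.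
under [in LHS]eq_bigr do rewrite expr0.
rewrite expr0 mul1r sumr_const card_ord mulrCA /M -mulr_natl mulr1 natrX.
by rewrite mulVf ?mulr1// expf_neq0// pnatr_eq0.
Qed.

End roots_of_unity.

(** * Cauchy's formula by means over roots of unity *)

Section cauchy.
Context {R : realType}.
Local Notation C := (Cx R).
Implicit Types (f : C -> C) (z : C).

(** Heine-Cantor by a near-covering argument. Only x is confined to the closed disk of radius r; y
    may lie slightly outside it. *)
Lemma derive1_unif_continuous f (r e : R) : analytic f -> r < 1 -> 0 < e ->
  exists2 d : R, 0 < d & forall x y, normc x <= r -> normc (x - y) < d ->
    normc (derive1 f x - derive1 f y) < e.
Proof.
move=> af r1 e0; pose p2c (p : R * R) : C := p.1 +i* p.2.
pose K := [set p : R * R | normc (p2c p) <= r].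
have clK : closed K.
  apply: (@closed_comp _ _ (fun p => normc (p2c p)) [set x | x <= r]).
    move=> p _; apply: (@continuous_comp _ _ _ p2c (fun z => normc z)).
      exact: continuous_pair.
    exact: continuous_normc.
  exact: closed_le.
have cK : compact K.
  apply: (@subclosed_compact _ _ (`[-r, r] `*` `[-r, r])) => //.
    by apply: compact_setX; exact: segment_compact.
  move=> [x y]; rewrite /K /mkset /p2c /= => xyr; split; rewrite /= in_itv /= -ler_norml.
    exact: le_trans (normc_ge_Re' (x +i* y)) xyr.
  exact: le_trans (normc_ge_Im' (x +i* y)) xyr.
pose P (d : R) (p : R * R) := forall y, normc (p2c p - y) < d ->
    normc (derive1 f (p2c p) - derive1 f y) < e.
have /compact_near_coveringP/(_ _ (0:R)^'+ P _)[] := cK.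
  move=> p Kp; have e20 : 0 < e / 2 by rewrite divr_gt0.
  have /cvgrPdist_lt/(_ (e / 2)%:C) := (af _ (le_lt_trans Kp r1)).2.
  rewrite ltcR => /(_ e20) /nbhs_ballP[_ /= /complex_gt0[d d0 ->] dP].
  have d20 : 0 < d / 2 by rewrite divr_gt0.
  have near_p : \forall q \near p, normc (p2c p - p2c q) < d / 2.
    have /cvgrPdist_lt/(_ (d / 2)%:C) := @continuous_pair R p.
    by rewrite ltcR => /(_ d20); apply: filterS => q; rewrite normE ltcR.
  have near_d : \forall x \near (0 : R)^'+, x < d / 2 by exact: nbhs_right_lt.
  exists ([set q | normc (p2c p - p2c q) < d / 2], [set x | x < d / 2]) => //.
  move=> [q x] [/= qp xd] y qy.
  have dd : d / 2 + d / 2 = d by rewrite -splitr.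
  have h1 : normc (derive1 f (p2c p) - derive1 f (p2c q)) < e / 2.
    have := dP (p2c q); rewrite /ball /= !normE !ltcR; apply.
    by apply: lt_trans qp _; lra.
  have h2 : normc (derive1 f (p2c p) - derive1 f y) < e / 2.
    have := dP y; rewrite /ball /= !normE !ltcR; apply.
    apply: le_lt_trans (cmod_triangle (p2c q) _ _) _.
    by apply: lt_le_trans (ltrD qp (lt_trans qy xd)) _; rewrite dd.
  exact: cmod_split h1 h2.
move=> d /= d0 dP; exists (d / 2); first by rewrite divr_gt0.
move=> x y xr; have := dP (d / 2); rewrite /ball /= sub0r normrN gtr0_norm ?divr_gt0//.
rewrite ltr_pdivrMr// mulr_natr mulr2n ltrDl => /(_ d0).
move=> /(_ isT (complex.Re x, complex.Im x)).
by rewrite /P /p2c /K /=; case: x xr => a b xr; apply.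
Qed.

Definition circle_mean n (G : C -> C) : C :=
  (2 ^+ n)^-1 * \sum_(l < 2 ^ n) G (omega n ^+ l).

Lemma circle_mean_le n (G : C -> C) (B : R) :
  (forall x, normc x = 1 -> normc (G x) <= B) -> normc (circle_mean n G) <= B.
Proof.
move=> GB; rewrite cmodM cmodV cmodX (cmod_nat 2).
have P0 : 0 < (2 ^+ n : R) by rewrite exprn_gt0.
rewrite ler_pdivrMl//; apply: le_trans (cmod_sum _ _ _) _.
apply: le_trans (_ : \sum_(l < 2 ^ n) B <= _).
  by apply: ler_sum => l _; rewrite GB// cmod_omegaX.
by rewrite sumr_const card_ord -[B *+ _]mulr_natl natrX.
Qed.

(* With p_l = z + s (rho w^l - z) the increments p_{l+1} - p_l are proportional to
   rho w^l, so the sum of f'(p_l) rho w^l is a telescoping sum up to Taylor errors. *)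
Lemma circle_mean_derive_small f z (rho s d e : R) n : analytic f ->
  normc z <= rho -> 0 < rho < 1 -> 0 < s <= 1 -> (0 < n)%N -> 0 <= e ->
  (forall x y, normc x <= rho -> normc (x - y) < d ->
    normc (derive1 f x - derive1 f y) < e) -> normc (omega n - 1 : C) < d ->
  normc (circle_mean n (fun x => derive1 f (z + s%:C * (rho%:C * x - z)) * (rho%:C * x))) <= e.
Proof.
move=> af zr /andP[r0 r1] /andP[s0 s1] n0 e0 fd wd.
pose p l := z + s%:C * (rho%:C * omega n ^+ l - z).
have pr l : normc (p l) <= rho.
  apply: disk_segment => //; last by rewrite (ltW s0).
  by rewrite cmodM cmod_omegaX mulr1 normc_re gtr0_norm.
have w1 : omega n - 1 != 0 :> C.
  have := @omegaX_sep1 R n 1; rewrite expr1 -cmod_gt0 => h.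
  by apply: lt_le_trans (h _); rewrite ?divr_gt0 ?exprn_gt0// (ltn_exp2l 0) ?n0.
have pS l : p l.+1 - p l = s%:C * (omega n - 1) * (rho%:C * omega n ^+ l).
  by rewrite /p exprS; ring.
have npS l : normc (p l.+1 - p l) = s * normc (omega n - 1 : C) * rho.
  by rewrite pS !cmodM cmod_omegaX mulr1 !normc_re !gtr0_norm.
have T : \sum_(l < 2 ^ n) (f (p l.+1) - f (p l)) = 0.
  rewrite -(big_mkord xpredT (fun l => f (p l.+1) - f (p l))) telescope_sumr//.
  by rewrite /p omegaX expr0 subrr.
have E : normc (\sum_(l < 2 ^ n) derive1 f (p l) * (p l.+1 - p l)) <=
    \sum_(l < 2 ^ n) e * (s * normc (omega n - 1 : C) * rho).
  rewrite -cmodN -[X in normc X]add0r -[X in X - _]T -sumrB.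
  apply: le_trans (cmod_sum _ _ _) _; apply: ler_sum => l _.
  rewrite -(npS l); apply: (analytic_taylor1 af r1) => // y yr yp.
  rewrite cmodBC; apply/ltW/fd => //; rewrite cmodBC; apply: le_lt_trans yp _.
  rewrite npS; apply: le_lt_trans wd.
  rewrite -mulrA mulrCA; apply: ler_piMr; first exact: normc_ge0.
  by rewrite mulr_ile1// ltW.
rewrite cmodM cmodV cmodX (cmod_nat 2) ler_pdivrMl ?exprn_gt0//.
have sw0 : 0 < s * normc (omega n - 1 : C) by rewrite mulr_gt0// cmod_gt0.
rewrite -(ler_pM2l sw0).
have -> : s * normc (omega n - 1 : C) = normc (s%:C * (omega n - 1) : C).
  by rewrite cmodM normc_re gtr0_norm.
rewrite -cmodM mulr_sumr.
under eq_bigr => l _ do rewrite mulrCA -(pS l).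
apply: le_trans E _; rewrite sumr_const card_ord -[_ *+ (2 ^ n)%N]mulr_natl natrX.
rewrite cmodM normc_re (gtr0_norm s0) [leRHS]mulrCA ler_wpM2l ?exprn_ge0//.
by rewrite [leRHS]mulrC ler_wpM2l// ler_piMr ?ltW.
Qed.

Lemma expr_pow2_cvg0 (a e : R) : 0 <= a < 1 -> 0 < e ->
  exists n0, forall n, (n0 <= n)%N -> a ^+ (2 ^ n) < e.
Proof.
move=> /andP[a0 a1] e0.
have : (fun n => a ^+ n) @ \oo --> (0 : R) by apply: cvg_expr; rewrite ger0_norm.
move=> /cvgrPdist_lt/(_ e e0)[n0 _ nP]; exists n0 => n n0n.
have := nP (2 ^ n)%N; rewrite /= sub0r normrN ger0_norm ?exprn_ge0//; apply.
by apply: leq_trans n0n _; rewrite ltnW// ltn_expl.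
Qed.

Lemma omega_cvg1 (e : R) : 0 < e ->
  exists n0, forall n, (n0 <= n)%N -> normc (omega n - 1 : C) < e.
Proof.
move=> e0; have [n0 n0P] := @expr_pow2_cvg0 2^-1 1 ltac:(by rewrite invr_ge0 ler0n invf_lt1// ltr1n) ltr01.
have : (fun n => (2^-1 : R) ^+ n) @ \oo --> (0 : R).
  by apply: cvg_expr; rewrite ger0_norm ?invr_ge0// invf_lt1// ltr1n.
have e16 : 0 < e / 16 by rewrite divr_gt0.
move=> /cvgrPdist_lt/(_ _ e16)[m _ mP]; exists m => n mn.
apply: le_lt_trans (omega_sub1_le n) _.
have := mP n mn; rewrite sub0r normrN ger0_norm ?exprn_ge0 ?invr_ge0//.
by rewrite exprVn ltr_pdivlMr// mulrC.
Qed.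

Lemma circle_mean_pole n (a : C) : normc a < 1 ->
  circle_mean n (fun x => (1 - cj x * a)^-1) = (1 - a ^+ (2 ^ n))^-1.
Proof.
move=> a1; have := @mean_geometric R n (a^* : C); rewrite cmodJ => /(_ a1).
move=> /(congr1 (fun x : C => cj x)).
rewrite [X in _ = X]cjV cjB cj1 cjX cjK => <-.
rewrite /circle_mean cjM cjV cjX cj_nat cj_sum; congr (_ * _).
by apply: eq_bigr => l _; rewrite cjV cjB cj1 cjM cjK mulrC.
Qed.

(** The nodes rho x are contracted to z along z + s (rho x - z), and J(s) is the mean with f taken
    at these points. On |x| = 1 one has rho x - z = rho x (1 - cj x a), so in J' the kernel cancels
    and [circle_mean_derive_small] applies. J(1) is the mean in the statement, and J(0) is f z / (1
    - a^(2^n)) by [circle_mean_pole]. *)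
Lemma cauchy_circle_mean f z (rho e : R) : analytic f -> normc z < rho -> rho < 1 ->
  0 < e -> exists n0, forall n, (n0 <= n)%N ->
  normc (circle_mean n (fun x => f (rho%:C * x) * (1 - cj x * (z / rho%:C))^-1) - f z) < e.
Proof.
move=> af zr r1 e0.
have r0 : 0 < rho := le_lt_trans (normc_ge0 _) zr.
have rC : rho%:C != 0 :> C by rewrite -cmod_gt0 normc_re normr_gt0 gt_eqF.
set a := z / rho%:C.
have a1 : normc a < 1 by rewrite cmodM cmodV normc_re gtr0_norm// ltr_pdivrMr ?mul1r.
have e20 : 0 < e / 2 by rewrite divr_gt0.
have [d d0 dP] := derive1_unif_continuous af r1 e20.
have [n1 n1P] := omega_cvg1 d0.
(* Below 1/2, the power a^(2^n) keeps |1 - a^(2^n)| >= 1/2; the second bound makes J(0) - f z, of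
   size at most 2 |f z| |a|^(2^n), smaller than e / 2. *)
pose e3 := Num.min (2^-1) (e / (4 * (normc (f z) + 1))).
have fz1 : 0 < normc (f z) + 1 by rewrite ltr_wpDl ?normc_ge0.
have e30 : 0 < e3 by rewrite lt_min invr_gt0 ltr0n/= divr_gt0 ?mulr_gt0.
have [n2 n2P] := @expr_pow2_cvg0 (normc a) e3 ltac:(by rewrite normc_ge0) e30.
exists (n1 + n2).+1 => n nn.
have zd : disk z := lt_trans zr r1.
pose J (s : R) : C := (2 ^+ n)^-1 * \sum_(l < 2 ^ n)
   (1 - cj (omega n ^+ l) * a)^-1 * f (z + s%:C * (rho%:C * omega n ^+ l - z)).
pose J' (s : R) : C := (2 ^+ n)^-1 * \sum_(l < 2 ^ n) (1 - cj (omega n ^+ l) * a)^-1 *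
   ((rho%:C * omega n ^+ l - z) * derive1 f (z + s%:C * (rho%:C * omega n ^+ l - z))).
have k0 l : 1 - cj (omega n ^+ l) * a != 0.
  rewrite -cmod_gt0; apply: lt_le_trans (cmod_ge_sub _ _).
  by rewrite cmod1 subr_gt0 cmodM cmodJ cmod_omegaX mul1r.
have dJ t : 0 <= t <= 1 -> path_deriv J t (J' t).
  move=> t01; apply: path_derivZ; apply: path_deriv_sum => l; apply: path_derivZ.
  apply: path_deriv_comp; apply: (af _ _).1.
  apply: le_lt_trans r1; apply: disk_segment => //; first exact: ltW.
  by rewrite cmodM cmod_omegaX mulr1 normc_re gtr0_norm.
have J'e t : 0 < t < 1 -> normc (J' t) <= e / 2.
  move=> /andP[t0 t1].
  have -> : J' t = circle_mean n
      (fun x => derive1 f (z + t%:C * (rho%:C * x - z)) * (rho%:C * x)).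
    congr (_ * _); apply: eq_bigr => l _.
    have alg (k X D : C) : k != 0 -> k^-1 * (X * k * D) = D * X by move=> k00; field.
    rewrite -(alg _ (rho%:C * omega n ^+ l) _ (k0 l)); congr (_ * (_ * _)).
    rewrite (conj_unimodular (cmod_omegaX n l)) /a.
    have w0 : omega n ^+ l != 0 :> C by rewrite expf_neq0// omega_neq0.
    by field; rewrite rC w0.
  apply: (circle_mean_derive_small af (ltW zr)) (dP) _ => //.
  - by rewrite r0.
  - by rewrite t0 ltW.
  - exact: leq_trans nn.
  - exact: ltW.
  - by apply: n1P; apply: leq_trans nn; rewrite leqW// leq_addr.
have := path_mean_value dJ J'e.
have -> : J 1 = circle_mean n (fun x => f (rho%:C * x) * (1 - cj x * a)^-1).
  congr (_ * _); apply: eq_bigr => l _; rewrite mulrC; congr (f _ * _).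
  by rewrite rmorph1 mul1r addrC subrK.
have -> : J 0 = f z * (1 - a ^+ (2 ^ n))^-1.
  rewrite -(circle_mean_pole n a1) mulrCA; congr (_ * _).
  rewrite mulr_sumr; apply: eq_bigr => l _.
  by rewrite rmorph0 mul0r addr0 mulrC.
set S := circle_mean _ _ => SJ.
apply: le_lt_trans (cmod_triangle (f z * (1 - a ^+ (2 ^ n))^-1) _ _) _.
rewrite [ltRHS]splitr; apply: ler_ltD => //.
have ha : normc a ^+ (2 ^ n) < e3.
  by apply: n2P; apply: leq_trans nn; rewrite leqW// leq_addl.
have := ha; rewrite lt_min => /andP[ha1 ha2].
have q0 : 2^-1 <= normc (1 - a ^+ (2 ^ n)).
  apply: le_trans (cmod_ge_sub _ _); rewrite cmod1 cmodX; lra.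
have q00 : 1 - a ^+ (2 ^ n) != 0.
  by rewrite -cmod_gt0; apply: lt_le_trans q0; rewrite invr_gt0.
have -> : f z * (1 - a ^+ (2 ^ n))^-1 - f z =
   f z * a ^+ (2 ^ n) * (1 - a ^+ (2 ^ n))^-1 by field.
rewrite !cmodM cmodV cmodX.
have q1 : (normc (1 - a ^+ (2 ^ n)))^-1 <= 2.
  by rewrite invf_ple ?posrE// (lt_le_trans _ q0)// invr_gt0.
apply: le_lt_trans (_ : (normc (f z) * normc a ^+ (2 ^ n)) * 2 < _).
  by rewrite ler_wpM2l// mulr_ge0 ?exprn_ge0 ?normc_ge0.
have A0 : 0 <= normc a ^+ (2 ^ n) by rewrite exprn_ge0// normc_ge0.
move: ha2; rewrite ltr_pdivlMr ?mulr_gt0// => ha2.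
rewrite ltr_pdivlMr//; have := normc_ge0 (f z); nra.
Qed.

End cauchy.

(** * Differentiating the integral operator *)

Section volterra_derivative.
Context {R : realType}.
Local Notation C := (Cx R).
Implicit Types (f h F : C -> C) (z : C).

Lemma derivable_cts f z : derivable f z 1 -> {for z, continuous f}.
Proof. by move=> /derivable1_diffP/differentiable_continuous. Qed.

Lemma continuous_Re : continuous (fun z : C => complex.Re z : R).
Proof.
move=> z; apply/(@cvgrPdist_lt _ R _ (nbhs z)) => e e0.
have e0C : 0 < (e%:C : C) by rewrite ltcR.
apply: filterS (@nbhsx_ballx _ C z (e%:C : C) e0C) => w.
by rewrite /ball /= normE ltcR; apply: le_lt_trans; rewrite -ReB normc_ge_Re'.
Qed.

Lemma continuous_Im : continuous (fun z : C => complex.Im z : R).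
Proof.
move=> z; apply/(@cvgrPdist_lt _ R _ (nbhs z)) => e e0.
have e0C : 0 < (e%:C : C) by rewrite ltcR.
apply: filterS (@nbhsx_ballx _ C z (e%:C : C) e0C) => w.
rewrite /ball /= normE ltcR; apply: le_lt_trans.
have -> : complex.Im z - complex.Im w = complex.Im (z - w) by case: z w => ? ? [].
exact: normc_ge_Im'.
Qed.

Lemma continuous_realC : continuous (fun t : R => t%:C : C).
Proof.
move=> t; apply/cvgrPdist_lt => _ /complex_gt0[e e0 ->].
apply: filterS (@nbhsx_ballx _ R t e e0) => s.
by rewrite /ball /= normE ltcR -rmorphB normc_re.
Qed.

Lemma integral_dilation (k : R -> R) (r : R) : 0 < r -> continuous k ->
  r * (\int[lebesgue_measure]_(t in `[0, 1]) k (r * t)) =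
  \int[lebesgue_measure]_(t in `[0, r]) k t.
Proof.
move=> r0 ck.
have dE (t : R) : is_derive t 1 (fun t : R => r * t) r.
  apply: (is_derive_eq (is_deriveZ r (is_derive_id t (1 : R)))).
  exact: mulr1.
have dE1 : derive1 (fun t : R => r * t) = cst r.
  by apply: boolp.funext => t; rewrite derive1E; exact: derive_val.
have cr : continuous (fun t : R => r * t).
  by move=> t; apply: continuousM; [exact: cvg_cst | exact: cvg_id].
have ckr : continuous (fun t : R => k (r * t)).
  by move=> t; apply: (@continuous_comp _ _ _ (fun t : R => r * t) k); [exact: cr | exact: ck].
have := @integration_by_substitution_increasing R (fun t : R => r * t) k 0 1 ler01.
rewrite mulr0 mulr1 dE1 => E.
rewrite [in RHS]/Rintegral E; first last.
- exact: continuous_subspaceT.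
- split; first by move=> t _; have [] := dE t.
  + exact: cvg_at_right_filter (cr 0).
  + exact: cvg_at_left_filter (cr 1).
- exact: is_cvg_cst.
- exact: is_cvg_cst.
- by move=> t _; exact: cvg_cst.
- by move=> s t _ _ st; rewrite ltr_pM2l.
rewrite -RintegralZl//; last first.
  apply: continuous_compact_integrable; first exact: segment_compact.
  exact: continuous_subspaceT.
by congr fine; apply: eq_integral => t _ /=; rewrite mulrC.
Qed.

Lemma derive_integral (k : R -> R) (r : R) : 0 < r -> continuous k ->
  is_derive r 1 (fun s => \int[lebesgue_measure]_(t in `[0, s]) k t) (k r).
Proof.
move=> r0 ck.
have [] := @continuous_FTC1 R k (BLeft 0) r (r + 1) _ _ _ _.
- by rewrite ltrDl.
- apply: continuous_compact_integrable; first exact: segment_compact.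
  exact: continuous_subspaceT.
- have : (BLeft 0 < BRight r :> itv_bound R)%O by rewrite bnd_simp ltW.
  by [].
- exact: ck.
by move=> d1 d2; apply: DeriveDef => //; rewrite -derive1E.
Qed.

Definition clamp (u t : R) := Num.max (- u) (Num.min t u).

Lemma clamp_id u t : 0 <= t <= u -> clamp u t = t.
Proof.
move=> /andP[t0 tu]; rewrite /clamp min_l// max_r//.
lra.
Qed.

Lemma norm_clamp u t : 0 <= u -> `|clamp u t| <= u.
Proof.
move=> u0; rewrite ler_norml le_max lexx /= ge_max ge_min lexx orbT andbT.
lra.
Qed.

Lemma continuous_clamp u : 0 <= u -> continuous (clamp u).
Proof.
move=> u0 t; apply/cvgrPdist_lt => e e0.
apply: filterS (@nbhsx_ballx _ R t e e0) => s; rewrite /ball /=; apply: le_lt_trans.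
rewrite /clamp; have [h1|h1] := leP t u; have [h2|h2] := leP s u;
  have [h3|h3] := leP (- u) t; have [h4|h4] := leP (- u) s;
  have [h5|h5] := leP (- u) u; rewrite ?subrr ?normr0//; try lra.
all: rewrite ler_norml; have := ler_norm (t - s); have := ler_norm (s - t);
  rewrite (distrC s t) => ? ?; apply/andP; split; lra.
Qed.

Lemma continuous_ray h z (u : R) : (forall w, disk w -> {for w, continuous h}) ->
  0 <= u -> u * normc z < 1 -> continuous (fun t => h ((clamp u t)%:C * z)).
Proof.
move=> ch u0 uz t.
apply: (@continuous_comp R C C (fun t : R => (clamp u t)%:C * z) h).
  apply: continuousM; last exact: cvg_cst.
  by apply: (@continuous_comp R R C (clamp u) (fun t : R => t%:C)); [exact: continuous_clamp | exact: continuous_realC].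
apply: ch; apply: le_lt_trans uz.
by rewrite cmodM normc_re ler_wpM2r ?normc_ge0// norm_clamp.
Qed.

(** Substitution gives F(r z) = z times the integral of h(t z) for t from 0 to r, and the
    fundamental theorem differentiates this at r = 1. The factor u lets real parts carry the whole
    information. *)
Lemma volterra_ray h F z (u : C) : (forall w, disk w -> {for w, continuous h}) ->
  (forall w, disk w -> F w = w * cintegral01 (fun t => h (t%:C * w))) ->
  disk z -> is_derive (1 : R) 1 (fun r : R => complex.Re (u * F (r%:C * z)))
     (complex.Re (u * (z * h z))).
Proof.
move=> ch FE dz.
(* A factor m > 1 with m |z| < 1: the ray up to m z stays in the disk, so that r can move on both
   sides of 1. *)
pose m := 2^-1 * (1 - normc z) + 1; have z1 : 0 < 1 - normc z by rewrite subr_gt0.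
have m1 : 1 < m by rewrite /m ltrDr mulr_gt0 ?invr_gt0.
have m0 : 0 <= m by rewrite ltW// (lt_trans ltr01).
have mz : m * normc z < 1 by rewrite /m; have := normc_ge0 z; nra.
pose kr t := complex.Re (h ((clamp m t)%:C * z)).
pose ki t := complex.Im (h ((clamp m t)%:C * z)).
have ckr : continuous kr.
  by move=> t; apply: (@continuous_comp _ _ _ (fun t => h ((clamp m t)%:C * z)));
    [exact: continuous_ray | exact: continuous_Re].
have cki : continuous ki.
  by move=> t; apply: (@continuous_comp _ _ _ (fun t => h ((clamp m t)%:C * z)));
    [exact: continuous_ray | exact: continuous_Im].
have [c1 c1m] : clamp m 1 = 1 /\ true by split => //; rewrite clamp_id// ler01 ltW.
pose a := complex.Re (u * z); pose b := complex.Im (u * z).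
have E : \forall r \near (1 : R),
    a * (\int[lebesgue_measure]_(t in `[0, r]) kr t) -
    b * (\int[lebesgue_measure]_(t in `[0, r]) ki t) = complex.Re (u * F (r%:C * z)).
  have n1 : \forall r \near (1 : R), 0 < r by exact: lt_nbhsr.
  have n2 : \forall r \near (1 : R), r < m by exact: lt_nbhsl.
  apply: filterS2 n1 n2 => r r0 rm.
  have drz : disk (r%:C * z).
    rewrite /disk /mkset cmodM normc_re gtr0_norm//; apply: le_lt_trans mz.
    by rewrite ler_wpM2r ?normc_ge0// ltW.
  rewrite FE// -(integral_dilation r0 ckr) -(integral_dilation r0 cki).
  have Ek t : t \in `[0, 1]%classic -> h (t%:C * (r%:C * z)) = h ((clamp m (r * t))%:C * z).
    rewrite inE /= in_itv /= => /andP[t0 t1]; rewrite clamp_id ?mulrA -?rmorphM ?[t * r]mulrC//.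
    rewrite mulr_ge0 ?(ltW r0)//=; apply: le_trans (ltW rm).
    by rewrite ler_piMr// ltW.
  set P := \int[_]_(_ in _) _; set Q := \int[_]_(_ in _) _.
  have -> : cintegral01 (fun t : R => h (t%:C * (r%:C * z))) = P +i* Q.
    by congr (_ +i* _); apply: eq_Rintegral => t /Ek /= ->.
  have -> : u * (r%:C * z * (P +i* Q)) = r%:C * (u * z * (P +i* Q)) :> C by ring.
  rewrite Re_realM /a /b.
  by case: (u * z) => c d /=; ring.
apply: (near_eq_is_derive E).
have -> : complex.Re (u * (z * h z)) = a * kr 1 - b * ki 1.
  by rewrite /kr /ki c1 mul1r mulrA /a /b; case: (u * z) (h z) => c d [c' d'].
by apply: is_deriveB; apply: is_deriveZ; exact: derive_integral.
Qed.

(** As F is analytic, F' can be read off along rays: the chain rule gives w F'(w) and [volterra_ray]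
    gives w h(w). At 0 the factor w loses the information, and continuity of F' and h replaces
    it. *)
Lemma volterra_derive1 h F z : (forall w, disk w -> {for w, continuous h}) ->
  analytic F ->
  (forall w, disk w -> F w = w * cintegral01 (fun t => h (t%:C * w))) ->
  disk z -> derive1 F z = h z.
Proof.
move=> ch aF FE.
have nz w : disk w -> w != 0 -> derive1 F w = h w.
  move=> dw w0; apply: (mulfI w0); apply/eqP; rewrite -subr_eq0 -cmod_eq0.
  (* With the difference d and the multiplier cj d, the real part that is known to vanish is
     |d|^2. *)
  set d := _ - _; suff : complex.Re (cj d * d) = 0 by rewrite ReM_conj => /eqP; rewrite sqrf_eq0.
  have p0 : path_deriv (fun s => F (0 + s%:C * w)) 1 (w * derive1 F (0 + 1%:C * w)).
    by apply: path_deriv_comp; rewrite add0r mul1r; exact: (aF w dw).1.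
  have := path_deriv_Re (path_derivZ (cj d) p0); rewrite add0r mul1r.
  have -> : (fun s : R => complex.Re (cj d * F (0 + s%:C * w))) =
      (fun s : R => complex.Re (cj d * F (s%:C * w))).
    by apply: boolp.funext => s; rewrite add0r.
  move=> [_ e1]; have [_ e2] := volterra_ray (cj d) ch FE dw.
  by rewrite /d mulrBr ReB -e1 -e2 subrr.
have [->|z0] := eqVneq z 0; last by move=> dz; exact: nz.
move=> d0; apply/eqP; rewrite -subr_eq0 -cmod_eq0; apply/eqP/le_anti.
rewrite normc_ge0 andbT; apply/ler_addgt0Pr => e e0; rewrite add0r.
have e20 : 0 < e / 2 by rewrite divr_gt0.
have /cvgrPdist_lt/(_ (e / 2)%:C) := (aF 0 d0).2; rewrite ltcR => /(_ e20) n1.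
have /cvgrPdist_lt/(_ (e / 2)%:C) := ch 0 d0; rewrite ltcR => /(_ e20) n2.
have [_ /= /complex_gt0[r r0 ->] rP] := proj1 (@nbhs_ballP _ _ _ _)
  (filterI (near_disk d0) (filterI n1 n2)).
have := rP ((r / 2)%:C); rewrite /ball /= sub0r normrN normE normc_re.
rewrite gtr0_norm ?divr_gt0// ltcR => /(_ _)[].
  by rewrite ltr_pdivrMr// mulr_natr mulr2n ltrDl.
move=> dr; rewrite !normE !ltcR => -[h1 h2].
have r20 : (r / 2)%:C != 0 :> C by rewrite -cmod_gt0 normc_re normr_gt0 gt_eqF// divr_gt0.
rewrite -(nz _ dr r20) in h2.
by rewrite ltW//; apply: cmod_split; rewrite cmodBC; eassumption.
Qed.

End volterra_derivative.

(** * Growth of Bloch functions, and the kernels (1 - a z)^-k *)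

Section bloch_functions.
Context {R : realType}.
Local Notation C := (Cx R).
Implicit Types (f : C -> C) (z : C).

Definition bnorm (b : R) f : R := normc (f 0) + bloch_sup b f.

Lemma bloch_norm_real b (f : bloch b) : `|f| = (bnorm b f)%:C.
Proof. by rewrite bloch_normE /bloch_norm normE -rmorphD. Qed.

Lemma bnorm_ge0 b (f : bloch b) : 0 <= bnorm b f.
Proof. by rewrite addr_ge0 ?normc_ge0 ?bloch_sup_ge0. Qed.

Lemma weight_le_bnorm b (f : bloch b) z : disk z -> bloch_weight b f z <= bnorm b f.
Proof. by move=> dz; rewrite -[leLHS]add0r lerD ?normc_ge0 ?bloch_supP. Qed.

Definition rad n : R := 1 - 2 ^- n.

Lemma rad_lt1 n : rad n < 1.
Proof. by rewrite /rad ltrBlDr ltrDl invr_gt0 exprn_gt0. Qed.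

Lemma rad_ge0 n : 0 <= rad n.
Proof. by rewrite /rad subr_ge0 invf_le1 ?exprn_gt0// exprn_ege1// ler1n. Qed.

Lemma rad_le m n : (m <= n)%N -> rad m <= rad n.
Proof.
by move=> mn; rewrite lerB// lef_pV2 ?posrE ?exprn_gt0// ler_weXn2l// ler1n.
Qed.

Lemma powR_exprn (x b : R) n : 0 <= x -> (x ^+ n) `^ b = (x `^ b) ^+ n.
Proof.
move=> x0; elim: n => [|n ih]; first by rewrite !expr0 powR1.
by rewrite !exprS powRM ?exprn_ge0// ih.
Qed.

Lemma powR_inv (x b : R) : 0 < x -> x^-1 `^ b = (x `^ b)^-1.
Proof.
move=> x0; apply: (@mulIf _ (x `^ b)); first by rewrite gt_eqF// powR_gt0.
by rewrite -powRM ?invr_ge0 ?(ltW x0)// !mulVf ?powR1// gt_eqF// powR_gt0.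
Qed.

Lemma powR_pow2V (b : R) n : (2 ^- n) `^ b = (2 `^ b) ^- n.
Proof. by rewrite powR_inv ?exprn_gt0// powR_exprn. Qed.

Lemma ltr_pow2R (b c : R) : b < c -> 2 `^ b < 2 `^ c :> R.
Proof.
by move=> bc; rewrite /powR gt_eqF// ltr_expR ltr_pM2r// ln_gt0// ltr1n.
Qed.

Lemma bloch_derive_bound b (f : bloch b) z n : 0 <= b -> normc z <= rad n ->
  normc (derive1 f z) <= bnorm b f * (2 `^ b) ^+ n.
Proof.
move=> b0 zn; have dz : disk z := le_lt_trans zn (rad_lt1 n).
have P0 : 0 < 2 `^ b :> R by rewrite powR_gt0.
rewrite -ler_pdivrMr ?exprn_gt0// mulrC; apply: le_trans (weight_le_bnorm f dz).
rewrite /bloch_weight ler_wpM2r ?normc_ge0// -powR_pow2V.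
have z0 := normc_ge0 z; have p0 : 0 < (2 ^- n : R) by rewrite invr_gt0 exprn_gt0.
have h : 2 ^- n <= 1 - normc z ^+ 2 by move: zn p0; rewrite /rad; nra.
by apply: ge0_ler_powR => //; rewrite nnegrE ltW// (lt_le_trans p0).
Qed.

(** Crossing the shell between [rad n] and [rad n.+1] changes f by at most |f| 2^(b (n+1)) 2^-(n+1)
    = |f| q^(n+1). As b > 1, q > 1 and the geometric sum is dominated by its last term, up to the
    factor q / (q - 1). *)
Lemma bloch_growth b (f : bloch b) z n : 1 < b -> normc z <= rad n ->
  normc (f z) <= bnorm b f * ((2 `^ b / 2) / (2 `^ b / 2 - 1)) * (2 `^ b / 2) ^+ n.
Proof.
move=> b1; set q := 2 `^ b / 2.
have q1 : 1 < q.
  by rewrite /q ltr_pdivlMr// mul1r -[ltLHS]powRr1// ltr_pow2R.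
have q0 : 0 < q := lt_trans ltr01 q1.
have N0 := bnorm_ge0 f; have q10 : 0 < q - 1 by rewrite subr_gt0.
have b0 : 0 <= b by rewrite ltW// (lt_trans ltr01).
elim: n z => [|n ih] z zn.
  have z0 : z = 0.
    apply/eqP; rewrite -cmod_eq0; apply/eqP/le_anti; rewrite normc_ge0 andbT.
    by apply: le_trans zn _; rewrite /rad expr0 invr1 subrr.
  rewrite z0 expr0 mulr1; apply: le_trans (_ : bnorm b f <= _).
    by rewrite lerDl bloch_sup_ge0.
  by rewrite ler_peMr// ler_pdivlMr// mul1r lerBlDr lerDl.
have [zr|zr] := leP (normc z) (rad n).
  apply: le_trans (ih z zr) _; rewrite ler_wpM2l ?mulr_ge0 ?invr_ge0 ?(ltW q0) ?(ltW q10)//.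
  by rewrite ler_weXn2l// ltW.
have z0 : 0 < normc z := le_lt_trans (rad_ge0 n) zr.
(* The radial projection of z onto the circle of radius [rad n]. *)
pose z' : C := (rad n / normc z)%:C * z.
have z'n : normc z' = rad n.
  rewrite cmodM normc_re ger0_norm ?divr_ge0 ?rad_ge0 ?normc_ge0//.
  by rewrite divfK// gt_eqF.
have zz' : normc (z - z') <= 2 ^- n.+1.
  have -> : z - z' = (1 - rad n / normc z)%:C * z by rewrite rmorphB rmorph1 mulrBl mul1r.
  rewrite cmodM normc_re ger0_norm; last by rewrite subr_ge0 ler_pdivrMr// mul1r ltW.
  rewrite mulrBl mul1r divfK ?gt_eqF//; move: zn; rewrite /rad exprS invfM => zn.
  by have : 0 < (2 ^- n : R) by [rewrite invr_gt0 exprn_gt0]; lra.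
have z'n1 : normc z' <= rad n.+1 by rewrite z'n rad_le.
have D := @analytic_mean_value R f z' z (rad n.+1) (bnorm b f * (2 `^ b) ^+ n.+1)
  (analytic_bloch f) (rad_lt1 n.+1) z'n1 zn
  (fun w wr => bloch_derive_bound f b0 wr).
have H : normc (f z - f z') <= bnorm b f * q ^+ n.+1.
  apply: le_trans D _; rewrite -mulrA ler_wpM2l// /q expr_div_n ler_wpM2l//.
have := cmodD (f z - f z') (f z'); rewrite subrK => /le_trans; apply.
apply: le_trans (lerD H (ih z' _)) _; first by rewrite z'n.
rewrite -[X in _ + X]mulrA -[leRHS]mulrA -mulrDr ler_wpM2l// exprS.
have Q0 : 0 <= q ^+ n by rewrite exprn_ge0// ltW.
have -> : q / (q - 1) * (q * q ^+ n) = q * q ^+ n + q / (q - 1) * q ^+ n.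
  by field; rewrite gt_eqF.
exact: lexx.
Qed.

Lemma bloch_dist b (f : bloch b) (x y : C) n : 0 <= b -> normc x = 1 -> normc y = 1 ->
  normc (f ((rad n)%:C * x) - f ((rad n)%:C * y)) <= bnorm b f * (2 `^ b) ^+ n * normc (x - y).
Proof.
move=> b0 x1 y1.
have r (u : C) : normc u = 1 -> normc ((rad n)%:C * u) <= rad n.
  by move=> u1; rewrite cmodM u1 mulr1 normc_re ger0_norm ?rad_ge0.
apply: le_trans (analytic_mean_value (analytic_bloch f) (rad_lt1 n) (r _ y1) (r _ x1)
  (fun w wr => bloch_derive_bound f b0 wr)) _.
rewrite -mulrBr cmodM normc_re ger0_norm ?rad_ge0//.
rewrite ler_wpM2l ?mulr_ge0 ?bnorm_ge0 ?exprn_ge0 ?powR_ge0//.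
by rewrite ler_piMl ?normc_ge0// ltW ?rad_lt1.
Qed.

Lemma bounded_derive_little_bloch b f (M : R) : 0 < b -> analytic f ->
  (forall z, disk z -> normc (derive1 f z) <= M) -> (forall z, ~ disk z -> f z = 0) ->
  f \in little_bloch_pred b.
Proof.
move=> b0 af fM f0; apply/asboolP; split => // e e0.
have M0 : 0 <= M := le_trans (normc_ge0 _) (fM 0 (@disk0 R)).
have M1 : 0 < M + 1 by rewrite ltr_wpDl.
pose d := (e / (M + 1)) `^ b^-1.
have d0 : 0 < d by rewrite powR_gt0// divr_gt0.
have db : d `^ b = e / (M + 1) by rewrite -powRrM mulVf ?gt_eqF// powRr1// divr_ge0 ?ltW.
have n1 : \forall r \near (1 : R)^'-, r < 1 by exact: nbhs_left_lt.
have n2 : \forall r \near (1 : R)^'-, 1 - d / 2 < r.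
  by apply: nbhs_left_gt; rewrite ltrBlDr ltrDl divr_gt0.
apply: filterS2 n1 n2 => r r1 rd z zr.
have dz : disk z by rewrite /disk /mkset zr.
have z0 := normc_ge0 z; rewrite zr in z0.
have h0 : 0 < 1 - r ^+ 2 by nra.
have h1 : 1 - r ^+ 2 < d by nra.
rewrite /bloch_weight zr; apply: le_lt_trans (_ : (e / (M + 1)) * M < _).
  apply: ler_pM; rewrite ?powR_ge0 ?normc_ge0 ?fM// -db.
  by apply: ge0_ler_powR; rewrite ?nnegrE ?ltW.
by rewrite mulrAC ltr_pdivrMr// ltr_pM2l// ltrDl.
Qed.

Definition kern_fun k (a z : C) : C := if `[< disk z >] then (1 - a * z)^-1 ^+ k else 0.

Lemma kern_funE k a z : disk z -> kern_fun k a z = (1 - a * z)^-1 ^+ k.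
Proof. by move=> dz; rewrite /kern_fun; case: asboolP. Qed.

Lemma cmod_sub1_ge (a z : C) : disk z -> 1 - normc a <= normc (1 - a * z).
Proof.
move=> dz; apply: le_trans (cmod_ge_sub _ _); rewrite cmod1 cmodM lerB//.
by rewrite ler_piMr ?normc_ge0// ltW.
Qed.

Lemma cmod_sub1_gt0 (a z : C) : normc a < 1 -> disk z -> 0 < normc (1 - a * z).
Proof. by move=> a1 dz; apply: lt_le_trans (cmod_sub1_ge a dz); rewrite subr_gt0. Qed.

Lemma kern_is_derive k a z : normc a < 1 -> disk z ->
  is_derive z 1 (kern_fun k a) (k%:R * a * (1 - a * z)^-1 ^+ k.+1).
Proof.
move=> a1 dz; pose H (y : C) : C := 1 - a * y.
have Hz : H z != 0 by rewrite -cmod_gt0 cmod_sub1_gt0.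
have dH : is_derive z 1 H (- a).
  apply: (is_derive_eq (is_deriveB (is_derive_cst (1 : C) z 1)
    (is_deriveZ a (is_derive_id z (1 : C))))).
  by rewrite sub0r; congr (- _); exact: mulr1.
have dV : is_derive z 1 (fun y => (H y)^-1) (a * (H z)^-1 ^+ 2).
  have [dH1 dH2] := dH.
  apply: DeriveDef; first exact: derivableV.
  by rewrite deriveV// dH2 -[_ *: _]/(_ * _) mulrNN mulrC exprVn.
have dX := is_deriveX k dV.
have E : \forall y \near z, (fun y => (H y)^-1 ^+ k) y = kern_fun k a y.
  by apply: filterS (near_disk dz) => y dy; rewrite kern_funE.
have dX' : is_derive z 1 (fun y => (H y)^-1 ^+ k)
    (k%:R * a * (1 - a * z)^-1 ^+ k.+1).
  have -> : k%:R * a * (1 - a * z)^-1 ^+ k.+1 =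
      (k%:R * (H z)^-1 ^+ k.-1) *: (a * (H z)^-1 ^+ 2).
    rewrite -[_ *: _]/(_ * _) -/(H z).
    case: (k) => [|m]; first by rewrite !mul0r.
    by rewrite /= !exprS expr0; ring.
  have -> // : (fun y => (H y)^-1 ^+ k) = (fun y => (H y)^-1) ^+ k.
  by apply: boolp.funext => y; elim: (k) => [|m ih]; rewrite ?expr0// !exprS ih.
exact: near_eq_is_derive E dX'.
Qed.

Lemma kern_derive1 k a z : normc a < 1 -> disk z ->
  derive1 (kern_fun k a) z = k%:R * a * (1 - a * z)^-1 ^+ k.+1.
Proof. by move=> a1 dz; rewrite derive1E; have [_] := kern_is_derive k a1 dz. Qed.

Lemma kern_analytic k a : normc a < 1 -> analytic (kern_fun k a).
Proof.
move=> a1 z dz; split; first by have [] := kern_is_derive k a1 dz.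
have E : \forall w \near z, k%:R * a * kern_fun k.+1 a w = derive1 (kern_fun k a) w.
  by apply: filterS (near_disk dz) => w dw; rewrite kern_derive1// kern_funE.
rewrite /prop_for /continuous_at -(nbhs_singleton E).
apply: (cvg_trans (near_eq_cvg E)); apply: cvgM; first exact: cvg_cst.
by apply: derivable_cts; have [] := kern_is_derive k.+1 a1 dz.
Qed.

Lemma kern_little b k a : 0 < b -> normc a < 1 -> kern_fun k a \in little_bloch_pred b.
Proof.
move=> b0 a1; have a10 : 0 < 1 - normc a by rewrite subr_gt0.
apply: (@bounded_derive_little_bloch b _ (k%:R * ((1 - normc a)^-1 ^+ k.+1))) => //.
- exact: kern_analytic.
- move=> z dz; rewrite kern_derive1// !cmodM cmodX cmodV (cmod_nat k).
  apply: ler_pM; rewrite ?mulr_ge0 ?normc_ge0 ?exprn_ge0 ?invr_ge0 ?normc_ge0//.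
    by rewrite ler_piMr// ltW.
  apply: lerXn2r; rewrite ?nnegrE ?invr_ge0 ?normc_ge0 ?(ltW a10)//.
  by rewrite lef_pV2 ?posrE ?cmod_sub1_gt0// cmod_sub1_ge.
- by move=> z dz; rewrite /kern_fun; case: asboolP.
Qed.

(** [insubd] makes the kernel total in a; its default 0 does not occur for b > 0 and |a| < 1, see
    [kernE]. *)
Definition kern b k a : little_bloch b := insubd 0 (kern_fun k a).

Lemma kernE b k a : 0 < b -> normc a < 1 -> kern b k a = kern_fun k a :> (C -> C).
Proof. by move=> b0 a1; rewrite /kern /insubd insubT//; exact: kern_little. Qed.

Lemma bloch_sumE b (I : Type) (r : seq I) (F : I -> bloch b) z :
  (\sum_(i <- r) F i : bloch b) z = \sum_(i <- r) F i z.
Proof.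
elim: r => [|i r ih]; first by rewrite !big_nil.
by rewrite !big_cons -ih.
Qed.

Lemma little_sumE b (I : Type) (r : seq I) (F : I -> little_bloch b) z :
  (\sum_(i <- r) F i : little_bloch b) z = \sum_(i <- r) F i z.
Proof.
elim: r => [|i r ih]; first by rewrite !big_nil.
by rewrite !big_cons -ih.
Qed.

End bloch_functions.

(** * Dyadic points and their ancestors *)

Section dyadic_points.
Context {R : realType}.
Local Notation C := (Cx R).

Definition zeta n l : C := (rad n)%:C * omega n ^+ l.

Lemma cmod_zeta n l : normc (zeta n l) = rad n.
Proof. by rewrite cmodM cmod_omegaX mulr1 normc_re ger0_norm ?rad_ge0. Qed.

Lemma zeta_disk n l : disk (zeta n l).
Proof. by rewrite /disk /mkset cmod_zeta rad_lt1. Qed.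

Lemma rad_omega_dist m j l l' : (l' * 2 ^ j <= l < l'.+1 * 2 ^ j)%N ->
  normc (omega (m + j) ^+ l - omega m ^+ l' : C) <= 16 / 2 ^+ m.
Proof.
move=> /andP[h1 h2].
rewrite -(omega_pow m j) -exprM mulnC; apply: le_trans (omegaX_dist _ h1) _.
have P (k : nat) : 0 < (2 ^+ k : R) by rewrite exprn_gt0.
apply: le_trans (_ : 2 ^+ j * (16 / 2 ^+ (m + j)) <= _).
  rewrite ler_wpM2r ?divr_ge0 ?(ltW (P _))// -natrX ler_nat leq_subLR.
  by move: h2; rewrite mulSn addnC => /ltnW.
by rewrite mulrCA exprD ler_wpM2l// invfM mulrC mulrVK// unitfE gt_eqF.
Qed.

(** The quotient [l %/ 2 ^ j] indexes the ancestor of l at level m. The radial displacement is at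
    most 2^-m and the angular one at most 16 / 2^m. *)
Lemma zeta_parent_dist m j l :
  normc (zeta (m + j) l - zeta m (l %/ 2 ^ j)) <= 17 / 2 ^+ m.
Proof.
have P (k : nat) : 0 < (2 ^+ k : R) by rewrite exprn_gt0.
have -> : zeta (m + j) l - zeta m (l %/ 2 ^ j) = (rad (m + j) - rad m)%:C * omega (m + j) ^+ l
    + (rad m)%:C * (omega (m + j) ^+ l - omega m ^+ (l %/ 2 ^ j)).
  rewrite /zeta; move: (omega (m + j) ^+ l : C) (omega m ^+ (l %/ 2 ^ j)%N : C) => x y.
  by move: (rad (m + j)) (rad m) => a b; rewrite rmorphB mulrBl mulrBr addrA subrK.
apply: le_trans (cmodD _ _) _; rewrite !cmodM cmod_omegaX mulr1 !normc_re.
rewrite [17 / _](_ : _ = 2 ^- m + 16 / 2 ^+ m); last by field; rewrite gt_eqF.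
rewrite lerD//.
  rewrite ger0_norm ?subr_ge0 ?rad_le ?leq_addr// /rad.
  by have : 0 < (2 ^- (m + j) : R) by [rewrite invr_gt0]; lra.
apply: le_trans (_ : normc (omega (m + j) ^+ l - omega m ^+ (l %/ 2 ^ j) : C) <= _).
  by rewrite ler_piMl ?normc_ge0// ger0_norm ?rad_ge0// ltW ?rad_lt1.
by apply: rad_omega_dist; rewrite leq_trunc_div ltn_ceil// expn_gt0.
Qed.

(** Each index at level m is the ancestor of exactly 2^j indices at level m + j. *)
Lemma sum_divn_pow2 m j (u : nat -> R) :
  \sum_(l < 2 ^ (m + j)) u (l %/ 2 ^ j)%N = 2 ^+ j * \sum_(l < 2 ^ m) u l.
Proof.
rewrite -(big_mkord xpredT (fun l => u (l %/ 2 ^ j)%N)) expnD big_nat_mul.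
rewrite big_mkord mulr_sumr; apply: eq_bigr => l _.
under eq_big_nat => i /andP[h1 h2].
  have -> : (i %/ 2 ^ j)%N = l.
    by apply/eqP; rewrite eqn_leq leq_divRL ?expn_gt0// h1 andbT -ltnS ltn_divLR ?expn_gt0.
  over.
by rewrite sumr_const_nat mulSn addnK -[u l *+ _]mulr_natl natrX.
Qed.

Lemma geometric_sum_le (x : R) K : 0 <= x < 1 -> \sum_(j < K) x ^+ j <= (1 - x)^-1.
Proof.
move=> /andP[x0 x1]; have x10 : 0 < 1 - x by rewrite subr_gt0.
rewrite -[leRHS]mul1r ler_pdivlMr// mulrC.
have := subrX1 x K => /(congr1 -%R); rewrite opprB -mulNr opprB => <-.
by rewrite lerBlDr lerDl exprn_ge0.
Qed.

Lemma triangular_sum (F : nat -> nat -> R) K :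
  \sum_(n < K) \sum_(m < n.+1) F n m = \sum_(m < K) \sum_(j < K - m) F (m + j)%N m.
Proof.
elim: K => [|K ih]; first by rewrite !big_ord0.
rewrite big_ord_recr ih /= [RHS]big_ord_recr /= subSnn big_ord1 addn0.
under [in RHS]eq_bigr => m _.
  rewrite subSn; last exact/ltnW/ltn_ord.
  rewrite big_ord_recr /= subnKC; last exact/ltnW/ltn_ord.
  over.
by rewrite big_split /= big_ord_recr addrA.
Qed.

End dyadic_points.

(** * The dyadic condition and its independence of the exponent *)

Section carleson.
Context {R : realType}.
Local Notation C := (Cx R).
Context (w : C -> R) (phi : C -> C) (W : R).
Context (w_ge0 : forall z, disk z -> 0 <= w z) (w_le : forall z, disk z -> w z <= W).
Context (phi_disk : forall z, disk z -> disk (phi z)).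

Definition kdist (v : C) z := normc (1 - cj v * phi z).

Lemma kdist_ge v z : disk z -> 1 - normc v <= kdist v z.
Proof. by move=> dz; have := @cmod_sub1_ge R (cj v) _ (phi_disk dz); rewrite cmodJ. Qed.

Lemma kdist_gt0 v z : disk v -> disk z -> 0 < kdist v z.
Proof. by move=> dv dz; apply: lt_le_trans (kdist_ge v dz); rewrite subr_gt0. Qed.

Lemma kdist_le v v' z : disk z -> kdist v z <= kdist v' z + normc (v - v').
Proof.
move=> dz; rewrite /kdist.
have -> : 1 - cj v * phi z = (1 - cj v' * phi z) - cj (v - v') * phi z by rewrite cjB; ring.
apply: le_trans (cmodB _ _) _; rewrite lerD2l cmodM cmodJ.
by rewrite ler_piMr ?normc_ge0// ltW// phi_disk.
Qed.

Lemma kdist_le2 v z : disk v -> disk z -> kdist v z <= 2.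
Proof.
move=> dv dz; apply: le_trans (cmodB _ _) _; rewrite cmod1 cmodM cmodJ.
have -> : 2 = 1 + 1 * 1 :> R by ring.
by rewrite lerD2l ler_pM ?normc_ge0// ltW// phi_disk.
Qed.

Definition kset a v : set R := [set w z / kdist v z `^ a | z in disk].
Definition ksup a v : R := sup (kset a v).

Lemma kset_ub a v : 0 <= a -> disk v -> has_ubound (kset a v).
Proof.
move=> a0 dv; exists (W / (1 - normc v) `^ a) => _ [z dz <-].
have v0 : 0 < 1 - normc v by rewrite subr_gt0.
apply: ler_pM; rewrite ?w_ge0 ?w_le ?invr_ge0 ?powR_ge0//.
rewrite lef_pV2 ?posrE ?powR_gt0 ?kdist_gt0//.
by apply: ge0_ler_powR => //; rewrite ?nnegrE ?kdist_ge// ltW ?kdist_gt0.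
Qed.

Lemma ksup_ub a v z : 0 <= a -> disk v -> disk z -> w z <= ksup a v * kdist v z `^ a.
Proof.
move=> a0 dv dz; rewrite -ler_pdivrMr ?powR_gt0 ?kdist_gt0//.
by apply: ub_le_sup; [exact: kset_ub | exists z].
Qed.

Lemma ksup_le a v M : disk v ->
  (forall z, disk z -> w z <= M * kdist v z `^ a) -> ksup a v <= M.
Proof.
move=> dv wM; apply: ge_sup; first by exists (w 0 / kdist v 0 `^ a), 0 => //; exact: disk0.
by move=> _ [z dz <-]; rewrite ler_pdivrMr ?powR_gt0 ?kdist_gt0// wM.
Qed.

Lemma ksup_ge0 a v : 0 <= a -> disk v -> 0 <= ksup a v.
Proof.
move=> a0 dv; have := ksup_ub a0 dv (@disk0 R) => /(le_trans (w_ge0 (@disk0 R))).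
by rewrite pmulr_lge0// powR_gt0// kdist_gt0//; exact: disk0.
Qed.

(** Moving v by at most c (1 - |v|) moves [kdist] by at most c times itself, because [kdist v z] is
    at least 1 - |v|. *)
Lemma ksup_shift a c v v' : 0 <= a -> 0 <= c -> disk v -> disk v' ->
  normc (v - v') <= c * (1 - normc v) -> ksup a v <= (1 + c) `^ a * ksup a v'.
Proof.
move=> a0 c0 dv dv' vv'; apply: ksup_le => // z dz.
apply: le_trans (ksup_ub a0 dv' dz) _; rewrite [leRHS]mulrAC [leRHS]mulrC ler_wpM2l ?ksup_ge0//.
have d0 := kdist_gt0 dv dz; rewrite -powRM ?addr_ge0 ?(ltW d0)//.
apply: ge0_ler_powR; rewrite ?nnegrE ?mulr_ge0 ?addr_ge0 ?(ltW d0) ?(ltW (kdist_gt0 _ _))//.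
apply: le_trans (kdist_le v' v dz) _; rewrite mulrDl mul1r lerD2l cmodBC.
by apply: le_trans vv' _; rewrite ler_wpM2l// kdist_ge.
Qed.

Context (beta : R).
Hypothesis beta1 : 1 < beta.
Local Notation q := (2 `^ beta / 2).

Lemma q_gt1 : 1 < q :> R.
Proof. by rewrite ltr_pdivlMr// mul1r -[ltLHS]powRr1// ltr_pow2R. Qed.

Lemma q_gt0 : 0 < q :> R. Proof. exact: lt_trans ltr01 q_gt1. Qed.

Definition carleson_term a n : R := (q / 2 `^ a) ^+ n * \sum_(l < 2 ^ n) ksup a (zeta n l).

(* A discrete form of the integral condition that does not depend on the
   exponent [a], see [carleson_exponent]. *)
Definition carleson a := exists B : R, forall K, \sum_(n < K) carleson_term a n <= B.

Lemma carleson_term_ge0 a n : 0 <= a -> 0 <= carleson_term a n.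
Proof.
move=> a0; rewrite mulr_ge0 ?exprn_ge0 ?divr_ge0 ?powR_ge0 ?(ltW q_gt0)//.
by apply: sumr_ge0 => l _; rewrite ksup_ge0//; exact: zeta_disk.
Qed.

Lemma dyadic_scale (t : R) n : 2 ^- n <= t -> t <= 2 ->
  exists2 m, (m <= n)%N & 2 ^- m <= t <= 2 * 2 ^- m.
Proof.
elim: n => [|n ih] tn t2; first by exists 0 => //; rewrite tn expr0 invr1 mulr1.
have [h|h] := leP (2 ^- n) t; first by have [m mn mt] := ih h t2; exists m => //; exact: leqW.
exists n.+1 => //; rewrite tn ltW//; apply: lt_le_trans h _.
by rewrite exprS invfM mulrA divff ?mul1r// pnatr_eq0.
Qed.

(** For given z let 2^-m be the scale of [kdist] at [zeta n l]. The ancestor v' at level m has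
    [kdist] at most (2 + 17) 2^-m at z, so w(z) is bounded by S_b(v') (19 2^-m)^b, while [kdist^-a]
    is at most 2^(m a). Since m depends on z, the sum over all m takes the place of the supremum
    over z. *)
Lemma ksup_exponent a b n l : 0 <= a -> 0 <= b ->
  ksup a (zeta n l) / (2 `^ a) ^+ n <= 19 `^ b *
  \sum_(m < n.+1) (2 `^ a) ^- (n - m) * ((2 `^ b) ^- m * ksup b (zeta m (l %/ 2 ^ (n - m)))).
Proof.
move=> a0 b0; have P (c : R) : 0 < (2 `^ c : R) by rewrite powR_gt0.
rewrite ler_pdivrMr ?exprn_gt0//; apply: ksup_le => [|z dz]; first exact: zeta_disk.
set v := zeta n l; set t := kdist v z.
have dv : disk v by exact: zeta_disk.
have t0 : 0 < t := kdist_gt0 dv dz.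
have tn : 2 ^- n <= t.
  by have := kdist_ge v dz; rewrite cmod_zeta /rad opprB addrC subrK.
have [m mn /andP[mt tm]] := dyadic_scale tn (kdist_le2 dv dz).
have m1n : (m < n.+1)%N by [].
pose v' : C := zeta m (l %/ 2 ^ (n - m)).
have dv' : disk v' by exact: zeta_disk.
have m0 : 0 < (2 ^- m : R) by rewrite invr_gt0 exprn_gt0.
have t' : kdist v' z <= 19 * 2 ^- m.
  apply: le_trans (kdist_le v' v dz) _.
  have := @zeta_parent_dist R m (n - m) l; rewrite subnKC// cmodBC => h.
  by apply: le_trans (lerD tm h) _; lra.
have K0 m' : 0 <= (2 `^ a) ^- (n - m') * ((2 `^ b) ^- m' * ksup b (zeta m' (l %/ 2 ^ (n - m')))).
  by rewrite !mulr_ge0 ?invr_ge0 ?exprn_ge0 ?powR_ge0// ksup_ge0//; exact: zeta_disk.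
apply: le_trans (_ : 19 `^ b * ((2 `^ a) ^- (n - m) * ((2 `^ b) ^- m * ksup b v')) *
    (2 `^ a) ^+ n * t `^ a <= _); last first.
  rewrite ler_wpM2r ?powR_ge0// ler_wpM2r ?exprn_ge0 ?powR_ge0//.
  rewrite ler_wpM2l ?powR_ge0// (bigD1 (Ordinal m1n))//= lerDl.
  by apply: sumr_ge0 => i _; exact: K0.
apply: le_trans (ksup_ub b0 dv' dz) _.
have h1 : kdist v' z `^ b <= 19 `^ b * (2 `^ b) ^- m.
  rewrite -powR_pow2V -powRM ?(ltW m0)//.
  by apply: ge0_ler_powR; rewrite ?nnegrE ?mulr_ge0 ?(ltW m0) ?(ltW (kdist_gt0 _ _)).
have h2 : 1 <= (2 `^ a) ^+ m * t `^ a.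
  apply: le_trans (_ : (2 `^ a) ^+ m * (2 ^- m) `^ a <= _).
    by rewrite powR_pow2V mulfV// expf_neq0// gt_eqF.
  rewrite ler_wpM2l ?exprn_ge0 ?powR_ge0//.
  by apply: ge0_ler_powR; rewrite ?nnegrE ?(ltW m0) ?(ltW t0).
have -> : 19 `^ b * ((2 `^ a) ^- (n - m) * ((2 `^ b) ^- m * ksup b v')) * (2 `^ a) ^+ n * t `^ a =
   ksup b v' * (19 `^ b * (2 `^ b) ^- m) * ((2 `^ a) ^+ m * t `^ a).
  rewrite -[in (2 `^ a) ^+ n](subnK mn) exprD.
  by field; rewrite !expf_neq0// gt_eqF.
rewrite -[leLHS]mulr1; apply: ler_pM => //.
- by rewrite mulr_ge0 ?powR_ge0 ?ksup_ge0.
- by rewrite ler_wpM2l ?ksup_ge0.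
Qed.

(** After [ksup_exponent], counting the 2^(n-m) descendants of each ancestor leaves the factor
    x^(n-m) with x = 2^(beta - a). It is summable exactly because beta < a. *)
Lemma carleson_exponent a b : 0 <= b -> beta < a -> carleson b -> carleson a.
Proof.
move=> b0 ba [B BP]; have P (c : R) : 0 < (2 `^ c : R) by rewrite powR_gt0.
have a0 : 0 <= a by rewrite ltW// (lt_trans ltr01)// (lt_trans beta1).
pose x : R := 2 * q / 2 `^ a.
have x0 : 0 <= x by rewrite divr_ge0 ?mulr_ge0 ?powR_ge0 ?(ltW q_gt0).
have x1 : x < 1.
  by rewrite /x ltr_pdivrMr// mul1r mulrC divfK ?pnatr_eq0// ltr_pow2R.
exists (19 `^ b * ((1 - x)^-1 * B)) => K.
pose u m l := (2 `^ b) ^- m * ksup b (zeta m l).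
have u0 m l : 0 <= u m l.
  by rewrite mulr_ge0 ?invr_ge0 ?exprn_ge0 ?powR_ge0// ksup_ge0//; exact: zeta_disk.
apply: le_trans (_ : \sum_(n < K) \sum_(m < n.+1)
   19 `^ b * (q ^+ n * ((2 `^ a) ^- (n - m) * (2 ^+ (n - m) * \sum_(l < 2 ^ m) u m l))) <= _).
  apply: ler_sum => n _; rewrite /carleson_term expr_div_n -mulrA mulr_sumr.
  apply: le_trans (_ : q ^+ n * \sum_(l < 2 ^ n) (19 `^ b *
      \sum_(m < n.+1) (2 `^ a) ^- (n - m) * u m (l %/ 2 ^ (n - m))%N) <= _).
    rewrite ler_wpM2l ?exprn_ge0 ?(ltW q_gt0)//; apply: ler_sum => l _.
    by rewrite mulrC; exact: ksup_exponent.
  rewrite -mulr_sumr exchange_big /= mulrCA !mulr_sumr.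
  apply: ler_sum => m _.
  rewrite -mulr_sumr; have := @sum_divn_pow2 R m (n - m) (u m).
  by rewrite subnKC -1?ltnS// => ->.
rewrite (triangular_sum (fun n m => 19 `^ b * (q ^+ n * ((2 `^ a) ^- (n - m) * (2 ^+ (n - m) * \sum_(l < 2 ^ m) u m l))))).
apply: le_trans (_ : \sum_(m < K) 19 `^ b * ((1 - x)^-1 * carleson_term b m) <= _); last first.
  rewrite -!mulr_sumr ler_wpM2l ?powR_ge0// ler_wpM2l ?BP//.
  by rewrite invr_ge0 subr_ge0 ltW.
apply: ler_sum => m _; rewrite -mulr_sumr ler_wpM2l ?powR_ge0//.
apply: le_trans (_ : \sum_(j < K - m) x ^+ j * carleson_term b m <= _); last first.
  by rewrite -mulr_suml ler_wpM2r ?carleson_term_ge0// geometric_sum_le// x0.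
apply: ler_sum => j _; rewrite addKn /carleson_term -mulr_sumr.
rewrite le_eqVlt; apply/orP; left; apply/eqP.
rewrite /x !expr_div_n !exprMn !exprVn !exprD.
by field; rewrite !expf_neq0// gt_eqF.
Qed.

(** At level n one has 2^n [kdist] >= 1, so (2^n [kdist])^-a decreases in a, and so does each
    normalized term. *)
Lemma carleson_exponent_le a b : 0 <= a -> a <= b -> carleson a -> carleson b.
Proof.
move=> a0 ab [B BP]; exists B => K; apply: le_trans (BP K).
have b0 : 0 <= b := le_trans a0 ab.
have P (c : R) : 0 < (2 `^ c : R) by rewrite powR_gt0.
apply: ler_sum => n _; rewrite /carleson_term [(_ / 2 `^ a) ^+ n]expr_div_n [(_ / 2 `^ b) ^+ n]expr_div_n -!mulrA.
rewrite ler_wpM2l ?exprn_ge0 ?(ltW q_gt0)// !mulr_sumr; apply: ler_sum => l _.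
rewrite ler_pdivrMl ?exprn_gt0//; apply: ksup_le => [|z dz]; first exact: zeta_disk.
set v := zeta n l; have dv : disk v by exact: zeta_disk.
apply: le_trans (ksup_ub a0 dv dz) _.
have d0 := kdist_gt0 dv dz.
have tn : 2 ^- n <= kdist v z.
  by have := kdist_ge v dz; rewrite cmod_zeta /rad opprB addrC subrK.
have e (x : R) : 0 < x -> x `^ b = x `^ (b - a) * x `^ a.
  by move=> x0; rewrite -powRD ?subrK// (gt_eqF x0) implybT.
rewrite (e _ d0) (e 2)// exprMn.
have n0 : 0 < (2 ^- n : R) by rewrite invr_gt0 exprn_gt0.
have h : 1 <= (2 `^ (b - a)) ^+ n * kdist v z `^ (b - a).
  apply: le_trans (_ : (2 `^ (b - a)) ^+ n * (2 ^- n) `^ (b - a) <= _).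
    by rewrite powR_pow2V mulfV// expf_neq0// gt_eqF.
  rewrite ler_wpM2l ?exprn_ge0 ?powR_ge0//.
  by apply: ge0_ler_powR; rewrite ?subr_ge0 ?nnegrE ?(ltW n0) ?(ltW d0).
have -> : (2 `^ (b - a)) ^+ n * (2 `^ a) ^+ n * ((2 `^ a) ^- n * ksup a v) *
    (kdist v z `^ (b - a) * kdist v z `^ a) =
  ksup a v * kdist v z `^ a * ((2 `^ (b - a)) ^+ n * kdist v z `^ (b - a)).
  by field; rewrite expf_neq0// gt_eqF.
by rewrite ler_peMr// mulr_ge0 ?powR_ge0// ksup_ge0.
Qed.

End carleson.

(** * Step functions on squares *)

Section step_integrals.
Context {R : realType}.
Local Notation C := (Cx R).
Local Notation leb2 := (@lebesgue_measure R \x @lebesgue_measure R)%E.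

(** The integral of a nonnegative function is a supremum over the simple functions below it, hence
    monotone for arbitrary functions. This spares a proof that the supremum over z is measurable. *)
Lemma le_integral_nonmeasurable d (T : measurableType d) (mu : {measure set T -> \bar R})
    (f g : T -> \bar R) :
  (forall x, 0 <= f x)%E -> (forall x, f x <= g x)%E ->
  (\int[mu]_x f x <= \int[mu]_x g x)%E.
Proof.
move=> f0 fg; have g0 x : (0 <= g x)%E by exact: le_trans (f0 x) (fg x).
rewrite !ge0_integralTE//; apply: le_ereal_sup => _ [h hf <-].
by exists h => // x; exact: le_trans (hf x) (fg x).
Qed.

Definition square (c : C) (h : R) : set (R * R) :=
  `[complex.Re c - h, complex.Re c + h] `*` `[complex.Im c - h, complex.Im c + h].

Lemma measurable_square c h : measurable (square c h).
Proof. by apply: measurableX; exact: measurable_itv. Qed.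

Lemma lebesgue_measure_centered_itv (x h : R) : 0 <= h ->
  @lebesgue_measure R `[x - h, x + h]%classic = (2 * h)%:E.
Proof.
move=> h0; rewrite lebesgue_measure_itv /= lte_fin.
case: ltP => xh; first by rewrite -EFinB; congr EFin; ring.
by congr EFin; lra.
Qed.

Lemma measure_square c h : 0 <= h -> leb2 (square c h) = (4 * h ^+ 2)%:E.
Proof.
move=> h0; rewrite /square product_measure1E; try exact: measurable_itv.
transitivity ((2 * h)%:E * (2 * h)%:E)%E.
  by congr (_ * _)%E; exact: lebesgue_measure_centered_itv.
by rewrite -EFinM; congr EFin; ring.
Qed.

Definition step (N : nat) (c : nat -> R) (v : nat -> C) (h : R) (p : R * R) : \bar R :=
  (\sum_(l < N) (c l)%:E * (\1_(square (v l) h) p)%:E)%E.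

Lemma measurable_step N c v h : measurable_fun
  [set: measurableTypeR R * measurableTypeR R] (step N c v h).
Proof.
apply: emeasurable_sum => l; apply: emeasurable_funM; first exact: measurable_cst.
by apply/measurable_EFinP; apply: measurable_indic; exact: measurable_square.
Qed.

Lemma step_ge0 N c v h p : (forall l, 0 <= c l) -> (0 <= step N c v h p)%E.
Proof. by move=> c0; apply: sume_ge0 => l _; rewrite mule_ge0 ?lee_fin. Qed.

Lemma integral_step N c v h : (forall l, 0 <= c l) -> 0 <= h ->
  (\int[leb2]_p step N c v h p)%E = (4 * h ^+ 2 * \sum_(l < N) c l)%:E.
Proof.
move=> c0 h0; rewrite /step ge0_integral_sum//=.
- rewrite mulr_sumr -sumEFin; apply: eq_bigr => l _.
  rewrite ge0_integralZl_EFin//; last first.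
    by apply/measurable_EFinP; apply: measurable_indic; exact: measurable_square.
  rewrite integral_indic//; last exact: measurable_square.
  rewrite setIT; transitivity ((c l)%:E * (4 * h ^+ 2)%:E)%E.
    by congr (_ * _)%E; exact: measure_square.
  by rewrite -EFinM mulrC.
- move=> l; apply: emeasurable_funM; first exact: measurable_cst.
  by apply/measurable_EFinP; apply: measurable_indic; exact: measurable_square.
- by move=> l p _; rewrite mule_ge0 ?lee_fin.
Qed.

Lemma square_dist c h (p : R * R) : square c h p -> normc (c - (p.1 +i* p.2)) <= 2 * h.
Proof.
move=> [/=]; rewrite !in_itv /= => /andP[a1 a2] /andP[b1 b2].
have -> : c - (p.1 +i* p.2) = (complex.Re c - p.1)%:C + ((complex.Im c - p.2) *i)%C.
  by apply/eqP; rewrite eq_complex; case: (c) => x y /=; rewrite addr0 add0r !eqxx.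
apply: le_trans (cmodD _ _) _; rewrite normc_re normc_im mulrDl !mul1r.
by apply: lerD; rewrite ler_norml; apply/andP; split; lra.
Qed.

Lemma dist_square c h (p : R * R) : normc (c - (p.1 +i* p.2)) <= h -> square c h p.
Proof.
move=> cp.
have := le_trans (normc_ge_Re' _) cp; have := le_trans (normc_ge_Im' _) cp.
case: c cp => x y _ /=; rewrite !ler_norml => /andP[b1 b2] /andP[a1 a2].
by split => /=; rewrite in_itv /=; apply/andP; split; lra.
Qed.

(** Comparability is assumed in both directions because s, later a - beta - 1, may be negative. *)
Lemma powR_ratio (x y s : R) : 0 < x -> 0 < y -> x <= 4 * y -> y <= 4 * x ->
  y `^ s <= 4 `^ `|s| * x `^ s.
Proof.
move=> x0 y0 xy yx; have [s0|s0] := leP 0 s.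
  rewrite ger0_norm// -powRM ?(ltW x0)//.
  by apply: ge0_ler_powR; rewrite ?nnegrE ?mulr_ge0 ?(ltW x0) ?(ltW y0).
rewrite ltr0_norm// -[s in y `^ s]opprK -[s in x `^ s]opprK !(powRN _ (- s)).
have s1 : 0 <= - s by rewrite oppr_ge0 ltW.
rewrite -[leRHS]invrK lef_pV2 ?posrE ?invr_gt0 ?mulr_gt0 ?invr_gt0 ?powR_gt0//.
rewrite invfM invrK ler_pdivrMl ?powR_gt0// -powRM ?(ltW y0)//.
by apply: ge0_ler_powR; rewrite ?nnegrE ?mulr_ge0 ?(ltW x0) ?(ltW y0).
Qed.

(** On one circle with n > 0 the radius is at least 1/2 and the roots are 4 / 2^n apart; on two
    circles the radial gap is at least half of the larger 2^-n. The sum of the two scales is the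
    form needed for disjoint squares. *)
Lemma zeta_separated n m l k : (l < 2 ^ n)%N -> (k < 2 ^ m)%N -> (n, l) != (m, k) ->
  (2 ^- n + 2 ^- m) / 4 <= normc (zeta n l - zeta m k : C).
Proof.
have P (j : nat) : 0 < (2 ^- j : R) by rewrite invr_gt0 exprn_gt0.
wlog nm : n m l k / (n <= m)%N => [hw ln km nmlk|ln km nmlk].
  have [nm|/ltnW mn] := leqP n m; first exact: hw.
  by rewrite cmodBC [_ + _]addrC; apply: hw => //; rewrite eq_sym.
have nm2 : 2 ^- m <= 2 ^- n :> R by rewrite lef_pV2 ?posrE ?exprn_gt0// ler_weXn2l// ler1n.
apply: (@le_trans _ _ (2 ^- n / 2)); first lra.
move: nm; rewrite leq_eqVlt => /orP[/eqP nm|nm].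
  move: km nmlk; rewrite -nm xpair_eqE eqxx /= => kn lk.
  rewrite /zeta -mulrBr cmodM normc_re ger0_norm ?rad_ge0//.
  have n0 : (0 < n)%N.
    by case: (n) ln kn lk => //; rewrite expn0 !ltnS !leqn0 => /eqP-> /eqP->.
  have r2 : 2^-1 <= rad n :> R.
    by apply: le_trans (_ : rad 1 <= _); [rewrite /rad expr1; lra | exact: rad_le].
  by have := @omegaX_sep R _ _ _ ln kn lk; have := P n; nra.
apply: le_trans (_ : normc (zeta m k : C) - normc (zeta n l : C) <= _); last first.
  by rewrite cmodBC cmod_ge_sub.
rewrite !cmod_zeta /rad.
have : 2 ^- m <= 2 ^- n.+1 :> R by rewrite lef_pV2 ?posrE ?exprn_gt0// ler_weXn2l// ler1n.
by rewrite exprS invfM; lra.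
Qed.

End step_integrals.

(** * The integral condition against the dyadic condition *)

Section carleson_integral.
Context {R : realType}.
Local Notation C := (Cx R).
Local Notation leb2 := (@lebesgue_measure R \x @lebesgue_measure R)%E.
Context (w : C -> R) (phi : C -> C) (W : R).
Context (w_ge0 : forall z, disk z -> 0 <= w z) (w_le : forall z, disk z -> w z <= W).
Context (phi_disk : forall z, disk z -> disk (phi z)).
Context (beta : R) (beta1 : 1 < beta) (a : R) (ba : beta < a).
Local Notation q := (2 `^ beta / 2).
Local Notation s := (a - beta - 1).
Local Notation ksup := (ksup w phi).

Let a0 : 0 <= a.
Proof. by rewrite ltW// (lt_trans ltr01)// (lt_trans beta1). Qed.

(** The integrand of (c) for a = alpha + 2, where alpha - beta + 1 = a - beta - 1. *)
Definition carleson_density (v : C) : \bar R :=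
  (ereal_sup [set (w z / kdist phi v z `^ a)%:E | z in disk] *
   ((1 - normc v ^+ 2) `^ s)%:E)%E.

Lemma carleson_densityE v : disk v ->
  carleson_density v = (ksup a v * (1 - normc v ^+ 2) `^ s)%:E.
Proof.
move=> dv; rewrite /carleson_density EFinM; congr (_ * _)%E.
rewrite -(image_comp (fun z => w z / kdist phi v z `^ a) EFin).
rewrite ereal_sup_EFin//; first exact: (kset_ub w_ge0 w_le phi_disk).
by exists (w 0 / kdist phi v 0 `^ a), 0 => //; exact: disk0.
Qed.

Lemma disk_1sub (v : C) : disk v ->
  [/\ 0 < 1 - normc v ^+ 2, 1 - normc v <= 1 - normc v ^+ 2 &
      1 - normc v ^+ 2 <= 2 * (1 - normc v)].
Proof. by rewrite /disk /mkset => v1; have v0 := normc_ge0 v; split; nra. Qed.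

(** A cell of level n has area of order 4^-n and its weight is of order 2^(-n s); with s = a - beta
    - 1 the product is 2^(n (beta - 1 - a)). *)
Lemma scale_carleson_term n :
  (2 ^- n) ^+ 2 * ((2 `^ s) ^- n * \sum_(l < 2 ^ n) ksup a (zeta n l)) =
  carleson_term w phi beta a n.
Proof.
rewrite /carleson_term mulrA; congr (_ * _).
have P (c : R) : 0 < (2 `^ c : R) by rewrite powR_gt0.
have e : 2 `^ s = 2 `^ a / (2 `^ beta * 2) :> R.
  have h : (2 != 0 :> R) by rewrite pnatr_eq0.
  by rewrite !powRB ?h ?implybT// powRr1// -mulrA invfM.
rewrite e -!exprVn -exprM mulnC exprM -exprMn; congr (_ ^+ n).
by field; rewrite !gt_eqF.
Qed.

Lemma carleson_of_integral :
  (disk_integral carleson_density < +oo)%E -> carleson w phi beta a.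
Proof.
move=> Ioo.
pose G p : \bar R := ((fun p : R * R => carleson_density (p.1 +i* p.2)) \_
   [set p : R * R | disk (p.1 +i* p.2 : C)]) p.
have IG : (\int[leb2]_p G p < +oo)%E.
  move: Ioo; rewrite /disk_integral integral_mkcond -/G => h.
  have : ((pi%:E * ((pi^-1)%:E * \int[leb2]_p G p))%E < +oo)%E.
    by rewrite lte_mul_pinfty// ?lee_fin ?pi_ge0.
  by rewrite muleA -EFinM mulfV ?mul1e// gt_eqF// pi_gt0.
have G0 p : (0 <= G p)%E.
  rewrite /G patchE; case: ifP => //; rewrite inE /= => dp.
  by rewrite carleson_densityE// lee_fin mulr_ge0 ?powR_ge0// (ksup_ge0 w_ge0 w_le phi_disk).
have IG0 : (0 <= \int[leb2]_p G p)%E by exact: integral_ge0.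
(* The inverse of the loss between a dyadic point and a point of its square: 9/8 = 1 + 1/8 from
   [ksup_shift], and 4^|s| from the weight. *)
pose k0 : R := ((9 / 8) `^ a * 4 `^ `|s|)^-1.
have k00 : 0 < k0 by rewrite invr_gt0 mulr_gt0// powR_gt0// divr_gt0.
pose c n l := k0 * (2 `^ s) ^- n * ksup a (zeta n l).
have c0 n l : 0 <= c n l.
  rewrite !mulr_ge0 ?invr_ge0 ?exprn_ge0 ?powR_ge0// ?(ltW k00)//.
  by rewrite (ksup_ge0 w_ge0 w_le phi_disk)//; exact: zeta_disk.
(* Points of the square are within 2^-n / 8 of its center, so two squares that meet have centers at
   distance at most (2^-n + 2^-m) / 8, half of what [zeta_separated] allows. The area 4 h^2 = 4^-n /
   64 explains the 64 below. *)
pose h n : R := 2 ^- n / 16.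
have P n : 0 < (2 ^- n : R) by rewrite invr_gt0 exprn_gt0.
have h0 n : 0 <= h n by rewrite divr_ge0// ltW.
pose st n := step (2 ^ n) (c n) (zeta n) (h n).
exists (64 / k0 * fine (\int[leb2]_p G p)) => K.
have stG p : (\sum_(n < K) st n p <= G p)%E.
  have [[n0 [l0 [n0K l0n pQ]]]|nQ] := pselect (exists n l, [/\ (n < K)%N, (l < 2 ^ n)%N &
      square (zeta n l) (h n) p]); last first.
    rewrite big1 ?G0// => n _; rewrite /st /step big1// => l _.
    rewrite indicE; case: (boolP (p \in _)) => [|_]; last by rewrite mule0.
    by rewrite inE => pQ; exfalso; apply: nQ; exists n, l.
  have dist0 := square_dist pQ.
  have z1 : normc (zeta n0 l0 : C) = 1 - 2 ^- n0 by rewrite cmod_zeta.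
  have p2 : normc (zeta n0 l0 - (p.1 +i* p.2)) <= 2 ^- n0 / 8 by rewrite /h in dist0; lra.
  have dp : disk (p.1 +i* p.2 : C).
    have := cmod_ge_sub (p.1 +i* p.2) (zeta n0 l0); rewrite cmodBC z1 /disk /mkset => e.
    by have := P n0; lra.
  have other n l : (n < K)%N -> (l < 2 ^ n)%N -> (n, l) != (n0, l0) ->
      \1_(square (zeta n l) (h n)) p = 0 :> R.
    move=> nK ln nl; rewrite indicE; case: (boolP (p \in _)) => //; rewrite inE => /square_dist d1.
    have d := cmod_triangle (p.1 +i* p.2) (zeta n l) (zeta n0 l0).
    rewrite [X in _ <= _ + X]cmodBC in d.
    by have := P n; have := P n0; rewrite /h in d1 dist0;
      have := @zeta_separated R _ _ _ _ ln l0n nl; lra.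
  rewrite (bigD1 (Ordinal n0K))//= [X in (_ + X)%E]big1 ?adde0; last first.
    move=> n nn0; rewrite /st /step big1// => l _; rewrite other ?mule0//.
    by rewrite xpair_eqE negb_and; apply/orP; left; apply: contra nn0 => /eqP e; apply/eqP/val_inj.
  rewrite /st /step (bigD1 (Ordinal l0n))//= [X in (_ + X)%E]big1 ?adde0; last first.
    move=> l nl0; rewrite other ?mule0//.
    by rewrite xpair_eqE negb_and; apply/orP; right; apply: contra nl0 => /eqP e; apply/eqP/val_inj.
  rewrite indicE mem_set// mule1 /G patchE mem_set// carleson_densityE// lee_fin.
  set v : C := p.1 +i* p.2.
  have [u1 u2 u3] := disk_1sub dp; rewrite -/v in u1 u2 u3.
  have e1 : ksup a (zeta n0 l0) <= (9 / 8) `^ a * ksup a v.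
    have -> : (9 / 8 : R) = 1 + 8^-1 by lra.
    apply: (ksup_shift w_ge0 w_le phi_disk) => //; first exact: zeta_disk.
    by rewrite -/v in p2; rewrite z1; lra.
  have e2 : (2 ^- n0) `^ s <= 4 `^ `|s| * (1 - normc v ^+ 2) `^ s.
    have q1 := cmod_ge_sub v (zeta n0 l0); rewrite cmodBC z1 in q1.
    have q2 := cmod_ge_sub (zeta n0 l0) v; rewrite z1 in q2.
    by apply: powR_ratio => //; have := P n0; rewrite -/v in p2 *; lra.
  rewrite /c -powR_pow2V -mulrA /k0 mulrC ler_pdivrMr ?mulr_gt0 ?powR_gt0 ?divr_gt0//.
  rewrite [leLHS]mulrC [leRHS](_ : _ = ((9 / 8) `^ a * ksup a v) *
     (4 `^ `|s| * (1 - normc v ^+ 2) `^ s)); last by ring.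
  apply: ler_pM => //; rewrite ?powR_ge0//.
  by rewrite (ksup_ge0 w_ge0 w_le phi_disk)//; exact: zeta_disk.
have := @le_integral_nonmeasurable R _ _ leb2 (fun p => \sum_(n < K) st n p)%E G _ stG.
rewrite ge0_integral_sum//; last 2 first.
- by move=> n; exact: measurable_step.
- by move=> n p _; apply: step_ge0.
move=> /(_ _)/le_trans-/(_ _)/(_ _ (lexx _)) H.
have {}H : (\sum_(n < K) (\int[leb2]_p st n p) <= \int[leb2]_p G p)%E.
  by apply: H => p; apply: sume_ge0 => n _; exact: step_ge0.
rewrite -ler_pdivrMl ?divr_gt0// -lee_fin fineK ?ge0_fin_numE//.
apply: le_trans H; rewrite mulr_sumr -sumEFin; apply: lee_sum => n _.
rewrite /st integral_step// lee_fin -scale_carleson_term /c -mulr_sumr /h.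
rewrite le_eqVlt; apply/orP; left; apply/eqP.
by field; rewrite !gt_eqF ?powR_gt0 ?exprn_gt0.
Qed.

Lemma integral_of_carleson :
  carleson w phi beta a -> (disk_integral carleson_density < +oo)%E.
Proof.
move=> [B BP].
have P n : 0 < (2 ^- n : R) by rewrite invr_gt0 exprn_gt0.
(* Here 35 = 1 + 34: a point v with 1 - |v| >= 2^-n / 2 lies within 17 2^-n <= 34 (1 - |v|) of its
   dyadic point. *)
pose k0 : R := 35 `^ a * 4 `^ `|s|.
have k00 : 0 < k0 by rewrite mulr_gt0// powR_gt0.
pose c n l := k0 * (2 `^ s) ^- n * ksup a (zeta n l).
have c0 n l : 0 <= c n l.
  rewrite !mulr_ge0 ?invr_ge0 ?exprn_ge0 ?powR_ge0// ?(ltW k00)//.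
  by rewrite (ksup_ge0 w_ge0 w_le phi_disk)//; exact: zeta_disk.
(* Large enough for the squares to cover the disk: at most 2^-n is lost radially and 16 / 2^n along
   the circle. *)
pose h n : R := 17 * 2 ^- n.
have h0 n : 0 <= h n by rewrite mulr_ge0// ltW.
pose st n := step (2 ^ n) (c n) (zeta n) (h n).
have st0 n p : (0 <= st n p)%E by exact: step_ge0.
pose G p : \bar R := ((fun p : R * R => carleson_density (p.1 +i* p.2)) \_
   [set p : R * R | disk (p.1 +i* p.2 : C)]) p.
have G0 p : (0 <= G p)%E.
  rewrite /G patchE; case: ifP => //; rewrite inE /= => dp.
  by rewrite carleson_densityE// lee_fin mulr_ge0 ?powR_ge0// (ksup_ge0 w_ge0 w_le phi_disk).
have Gst p : (G p <= \sum_(0 <= n <oo) st n p)%E.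
  rewrite /G patchE; case: ifP => [|_]; last exact: nneseries_ge0.
  rewrite inE /= => dp; rewrite carleson_densityE//; set v : C := p.1 +i* p.2.
  have [u1 u2 u3] := disk_1sub dp; rewrite -/v in u1 u2 u3.
  have v0 := normc_ge0 v; have v1 : normc v < 1 by exact: dp.
  have [n /andP[n1 n2]] : exists n, 2 ^- n / 2 <= 1 - normc v <= 2 ^- n.
    have [N hN] : exists N : nat, 2 ^- N <= 1 - normc v.
      have : (fun n => (2^-1 : R) ^+ n) @ \oo --> (0 : R).
        by apply: cvg_expr; rewrite ger0_norm ?invr_ge0// invf_lt1// ltr1n.
      have v10 : 0 < 1 - normc v by rewrite subr_gt0.
      move=> /cvgrPdist_lt/(_ _ v10)[N _ /(_ N)]; rewrite /= leqnn => /(_ isT).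
      rewrite sub0r normrN ger0_norm ?exprn_ge0 ?invr_ge0// exprVn => hN.
      by exists N; exact: ltW.
    have [|m mN /andP[m1 m2]] := dyadic_scale hN; first lra.
    (* [dyadic_scale] puts 1 - |v| above 2^-m, but it is wanted below 2^-n, hence n = m - 1. For m =
       0 it equals 1, and n = 0 works. *)
    case: m mN m1 m2 => [|m] _ m1 m2.
      by exists 0; move: m1 m2; rewrite expr0 invr1 => m1 m2; apply/andP; split; lra.
    exists m; move: m1 m2; rewrite exprS invfM => m1 m2.
    by have pm := P m; apply/andP; split; lra.
  have [l ln vl] : exists2 l, (l < 2 ^ n)%N & normc (v - zeta n l) <= 17 * 2 ^- n.
    have [x x1 vx] : exists2 x : C, normc x = 1 & v = (normc v)%:C * x.
      have [e|e] := eqVneq v 0; first by exists 1; rewrite ?cmod1// e cmod0 rmorph0 mul0r.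
      have nv : normc v != 0 by rewrite cmod_eq0.
      exists ((normc v)^-1%:C * v); last by rewrite mulrA -rmorphM mulfV// mul1r.
      by rewrite cmodM normc_re ger0_norm ?invr_ge0// mulVf.
    have [l ln xl] := omega_dense n x1; exists l => //.
    have -> : v - zeta n l = (normc v - rad n)%:C * x + (rad n)%:C * (x - omega n ^+ l).
      rewrite {1}vx /zeta; move: (normc v) (rad n) => r1 r2.
      by rewrite rmorphB mulrBl mulrBr addrA subrK.
    apply: le_trans (cmodD _ _) _; rewrite !cmodM x1 mulr1 !normc_re.
    have e1 : `|normc v - rad n| <= 2 ^- n.
      by rewrite /rad ler_norml; have := P n; move=> pn; apply/andP; split; lra.
    have e2 : `|rad n| * normc (x - omega n ^+ l) <= 16 / 2 ^+ n.
      apply: le_trans xl; rewrite ler_piMl ?normc_ge0//.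
      by rewrite ger0_norm ?rad_ge0// ltW ?rad_lt1.
    by have := lerD e1 e2; move/le_trans; apply; lra.
  have e1 : ksup a v <= 35 `^ a * ksup a (zeta n l).
    have -> : (35 : R) = 1 + 34 by lra.
    apply: (ksup_shift w_ge0 w_le phi_disk) => //; first exact: zeta_disk.
    by lra.
  have e2 : (1 - normc v ^+ 2) `^ s <= 4 `^ `|s| * (2 ^- n) `^ s.
    by apply: powR_ratio => //; have := P n; lra.
  apply: le_trans (_ : st n p <= _)%E; last first.
    apply: le_trans (nneseries_lim_ge n.+1 _) => //.
    by rewrite big_nat_recr//= leeDr// sume_ge0.
  rewrite /st /step (bigD1 (Ordinal ln))//=.
  apply: le_trans (_ : (c n l)%:E * (\1_(square (zeta n l) (h n)) p)%:E <= _)%E; last first.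
    by rewrite leeDl// sume_ge0// => i _; rewrite mule_ge0 ?lee_fin.
  rewrite indicE mem_set ?mule1; last by apply: dist_square; rewrite cmodBC.
  rewrite lee_fin /c -powR_pow2V /k0.
  rewrite [leRHS](_ : _ = (35 `^ a * ksup a (zeta n l)) * (4 `^ `|s| * (2 ^- n) `^ s)); last by ring.
  apply: ler_pM => //; rewrite ?powR_ge0//.
  by rewrite (ksup_ge0 w_ge0 w_le phi_disk).
have IG : (\int[leb2]_p G p <= (4 * 289 * k0 * B)%:E)%E.
  apply: le_trans (le_integral_nonmeasurable leb2 G0 Gst) _.
  rewrite integral_nneseries//; last by move=> n; exact: measurable_step.
  apply: lime_le; first by apply: is_cvg_nneseries => n _ _; exact: integral_ge0.
  apply: nearW => K; rewrite big_mkord.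
  apply: le_trans (_ : (4 * 289 * k0 * \sum_(n < K) carleson_term w phi beta a n)%:E <= _)%E; last first.
    by rewrite lee_fin ler_wpM2l// mulr_ge0// ltW.
  rewrite mulr_sumr -sumEFin; apply: lee_sum => n _.
  rewrite /st integral_step// lee_fin -scale_carleson_term /c -mulr_sumr /h.
  by rewrite le_eqVlt; apply/orP; left; apply/eqP; ring.
rewrite /disk_integral integral_mkcond -/G.
apply: le_lt_trans (_ : (pi^-1)%:E * (4 * 289 * k0 * B)%:E < _)%E; last by rewrite -EFinM ltry.
by rewrite lee_wpmul2l// lee_fin invr_ge0 pi_ge0.
Qed.

End carleson_integral.

(** * Sums of inverse powers over roots of unity *)

Section forelli_rudin.
Context {R : realType}.
Local Notation C := (Cx R).

(** The Poisson kernel as the real part of (1 + u) / (1 - u). Its form is affine in (1 - u)^-1, so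
    that [mean_geometric] can sum it exactly. *)
Lemma Re_cayley (u : C) : u != 1 ->
  complex.Re (2 * (1 - u)^-1 - 1) = (1 - normc u ^+ 2) / normc (1 - u) ^+ 2.
Proof.
move=> u1; have d0 : 1 - u != 0 by rewrite subr_eq0 eq_sym.
have n0 : normc (1 - u) ^+ 2 != 0 by rewrite expf_neq0// cmod_eq0.
have -> : 2 * (1 - u)^-1 - 1 = ((normc (1 - u) ^+ 2)^-1)%:C * (cj (1 - u) * (1 + u)).
  have e : (normc (1 - u) ^+ 2)%:C = cj (1 - u) * (1 - u).
    apply/eqP; rewrite eq_complex ReM_conj eqxx /=.
    by case: (u) => x y /=; apply/eqP; ring.
  have c0 : cj (1 - u) != 0 by rewrite -cmod_eq0 cmodJ cmod_eq0.
  have -> : ((normc (1 - u) ^+ 2)^-1)%:C = ((normc (1 - u) ^+ 2)%:C)^-1 :> C by rewrite fmorphV.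
  rewrite e invfM mulrACA mulVf// mul1r; apply: (mulfI d0).
  by rewrite mulrBr mulrCA mulfV// mulr1 mulrA mulfV// mul1r; ring.
rewrite Re_realM mulrC; congr (_ / _).
rewrite -ReM_conj cjB cj1; case: (u) => x y /=; ring.
Qed.

(** By [Re_cayley] and [mean_geometric] the mean of the Poisson kernels at the points a w is the
    Poisson kernel at a^(2^n), which is at most 4 because |a|^(2^n) <= 1/2. *)
Lemma sum_inv_sqr_le n (a : C) : normc a <= rad n ->
  \sum_(l < 2 ^ n) (normc (1 - a * omega n ^+ l) ^+ 2)^-1 <= 4 * 2 ^+ n / (1 - normc a).
Proof.
move=> an; have a1 : normc a < 1 := le_lt_trans an (rad_lt1 n).
have a0 := normc_ge0 a; have P0 : 0 < (2 ^+ n : R) by rewrite exprn_gt0.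
have ul l : normc (a * omega n ^+ l) = normc a by rewrite cmodM cmod_omegaX mulr1.
have u1 l : a * omega n ^+ l != 1.
  by apply/eqP => e; move: (ul l); rewrite e cmod1 => e1; rewrite -e1 ltxx in a1.
have d0 : 0 < 1 - normc a ^+ 2 by nra.
(* Bernoulli's inequality gives (1 + 2^-n)^(2^n) >= 2, and (1 - 2^-n) (1 + 2^-n) <= 1. *)
have aM : normc a ^+ (2 ^ n) <= 2^-1.
  have r0 := rad_ge0 n : 0 <= rad n :> R.
  apply: le_trans (lerXn2r (2 ^ n) _ _ an) _; rewrite ?nnegrE//.
  have x0 : 0 < (2 ^- n : R) by rewrite invr_gt0.
  have h1 : (1 + 2 ^- n) ^+ (2 ^ n) >= 2 :> R.
    apply: le_trans (_ : 1 + (2 ^ n)%:R * 2 ^- n <= _); first by rewrite natrX divff ?gt_eqF.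
    elim: (2 ^ n)%N => [|k ih]; first by rewrite expr0 mul0r addr0.
    rewrite exprS -natr1; apply: le_trans (ler_wpM2l _ ih); last lra.
    by have : 0 <= (k%:R : R) by []; nra.
  have h2 : rad n * (1 + 2 ^- n) <= 1 :> R by rewrite /rad; nra.
  have h3 : (rad n * (1 + 2 ^- n)) ^+ (2 ^ n) <= 1 :> R.
    by rewrite exprn_ile1// mulr_ge0// addr_ge0// ltW.
  rewrite exprMn in h3.
  have h4 : 0 <= rad n ^+ (2 ^ n) :> R by rewrite exprn_ge0.
  by nra.
have am0 : 0 <= normc a ^+ (2 ^ n) by rewrite exprn_ge0.
have vn : normc (a ^+ (2 ^ n)) <= 2^-1 by rewrite cmodX.
have v1 : a ^+ (2 ^ n) != 1 by apply/eqP => e; move: vn; rewrite e cmod1; lra.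
have E : \sum_(l < 2 ^ n) (1 - normc a ^+ 2) * (normc (1 - a * omega n ^+ l) ^+ 2)^-1 =
    2 ^+ n * complex.Re (2 * (1 - a ^+ (2 ^ n))^-1 - 1).
  rewrite -(mean_geometric n a1) -Re_realM.
  have -> : (2 ^+ n)%:C * (2 * (2 ^- n * \sum_(l < 2 ^ n) (1 - a * omega n ^+ l)^-1) - 1) =
      \sum_(l < 2 ^ n) (2 * (1 - a * omega n ^+ l)^-1 - 1) :> C.
    rewrite big_split /= sumr_const card_ord -mulr_sumr rmorphXn rmorph_nat.
    move: (\sum_l _) => S; rewrite -[(- 1) *+ _]mulr_natl natrX.
    by field; rewrite expf_neq0// pnatr_eq0.
  rewrite (big_morph (fun z : C => complex.Re z) (id1 := 0) (op1 := +%R)) => [|x y|]; last first.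
  - by [].
  - exact: ReD.
  by apply: eq_bigr => l _; rewrite Re_cayley// ul.
rewrite -mulr_sumr Re_cayley// in E.
have B : (1 - normc (a ^+ (2 ^ n)) ^+ 2) / normc (1 - a ^+ (2 ^ n)) ^+ 2 <= 4.
  have t1 : 2^-1 <= normc (1 - a ^+ (2 ^ n)).
    by apply: le_trans (cmod_ge_sub _ _); rewrite cmod1; lra.
  rewrite ler_pdivrMr ?exprn_gt0//; last by lra.
  by have := normc_ge0 (a ^+ (2 ^ n)); nra.
rewrite ler_pdivlMr ?subr_gt0//.
set S := \sum_(l < _) _ in E *; have S0 : 0 <= S.
  by apply: sumr_ge0 => l _; rewrite invr_ge0 exprn_ge0// normc_ge0.
apply: le_trans (_ : S * (1 - normc a ^+ 2) <= _).
  by rewrite ler_wpM2l//; nra.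
by rewrite mulrC E [leRHS]mulrC ler_wpM2l// ltW.
Qed.

Lemma sum_inv_pow_le n k (a : C) : normc a <= rad n ->
  \sum_(l < 2 ^ n) (normc (1 - a * omega n ^+ l))^-1 ^+ k.+2 <=
  4 * 2 ^+ n * (1 - normc a)^-1 ^+ k.+1.
Proof.
move=> an; have a1 : normc a < 1 := le_lt_trans an (rad_lt1 n).
have a10 : 0 < 1 - normc a by rewrite subr_gt0.
apply: le_trans (_ : (1 - normc a)^-1 ^+ k *
    \sum_(l < 2 ^ n) (normc (1 - a * omega n ^+ l) ^+ 2)^-1 <= _).
  rewrite mulr_sumr; apply: ler_sum => l _.
  have t0 : 1 - normc a <= normc (1 - a * omega n ^+ l).
    by apply: le_trans (cmod_ge_sub _ _); rewrite cmod1 cmodM cmod_omegaX mulr1.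
  have t1 := lt_le_trans a10 t0.
  rewrite -(addn2 k) exprD -[X in _ <= _ * X]exprVn ler_wpM2r ?exprn_ge0 ?invr_ge0 ?(ltW t1)//.
  by apply: lerXn2r; rewrite ?nnegrE ?invr_ge0 ?(ltW a10) ?(ltW t1)// lef_pV2.
apply: le_trans (ler_wpM2l _ (sum_inv_sqr_le an)) _.
  by rewrite exprn_ge0// invr_ge0 ltW.
by rewrite exprSr mulrC mulrAC mulrA.
Qed.

(** With truncated subtraction the exponent is |n - m|; the two flanks of the peak at m are
    geometric. *)
Lemma two_sided_geometric (z : R) m K : 0 < z < 1 ->
  \sum_(n < K) z ^+ ((n - m) + (m - n)) <= 2 / (1 - z).
Proof.
move=> /andP[z0 z1]; have z10 : 0 < 1 - z by rewrite subr_gt0.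
have up j : (j <= m)%N -> \sum_(n < j) z ^+ ((n - m) + (m - n)) <= z ^+ (m - j).+1 / (1 - z).
  elim: j => [_|j ih jm]; first by rewrite big_ord0 divr_ge0 ?exprn_ge0 ?ltW.
  rewrite big_ord_recr /=; apply: le_trans (lerD (ih (ltnW jm)) (lexx _)) _.
  rewrite (eqP (ltnW jm : (j - m)%N == 0)) add0n -(subnSK jm) !exprS.
  rewrite le_eqVlt; apply/orP; left; apply/eqP.
  by field; rewrite gt_eqF.
have down j : \sum_(n < m + j) z ^+ ((n - m) + (m - n)) <= (2 - z ^+ j) / (1 - z).
  elim: j => [|j ih].
    rewrite addn0; apply: le_trans (up m (leqnn _)) _.
    by rewrite subnn expr0 expr1 ler_pM2r ?invr_gt0//; lra.
  rewrite addnS big_ord_recr /=; apply: le_trans (lerD ih (lexx _)) _.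
  rewrite addKn (eqP (leq_addr j m : (m - (m + j))%N == 0)) addn0 exprS.
  rewrite le_eqVlt; apply/orP; left; apply/eqP.
  by field; rewrite gt_eqF.
have [Km|mK] := leqP K m.
  apply: le_trans (up K Km) _; rewrite ler_pM2r ?invr_gt0//.
  by apply: le_trans (_ : 1 <= _); [rewrite exprn_ile1 ?ltW | rewrite ler1n].
rewrite -(subnKC (ltnW mK)); apply: le_trans (down _) _.
by rewrite ler_pM2r ?invr_gt0// lerBlDr lerDl exprn_ge0// ltW.
Qed.

End forelli_rudin.

(** * Test functions in the little Bloch space *)

Section test_function.
Context {R : realType}.
Local Notation C := (Cx R).
Context (beta : R) (beta1 : 1 < beta) (A : nat) (bA : beta < A%:R).
Local Notation q := (2 `^ beta / 2).

Let beta0 : 0 < beta. Proof. exact: lt_trans ltr01 beta1. Qed.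

Definition grid K : seq (nat * nat) := [seq (n, l) | n <- iota 0 K, l <- iota 0 (2 ^ n)].

Lemma big_grid (V : nmodType) K (F : nat * nat -> V) :
  \sum_(i <- grid K) F i = \sum_(n < K) \sum_(l < 2 ^ n) F (nat_of_ord n, nat_of_ord l).
Proof.
rewrite big_allpairs_dep -(big_mkord xpredT (fun n => \sum_(l < 2 ^ n) F (n, nat_of_ord l))).
rewrite /index_iota subn0; apply: eq_bigr => n _.
by rewrite -(big_mkord xpredT (fun l => F (n, l))) /index_iota subn0.
Qed.

Definition test_kernel (i : nat * nat) : little_bloch beta := kern beta A (cj (zeta i.1 i.2)).
Definition test_coef (i : nat * nat) : R := (q / 2 `^ A%:R) ^+ i.1.

Lemma cmod_cj_zeta n l : normc (cj (zeta n l) : C) < 1.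
Proof. by rewrite cmodJ cmod_zeta rad_lt1. Qed.

Lemma test_coef_ge0 i : 0 <= test_coef i.
Proof. by rewrite exprn_ge0// divr_ge0 ?powR_ge0// ltW// q_gt0. Qed.

Let x : R := 2 `^ beta / 2 ^+ A.

Let x_gt0 : 0 < x. Proof. by rewrite divr_gt0 ?powR_gt0 ?exprn_gt0. Qed.

Let x_lt1 : x < 1.
Proof. by rewrite /x ltr_pdivrMr ?exprn_gt0// mul1r -powR_mulrn// ltr_pow2R. Qed.

Let A2 : (1 < A)%N.
Proof. by rewrite -(ltr_nat R) (lt_trans beta1 bA). Qed.

(** By [sum_inv_pow_le], circle n contributes at most 4 x^n (1 - |a|)^-A with x = 2^(beta - A), and
    1 - |a| is at least both 2^-n and 2^-m. For n <= m this gives 4 2^(n beta), for n > m it gives 4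
    2^(m beta) x^(n-m). The decay away from n = m is geometric on the left by beta > 0 and on the
    right by beta < A. *)
Lemma test_sum_le K (z : C) m : disk z -> 2 ^- m <= 1 - normc z ->
  \sum_(i <- grid K) test_coef i * (normc (1 - cj (zeta i.1 i.2) * z))^-1 ^+ A.+1 <=
  4 * (2 `^ beta) ^+ m * (2 / (1 - Num.max x (2 `^ beta)^-1)).
Proof.
move=> dz zm; have P (c : R) : 0 < (2 `^ c : R) by rewrite powR_gt0.
set y := Num.max _ _.
have y0 : 0 < y by rewrite lt_max x_gt0.
have y1 : y < 1.
  rewrite gt_max x_lt1 invf_lt1//.
  by apply: le_lt_trans (ltr_pow2R beta0); rewrite powRr0.
apply: le_trans (_ : \sum_(n < K) 4 * (2 `^ beta) ^+ m * y ^+ ((n - m) + (m - n)) <= _); last first.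
  by rewrite -mulr_sumr ler_wpM2l ?mulr_ge0 ?exprn_ge0 ?powR_ge0// two_sided_geometric// y0.
rewrite big_grid; apply: ler_sum => n _.
rewrite /test_coef /= -mulr_sumr; pose a : C := (rad n)%:C * cj z.
have an : normc a = rad n * normc z by rewrite cmodM cmodJ normc_re ger0_norm ?rad_ge0.
have z0 := normc_ge0 z; have r0 : 0 <= rad n :> R by exact: rad_ge0.
have ale : normc a <= rad n by rewrite an ler_piMr// ltW.
have E l : normc (1 - cj (zeta n l) * z) = normc (1 - a * omega n ^+ l).
  rewrite -(cmodJ (1 - cj _ * z)) cjB cj1 cjM cjK /a /zeta; congr (normc (1 - _)); ring.
under eq_bigr do rewrite E.
have P2 : 0 < (2 ^+ n : R) by rewrite exprn_gt0.
have := @sum_inv_pow_le R n A.-1 a ale; rewrite prednK ?(ltnW A2)// => H.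
apply: le_trans (ler_wpM2l _ H) _; first by rewrite exprn_ge0// divr_ge0 ?powR_ge0// ltW// q_gt0.
have d0 : 0 < 1 - normc z by rewrite subr_gt0.
have ea : 1 - normc a >= 1 - normc z by rewrite an lerB// ler_piMl// ltW// rad_lt1.
have d1 : 0 < 1 - normc a by exact: lt_le_trans ea.
have en : 1 - normc a >= 2 ^- n by rewrite -[leLHS](subKr 1) lerB.
have -> : (q / 2 `^ A%:R) ^+ n * (4 * 2 ^+ n * (1 - normc a)^-1 ^+ A) =
    4 * (x ^+ n * (1 - normc a)^-1 ^+ A).
  have e : (q / 2 `^ A%:R) ^+ n * 2 ^+ n = x ^+ n.
    rewrite -exprMn powR_mulrn// /x; congr (_ ^+ n).
    by field; rewrite expf_neq0// pnatr_eq0.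
  by rewrite -e; ring.
rewrite -[leRHS]mulrA ler_wpM2l//.
have [nm|mn] := leqP n m.
  rewrite (eqP (nm : (n - m)%N == 0)) add0n.
  apply: le_trans (_ : x ^+ n * (2 ^+ n) ^+ A <= _).
    rewrite ler_wpM2l ?exprn_ge0 ?(ltW x_gt0)// lerXn2r ?nnegrE ?invr_ge0 ?(ltW d1) ?(ltW P2)//.
    by rewrite -[leRHS]invrK lef_pV2 ?posrE// invr_gt0.
  rewrite -exprM mulnC exprM -exprMn /x divfK ?expf_neq0 ?pnatr_eq0//.
  have -> : (2 `^ beta) ^+ n = (2 `^ beta) ^+ m * (2 `^ beta)^-1 ^+ (m - n) :> R.
    by rewrite -{1}(subnKC nm) exprD exprVn mulfK// expf_neq0// gt_eqF.
  rewrite ler_wpM2l ?exprn_ge0 ?powR_ge0// lerXn2r ?nnegrE ?invr_ge0 ?powR_ge0 ?(ltW y0)//.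
  by rewrite le_max lexx orbT.
rewrite (eqP (ltnW mn : (m - n)%N == 0)) addn0.
apply: le_trans (_ : x ^+ n * (2 ^+ m) ^+ A <= _).
  rewrite ler_wpM2l ?exprn_ge0 ?(ltW x_gt0)// lerXn2r ?nnegrE ?invr_ge0 ?(ltW d1) ?exprn_ge0//.
  by rewrite -[leRHS]invrK lef_pV2 ?posrE ?invr_gt0 ?exprn_gt0// (le_trans zm).
rewrite -{1}(subnKC (ltnW mn)) exprD mulrAC -exprM mulnC exprM -exprMn.
rewrite {1}/x divfK ?expf_neq0 ?pnatr_eq0//.
rewrite ler_wpM2l ?exprn_ge0 ?powR_ge0// lerXn2r ?nnegrE ?(ltW x_gt0) ?(ltW y0)//.
by rewrite le_max lexx.
Qed.

(** Only absolute values of the coefficients are used, so the bound is uniform in the factors h. The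
    value at 0 costs the sum of all coefficients, the geometric series of ratio x; in the seminorm,
    4^beta comes from 1 - |z|^2 <= 4 2^-m. *)
Lemma test_function_norm : exists2 C0 : R, 0 < C0 & forall K (h : nat * nat -> C),
  (forall i, normc (h i) = 1) ->
  bnorm beta (\sum_(i <- grid K) ((test_coef i)%:C * h i) *: test_kernel i : little_bloch beta) <= C0.
Proof.
pose y := Num.max x (2 `^ beta)^-1.
have P (c : R) : 0 < (2 `^ c : R) by rewrite powR_gt0.
have y1 : y < 1.
  rewrite gt_max x_lt1 invf_lt1//.
  by apply: le_lt_trans (ltr_pow2R beta0); rewrite powRr0.
have y10 : 0 < 2 / (1 - y) by rewrite divr_gt0// subr_gt0.
have B0 : 0 < 4 `^ beta * (A%:R * (4 * (2 / (1 - y)))).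
  by rewrite mulr_gt0 ?powR_gt0// mulr_gt0 ?ltr0n ?(ltnW A2)// mulr_gt0.
exists ((1 - x)^-1 + 4 `^ beta * (A%:R * (4 * (2 / (1 - y))))).
  by rewrite addr_gt0// invr_gt0 subr_gt0.
move=> K h h1; set F := (\sum_(i <- _) _ : little_bloch beta).
have FE z : F z = \sum_(i <- grid K) (test_coef i)%:C * h i * kern_fun A (cj (zeta i.1 i.2)) z.
  rewrite little_sumE; apply: eq_bigr => i _.
  rewrite -[LHS]/((test_coef i)%:C * h i * test_kernel i z).
  by rewrite /test_kernel kernE// cmod_cj_zeta.
have ch i : normc ((test_coef i)%:C * h i) = test_coef i.
  by rewrite cmodM h1 mulr1 normc_re ger0_norm// test_coef_ge0.
apply: lerD.
  rewrite FE; apply: le_trans (cmod_sum _ _ _) _.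
  apply: le_trans (_ : \sum_(i <- grid K) test_coef i <= _).
    apply: ler_sum => i _; rewrite cmodM ch kern_funE; last exact: disk0.
    by rewrite mulr0 subr0 invr1 expr1n cmod1 mulr1.
  rewrite big_grid; apply: le_trans (geometric_sum_le K _); last by rewrite x_lt1 ltW.
  apply: ler_sum => n _; rewrite /test_coef /= sumr_const card_ord -[_ *+ (2 ^ n)%N]mulr_natl natrX.
  rewrite -exprMn le_eqVlt; apply/orP; left; apply/eqP; congr (_ ^+ n).
  by rewrite powR_mulrn// /x; field; rewrite expf_neq0// pnatr_eq0.
apply: bloch_sup_le => z dz.
have d0 : 0 < 1 - normc z by rewrite subr_gt0.
have [N hN] : exists N : nat, 2 ^- N <= 1 - normc z.
  have : (fun n => (2^-1 : R) ^+ n) @ \oo --> (0 : R).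
    by apply: cvg_expr; rewrite ger0_norm ?invr_ge0// invf_lt1// ltr1n.
  move=> /cvgrPdist_lt/(_ _ d0)[N _ /(_ N)]; rewrite /= leqnn => /(_ isT).
  rewrite sub0r normrN ger0_norm ?exprn_ge0 ?invr_ge0// exprVn => hN.
  by exists N; exact: ltW.
have z0 := normc_ge0 z.
have [|m mN /andP[m1 m2]] := dyadic_scale hN; first lra.
have dF : derive1 F z = \sum_(i <- grid K) (test_coef i)%:C * h i *
    (A%:R * cj (zeta i.1 i.2) * (1 - cj (zeta i.1 i.2) * z)^-1 ^+ A.+1).
  have := @derive1_0 R z; rewrite /F; elim: (grid K) => [|i r ih] e0.
    by rewrite !big_nil.
  rewrite !big_cons -ih//.
  set k := test_kernel i; set S := (\sum_(j <- r) _ : little_bloch beta).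
  have ak : analytic k by exact: (analytic_bloch (little_incl k)).
  have aS : analytic S by exact: (analytic_bloch (little_incl S)).
  have := derive1_lin ((test_coef i)%:C * h i) (ak z dz).1 (aS z dz).1.
  rewrite -[X in derive1 X z]/((((test_coef i)%:C * h i) *: k + S : little_bloch beta) : C -> C) => ->.
  congr (_ * _ + _); rewrite /k /test_kernel kernE ?cmod_cj_zeta//.
  by rewrite kern_derive1// cmod_cj_zeta.
have D : normc (derive1 F z) <= A%:R * (4 * (2 `^ beta) ^+ m * (2 / (1 - y))).
  rewrite dF; apply: le_trans (cmod_sum _ _ _) _.
  apply: le_trans (ler_wpM2l _ (test_sum_le K dz m1)) => //.
  rewrite mulr_sumr; apply: ler_sum => i _.
  rewrite cmodM ch !cmodM cmod_nat cmodX cmodV [leRHS]mulrCA.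
  rewrite ler_wpM2l ?test_coef_ge0// ler_wpM2r ?exprn_ge0 ?invr_ge0 ?normc_ge0//.
  by rewrite ler_piMr// ltW// cmod_cj_zeta.
apply: le_trans (_ : (4 * 2 ^- m) `^ beta * (A%:R * (4 * (2 `^ beta) ^+ m * (2 / (1 - y)))) <= _).
  apply: ler_pM => //; rewrite ?powR_ge0 ?normc_ge0//.
  have u0 : 0 < 1 - normc z ^+ 2 by nra.
  apply: ge0_ler_powR; rewrite ?nnegrE ?(ltW beta0) ?(ltW u0)//.
  by nra.
rewrite powRM ?invr_ge0 ?exprn_ge0// powR_pow2V le_eqVlt; apply/orP; left; apply/eqP.
have y10' : 1 - y != 0 by rewrite gt_eqF// subr_gt0.
by field; rewrite y10' expf_neq0// gt_eqF.
Qed.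

End test_function.

(** * The real-valued Bloch norm *)

Section bloch_norms.
Context {R : realType}.
Local Notation C := (Cx R).
Context {b : R}.
Implicit Types (f g : bloch b).

Lemma bnormD f g : bnorm b (f + g : bloch b) <= bnorm b f + bnorm b g.
Proof. by have := ler_normD f g; rewrite !bloch_norm_real -rmorphD lecR. Qed.

Lemma bnormZ (c : C) f : bnorm b (c *: f : bloch b) = normc c * bnorm b f.
Proof.
by have := bloch_normZ c f; rewrite -!bloch_normE !bloch_norm_real normE -rmorphM => /complexI.
Qed.

Lemma bnorm_sum (I : Type) (r : seq I) (u : I -> bloch b) :
  bnorm b (\sum_(i <- r) u i : bloch b) <= \sum_(i <- r) bnorm b (u i).
Proof.
elim: r => [|i r ih]; last first.
  by rewrite !big_cons; apply: le_trans (bnormD _ _) _; rewrite lerD2l.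
by rewrite !big_nil -lecR -bloch_norm_real normr0.
Qed.

Lemma bnorm_series_le (u : nat -> bloch b) f : series u @ \oo --> f ->
  ((bnorm b f)%:E <= \sum_(0 <= k <oo) (bnorm b (u k))%:E)%E.
Proof.
move=> uf; apply/lee_addgt0Pr => e e0.
have e0C : 0 < (e%:C : C) by rewrite ltcR.
move/cvgrPdist_lt : uf => /(_ _ e0C)[n _ /(_ n)]; rewrite /= leqnn => /(_ isT).
rewrite bloch_norm_real ltcR => fn.
apply: le_trans (_ : (\sum_(0 <= k < n) bnorm b (u k) + e)%:E <= _)%E.
  rewrite lee_fin; have := bnormD (series u n) (f - series u n); rewrite addrC subrK => /le_trans.
  by apply; apply: lerD (ltW fn); exact: bnorm_sum.
rewrite EFinD leeD2r// -sumEFin; apply: nneseries_lim_ge => k _ _.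
by rewrite lee_fin bnorm_ge0.
Qed.

End bloch_norms.

Lemma dual_norm_ge0 {R : realType} (X : normedModType (Cx R)) (x' : {linear X -> Cx R}) :
  (0 <= dual_norm x')%E.
Proof.
apply: le_trans (ereal_sup_ubound _); last first.
  by exists 0 => /=; [rewrite normr0 | reflexivity].
by rewrite linear0 lee_fin normc_ge0.
Qed.

(** * The operator T, and the necessity of the dyadic condition *)

Section volterra_operator.
Context {R : realType}.
Local Notation C := (Cx R).
Context (beta gamma : R) (g phi : C -> C) (T : bloch beta -> bloch gamma).
Context (beta1 : 1 < beta).
Context (ag : analytic g) (aphi : analytic phi) (phi_disk : forall z, disk z -> disk (phi z)).
Context (TE : forall f z, disk z -> T f z = volterra g phi f z).
Implicit Types (f : bloch beta) (z : C).

Let beta0 : 0 < beta. Proof. exact: lt_trans ltr01 beta1. Qed.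

Local Notation w := (bloch_weight gamma g).

Lemma T_derive1 f z : disk z -> derive1 (T f) z = f (phi z) * derive1 g z.
Proof.
move=> dz; apply: (@volterra_derive1 R (fun z => f (phi z) * derive1 g z) (T f) z) _ _ _ dz.
- move=> v dv; apply: continuousM; last exact: (ag dv).2.
  apply: (@continuous_comp _ _ _ phi f); first exact/derivable_cts/(aphi dv).1.
  exact/derivable_cts/(analytic_bloch f (phi_disk dv)).1.
- exact: analytic_bloch.
- by move=> v dv; rewrite TE.
Qed.

Lemma weight_T f z : disk z -> bloch_weight gamma (T f) z = w z * normc (f (phi z)).
Proof. by move=> dz; rewrite /bloch_weight T_derive1// cmodM mulrA mulrAC. Qed.

Lemma T_at0 f : T f 0 = 0.
Proof. by rewrite (TE f (@disk0 R)) /volterra mul0r. Qed.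

Lemma weight_T_le f z : disk z -> w z * normc (f (phi z)) <= bnorm gamma (T f).
Proof. by move=> dz; rewrite -weight_T//; exact: weight_le_bnorm. Qed.

Lemma bnorm_T_le f M : (forall z, disk z -> w z * normc (f (phi z)) <= M) ->
  bnorm gamma (T f) <= M.
Proof.
move=> fM; rewrite /bnorm T_at0 cmod0 add0r; apply: bloch_sup_le => z dz.
by rewrite weight_T// fM.
Qed.

(** The kernel of exponent 0 is the constant 1 on the disk, and the derivative of T 1 is g'; so this
    norm bounds the weight w. *)
Definition weight_bound : R := bnorm gamma (T (little_incl (kern beta 0 0))).

Lemma weight_le_bound z : disk z -> w z <= weight_bound.
Proof.
move=> dz; apply: le_trans (weight_T_le _ dz); rewrite /= kernE ?cmod0//.
by rewrite (kern_funE _ _ (phi_disk dz)) expr0 cmod1 mulr1.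
Qed.

Context (A : nat) (bA : beta < A%:R).

Lemma ksup_le_T n l : ksup w phi A%:R (zeta n l) <=
  bnorm gamma (T (little_incl (test_kernel beta A (n, l)))).
Proof.
apply: (ksup_le phi_disk) => [|z dz]; first exact: zeta_disk.
have d0 := kdist_gt0 phi_disk (zeta_disk n l) dz.
rewrite -ler_pdivrMr ?powR_gt0//; apply: le_trans (weight_T_le _ dz).
rewrite -[little_incl _ _]/(test_kernel beta A (n, l) (phi z)) /test_kernel.
rewrite kernE ?cmod_cj_zeta// (kern_funE _ _ (phi_disk dz)) cmodX cmodV.
by rewrite powR_mulrn ?(ltW d0)// exprVn.
Qed.

(** The phases h are chosen to make each value of x' on h_i times a kernel nonnegative; then x' of
    the test function is the whole sum of moduli, and the norm bound C0 of the test function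
    applies. *)
Lemma dual_norm_test_sum (x' : {linear little_bloch beta -> C}) (C0 : R) K : 0 < C0 ->
  (forall h : nat * nat -> C, (forall i, normc (h i) = 1) ->
   bnorm beta (\sum_(i <- grid K) ((test_coef beta A i)%:C * h i) *: test_kernel beta A i
     : little_bloch beta) <= C0) ->
  ((\sum_(i <- grid K) test_coef beta A i * normc (x' (test_kernel beta A i)))%:E <=
    C0%:E * dual_norm x')%E.
Proof.
move=> C00 hC0.
have ex (i : nat * nat) : exists u : C, normc u = 1 /\
    u * x' (test_kernel beta A i) = (normc (x' (test_kernel beta A i)))%:C.
  by have [u u1 ux] := cmod_rotate (x' (test_kernel beta A i)); exists u.
have [h hP] := boolp.choice ex.
have h1 i : normc (h i) = 1 := (hP i).1.
have {}hP i := (hP i).2.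
set F := (\sum_(i <- grid K) ((test_coef beta A i)%:C * h i) *: test_kernel beta A i : little_bloch beta).
have FC0 : bnorm beta F <= C0 by exact: hC0.
set S := \sum_(i <- _) _.
have xF : x' F = S%:C.
  rewrite /F linear_sum /S rmorph_sum; apply: eq_bigr => i _.
  by rewrite linearZ -[LHS]/(_ * _) -mulrA hP rmorphM.
have S0 : 0 <= S.
  by apply: sumr_ge0 => i _; rewrite mulr_ge0 ?test_coef_ge0 ?normc_ge0.
rewrite -lee_pdivrMl//.
apply: ereal_sup_ubound; exists ((C0^-1)%:C *: F).
  rewrite /= normrZ normE normc_re ger0_norm ?invr_ge0 ?(ltW C00)//.
  rewrite -[`|F|]/(`|little_incl F|) bloch_norm_real -rmorphM lecR.
  by rewrite ler_pdivrMl// mulr1.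
have -> : x' ((C0^-1)%:C *: F) = (C0^-1)%:C * x' F by exact: linearZ.
rewrite xF -rmorphM normc_re ger0_norm//.
by rewrite mulr_ge0// invr_ge0 ltW.
Qed.

Lemma carleson_of_nuclear : nuclear (T \o @little_incl R beta) ->
  carleson w phi beta A%:R.
Proof.
move=> [x' [y [_ sumoo cv]]].
have [C0 C00 hC0] := test_function_norm beta1 bA.
set Sg := (\sum_(0 <= k <oo) _)%E in sumoo.
have a0 k : (0 <= dual_norm (x' k) * (complex.Re `|y k|)%:E)%E.
  by rewrite mule_ge0 ?dual_norm_ge0// lee_fin bloch_norm_real /= bnorm_ge0.
have Sg0 : (0 <= Sg)%E by exact: nneseries_ge0.
exists (C0 * fine Sg) => K.
pose K_ := test_kernel beta A; pose c := test_coef beta A.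
have c0 i : 0 <= c i by exact: test_coef_ge0.
have e1 : \sum_(n < K) carleson_term w phi beta A%:R n <=
    \sum_(i <- grid K) c i * bnorm gamma (T (little_incl (K_ i))).
  rewrite big_grid; apply: ler_sum => n _; rewrite /carleson_term mulr_sumr.
  apply: ler_sum => l _; rewrite ler_wpM2l ?ksup_le_T//.
rewrite -lee_fin EFinM fineK ?ge0_fin_numE//.
apply: le_trans (_ : (\sum_(i <- grid K) c i * bnorm gamma (T (little_incl (K_ i))))%:E <= _)%E.
  by rewrite lee_fin.
have n0 i k : (0 <= (c i * (normc (x' k (K_ i)) * bnorm gamma (y k)))%:E)%E.
  by rewrite lee_fin !mulr_ge0 ?normc_ge0 ?bnorm_ge0.
have key (r t : R) (Z : \bar R) : 0 <= r -> (t%:E <= Z)%E -> ((r * t)%:E <= r%:E * Z)%E.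
  by move=> r0 tZ; rewrite EFinM lee_wpmul2l.
(* Each T K_i is expanded first; exchanging the nonnegative sums then lets a single functional meet
   all the kernels at once. *)
apply: le_trans (_ : \sum_(i <- grid K) \sum_(0 <= k <oo)
    (c i * (normc (x' k (K_ i)) * bnorm gamma (y k)))%:E <= _)%E.
  rewrite -sumEFin; apply: lee_sum => i _.
  under eq_eseriesr do rewrite EFinM.
  rewrite nneseriesZl; last by move=> k _; rewrite lee_fin mulr_ge0 ?normc_ge0 ?bnorm_ge0.
  apply: key; first exact: c0.
  have := bnorm_series_le (cv (K_ i)) => /le_trans; apply.
  apply: lee_nneseries => [k _ _|k _]; first by rewrite lee_fin bnorm_ge0.
  by rewrite lee_fin bnormZ.
rewrite -nneseries_sum//.
apply: le_trans (_ : \sum_(0 <= k <oo) (C0%:E * (dual_norm (x' k) * (complex.Re `|y k|)%:E)) <= _)%E.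
  apply: lee_nneseries => [k _ _|k _]; first exact: sume_ge0.
  rewrite sumEFin bloch_norm_real /= muleA.
  under eq_bigr do rewrite mulrA.
  rewrite -mulr_suml EFinM; apply: lee_wpmul2r; first by rewrite lee_fin bnorm_ge0.
  by apply: dual_norm_test_sum => // h h1; exact: hC0.
by rewrite nneseriesZl.
Qed.

End volterra_operator.

(** * Concatenating finite blocks into one sequence *)

Section flattening.
Context {I : Type} (i0 : I) (blk : nat -> seq I).
Hypothesis blk_gt0 : forall k, (0 < size (blk k))%N.

Definition blocks K : seq I := flatten [seq blk k | k <- iota 0 K].

Lemma blocksS K : blocks K.+1 = blocks K ++ blk K.
Proof. by rewrite /blocks -addn1 iotaD map_cat flatten_cat /= add0n cats0. Qed.

Lemma size_blocks K : (K <= size (blocks K))%N.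
Proof.
elim: K => // K ih; rewrite blocksS size_cat -addn1.
exact: leq_add.
Qed.

(** Blocks are nonempty, so the first j + 1 of them have an entry of index j and the default i0
    plays the part of a filler only. *)
Definition flat j : I := nth i0 (blocks j.+1) j.

Lemma nth_blocks K K' j : (K <= K')%N -> (j < size (blocks K))%N ->
  nth i0 (blocks K') j = nth i0 (blocks K) j.
Proof.
move=> /subnK <-; elim: (K' - K)%N => // d ih jK.
rewrite addSn blocksS nth_cat ih// ifT//.
apply: leq_trans jK _; elim: d {ih} => // d ih.
by rewrite addSn blocksS size_cat (leq_trans ih)// leq_addr.
Qed.

Lemma flatE K j : (j < size (blocks K))%N -> flat j = nth i0 (blocks K) j.
Proof.
move=> jK; rewrite /flat; have [h|h] := leqP K j.+1; first exact: nth_blocks.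
by rewrite (@nth_blocks j.+1 K)// ?size_blocks// ltnW.
Qed.

Lemma sum_flat (V : nmodType) (F : I -> V) K :
  \sum_(0 <= j < size (blocks K)) F (flat j) = \sum_(k < K) \sum_(i <- blk k) F i.
Proof.
rewrite -(big_mkord xpredT (fun k => \sum_(i <- blk k) F i)).
transitivity (\sum_(i <- blocks K) F i); last first.
  by rewrite /blocks big_flatten big_map /index_iota subn0.
rewrite (big_nth i0) !big_nat; apply: eq_bigr => j /= jK.
by rewrite (@flatE K).
Qed.

End flattening.

(** * Nuclear expansions from pointwise convergence along blocks *)

Section nuclear_blocks.
Context {R : realType}.
Local Notation C := (Cx R).
Context (beta gamma : R) (g phi : C -> C) (T : bloch beta -> bloch gamma).
Context (ag : analytic g) (aphi : analytic phi) (phi_disk : forall z, disk z -> disk (phi z)).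
Context (TE : forall f z, disk z -> T f z = volterra g phi f z).

Local Notation w := (bloch_weight gamma g).

Lemma bounded_functional_continuous b (x' : {linear bloch b -> C}) (nu : R) :
  (forall f, normc (x' f) <= nu * bnorm b f) -> continuous x'.
Proof.
move=> xb f; apply/(@cvgrPdist_lt _ _ _ (nbhs f)) => _ /complex_gt0[e e0 ->].
have nu1 : 0 < `|nu| + 1 by rewrite ltr_wpDl.
have d0 : 0 < ((e / (`|nu| + 1))%:C : C) by rewrite ltcR divr_gt0.
apply: filterS (@nbhsx_ballx _ _ f _ d0) => h.
rewrite -ball_normE /= bloch_norm_real ltcR normE ltcR -linearB => fh.
apply: le_lt_trans (xb _) _; have N0 := bnorm_ge0 (f - h).
move: fh; rewrite ltr_pdivlMr// mulrC; apply: le_lt_trans.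
by rewrite ler_wpM2r// (le_trans (ler_norm _))// lerDl.
Qed.

Lemma dual_norm_le b (x' : {linear bloch b -> C}) (nu : R) : 0 <= nu ->
  (forall f, normc (x' f) <= nu * bnorm b f) -> (dual_norm x' <= nu%:E)%E.
Proof.
move=> nu0 xb; apply: ge_ereal_sup => _ [f /= f1 <-]; rewrite lee_fin.
apply: le_trans (xb f) _; rewrite ler_piMr//.
by move: f1; rewrite bloch_norm_real lecR.
Qed.

Lemma derive1_bloch_sum (I : Type) (r : seq I) (c : I -> C) (u : I -> bloch gamma) z : disk z ->
  derive1 (\sum_(i <- r) c i *: u i : bloch gamma) z = \sum_(i <- r) c i * derive1 (u i) z.
Proof.
move=> dz; elim: r => [|i r ih]; first by rewrite !big_nil derive1_0.
rewrite !big_cons -ih; set S := (\sum_(j <- r) _ : bloch gamma).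
exact: (derive1_lin (c i) (analytic_bloch (u i) dz).1 (analytic_bloch S dz).1).
Qed.

Context {I : Type} (i0 : I) (blk : nat -> seq I).
Context (x : I -> {linear bloch beta -> C}) (e : I -> bloch beta) (nu : I -> R) (B : R).
Hypothesis blk_gt0 : forall k, (0 < size (blk k))%N.
Hypothesis nu_ge0 : forall i, 0 <= nu i.
Hypothesis x_le : forall i f, normc (x i f) <= nu i * bnorm beta f.
Hypothesis sum_le : forall K, \sum_(k < K) \sum_(i <- blk k) nu i * bnorm gamma (T (e i)) <= B.
Hypothesis e_cvg : forall (f : bloch beta) (v : C) (d : R), disk v -> 0 < d -> exists K0, forall K, (K0 <= K)%N ->
  normc (f v - \sum_(k < K) \sum_(i <- blk k) x i f * e i v) < d.

Let fl := flat i0 blk.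
Let a j := nu (fl j) * bnorm gamma (T (e (fl j))).

Let a_ge0 j : 0 <= a j. Proof. by rewrite mulr_ge0// bnorm_ge0. Qed.

Let a_sum J : \sum_(0 <= j < J) a j <= B.
Proof.
apply: le_trans (sum_le J).
rewrite -(sum_flat i0 blk_gt0 (fun i => nu i * bnorm gamma (T (e i)))).
rewrite (big_cat_nat _ (size_blocks blk_gt0 J))//= lerDl.
by apply: sumr_ge0 => j _; exact: a_ge0.
Qed.

Let a_tail (d : R) : 0 < d -> exists J0, forall J J', (J0 <= J)%N -> (J <= J')%N ->
  \sum_(J <= j < J') a j <= d.
Proof.
move=> d0; have cv : cvgn (series a).
  apply: nondecreasing_is_cvgn; first by apply: nondecreasing_series => j _ _; exact: a_ge0.
  by exists B => _ [J _ <-]; exact: a_sum.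
have /cvgrPdist_lt/(_ (d / 2)) := cv; rewrite divr_gt0// => /(_ isT)[J0 _ J0P].
exists J0 => J J' JJ0 JJ'.
have h1 := J0P J JJ0; have h2 := J0P J' (leq_trans JJ0 JJ').
have -> : \sum_(J <= j < J') a j = series a J' - series a J.
  by rewrite /series /= [in RHS](big_cat_nat _ JJ')//= addrAC subrr add0r.
move: h1 h2; set L := lim _; rewrite /= !ltr_norml => /andP[h1 h1'] /andP[h2 h2'].
by rewrite lerBlDr; lra.
Qed.

(** At z the weighted derivative of the remainder after J terms is w(z) times a remainder at phi(z).
    Up to an arbitrarily small error the latter is a finite sum of terms beyond J, whose weighted
    size is at most |f| times a tail of the series of a_j. The tail does not depend on z, so
    pointwise convergence becomes norm convergence. *)
Lemma nuclear_blocks : nuclear T.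
Proof.
exists (fun j => x (fl j)), (fun j => T (e (fl j))); split.
- by move=> j; exact: (bounded_functional_continuous (x_le (fl j))).
- apply: (@le_lt_trans _ _ B%:E); last exact: ltry.
  apply: lime_le.
    apply: is_cvg_nneseries => j _ _.
    by rewrite mule_ge0 ?dual_norm_ge0// lee_fin bloch_norm_real /= bnorm_ge0.
  apply: nearW => J; apply: le_trans (_ : (\sum_(0 <= j < J) a j)%:E <= _)%E; last first.
    by rewrite lee_fin a_sum.
  rewrite -sumEFin; apply: lee_sum => j _.
  rewrite EFinM bloch_norm_real /= lee_wpmul2r ?lee_fin ?bnorm_ge0//.
  by apply: dual_norm_le => // f; exact: x_le.
move=> f; apply/cvgrPdist_le => _ /complex_gt0[d d0 ->].
have N1 : 0 < bnorm beta f + 1 by rewrite ltr_wpDl ?bnorm_ge0.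
have [J0 J0P] := a_tail (divr_gt0 d0 N1).
exists J0 => // J /= J0J; rewrite bloch_norm_real lecR.
set S := series _ J.
have SE : S = \sum_(j <- index_iota 0 J) x (fl j) f *: T (e (fl j)) by [].
(* All images of T vanish at 0, so only the seminorm is left. *)
rewrite /bnorm; apply: le_trans (_ : 0 + d <= _); last by rewrite add0r.
apply: lerD.
  rewrite -[(T f - S) 0]/(T f 0 - S 0) (T_at0 TE) sub0r cmodN SE bloch_sumE.
  rewrite big1 ?cmod0// => j _.
  by rewrite -[LHS]/(_ * T (e (fl j)) 0) (T_at0 TE) mulr0.
apply: bloch_sup_le => z dz.
have dE : derive1 (T f - S : bloch gamma) z =
    (f (phi z) - \sum_(j <- index_iota 0 J) x (fl j) f * e (fl j) (phi z)) * derive1 g z.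
  have -> : T f - S = (-1) *: S + T f :> bloch gamma by rewrite scaleN1r addrC.
  rewrite (derive1_lin (-1) (analytic_bloch S dz).1 (analytic_bloch (T f) dz).1).
  have e1 : derive1 S z = (\sum_(j <- index_iota 0 J) x (fl j) f * e (fl j) (phi z)) * derive1 g z.
    rewrite SE derive1_bloch_sum// mulr_suml; apply: eq_bigr => j _.
    by rewrite (T_derive1 ag aphi phi_disk TE)// mulrA.
  rewrite e1 (T_derive1 ag aphi phi_disk TE)//.
  have alg (p q r : C) : -1 * (p * r) + q * r = (q - p) * r by ring.
  exact: alg.
rewrite /bloch_weight dE cmodM mulrA mulrAC -/(bloch_weight gamma g z).
have W0 : 0 <= w z by exact: weight_ge0.
apply/ler_addgt0Pr => d' d'0.
have W1 : 0 < w z + 1 by rewrite ltr_wpDl.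
have [K0 K0P] := e_cvg f (phi_disk dz) (divr_gt0 d'0 W1).
(* Convergence is known only at ends of blocks; this K is past K0, and its block end P is past J. *)
pose K := (K0 + J)%N; have {}K0P := K0P K (leq_addr _ _).
set P := size (blocks blk K).
have JP : (J <= P)%N by apply: leq_trans (size_blocks blk_gt0 K); rewrite leq_addl.
rewrite -(sum_flat i0 blk_gt0 (fun i => x i f * e i (phi z))) in K0P.
set SP := \sum_(0 <= j < P) _ in K0P; set SJ := \sum_(j <- _) _.
apply: le_trans (_ : w z * (normc (f (phi z) - SP) + normc (SP - SJ)) <= _).
  by rewrite ler_wpM2l// cmod_triangle.
rewrite mulrDr addrC; apply: lerD; last first.
  apply: le_trans (_ : (w z + 1) * (d' / (w z + 1)) <= _); last by rewrite mulrC divfK// gt_eqF.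
  by apply: ler_pM; rewrite ?normc_ge0// ?lerDl// ltW.
have -> : SP - SJ = \sum_(J <= j < P) x (fl j) f * e (fl j) (phi z).
  by rewrite /SP /SJ [X in X - _](big_cat_nat _ JP)//= addrAC subrr add0r.
apply: le_trans (ler_wpM2l W0 (cmod_sum _ _ _)) _; rewrite mulr_sumr.
apply: le_trans (_ : bnorm beta f * \sum_(J <= j < P) a j <= _); last first.
  apply: le_trans (_ : (bnorm beta f + 1) * (d / (bnorm beta f + 1)) <= _).
    apply: ler_pM; rewrite ?bnorm_ge0 ?lerDl//; last exact: J0P.
    by apply: sumr_ge0 => j _; exact: a_ge0.
  by rewrite mulrC divfK// gt_eqF.
rewrite mulr_sumr; apply: ler_sum => j _.
rewrite cmodM mulrCA /a [leRHS]mulrA [bnorm beta f * _]mulrC; apply: ler_pM.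
- exact: normc_ge0.
- exact: mulr_ge0 W0 (normc_ge0 _).
- exact: x_le.
exact: (weight_T_le ag aphi phi_disk TE).
Qed.

End nuclear_blocks.

(** * Richardson extrapolation *)

Section richardson.
Context {F : numFieldType}.

Let two_gt0 n : 0 < (2 ^+ n : F). Proof. exact: exprn_gt0. Qed.

Lemma sub_inv (x y : F) : x != 0 -> y != 0 -> y^-1 - x^-1 = (x - y) * (x^-1 * y^-1).
Proof. by move=> x0 y0; field; rewrite x0 y0. Qed.

(* Richardson extrapolation of b |-> (a + b)^-1 at b = 0 along b, b/2, b/4, ... *)
Lemma richardson N : exists (c : nat -> F) (k : F), \sum_(i < N.+1) c i = 1 /\
  forall a b, (forall i, (i < N.+2)%N -> a + b / 2 ^+ i != 0) ->
    \sum_(i < N.+1) c i * (a + b / 2 ^+ i.+1)^-1 - \sum_(i < N.+1) c i * (a + b / 2 ^+ i)^-1 =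
    k * b ^+ N.+1 * \prod_(i < N.+2) (a + b / 2 ^+ i)^-1.
Proof.
elim: N => [|N [c [k [c1 cE]]]].
  exists (fun=> 1), 2^-1; split; first by rewrite big_ord1.
  move=> a b ab; rewrite !big_ord1 big_ord_recl big_ord1 /= /bump leq0n /= expr1.
  have h0 := ab 0 isT; have h1 := ab 1%N isT; rewrite expr0 divr1 expr1 in h0 h1 *.
  rewrite !mul1r sub_inv// expr1; congr (_ * _).
  by field.
pose M : F := 2 ^+ N.+1 - 1.
have M0 : M != 0.
  by rewrite subr_eq0 gt_eqF// exprn_egt1// ltr1n.
(* The previous rule at b / 2 and at b, with weights 2^(N+1) / M and -1 / M: the weights sum to 1,
   and the factors b^(N+1) of the two errors become equal, so that their difference yields one more
   factor b. *)
pose c' i := (2 ^+ N.+1 * (if i is i'.+1 then c i' else 0) -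
              (if (i <= N)%N then c i else 0)) / M.
have cs (G : nat -> F) : \sum_(i < N.+2) c' i * G i =
    (2 ^+ N.+1 * \sum_(i < N.+1) c i * G i.+1 - \sum_(i < N.+1) c i * G i) / M.
  rewrite /c'; under eq_bigr do rewrite mulrAC mulrBl.
  rewrite -mulr_suml sumrB; congr ((_ - _) / M).
    rewrite big_ord_recl /= mulr0 mul0r add0r mulr_sumr; apply: eq_bigr => i _.
    by rewrite -mulrA.
  rewrite big_ord_recr /= ltnn mul0r addr0; apply: eq_bigr => i _.
  by rewrite -ltnS ltn_ord.
exists c', (k * (1 - 2 ^- N.+2) / M); split.
  have := cs (fun=> 1); under eq_bigr do rewrite mulr1.
  move=> ->; under eq_bigr do rewrite mulr1.
  by rewrite c1 mulr1 divff.
move=> a b ab; rewrite (cs (fun i => (a + b / 2 ^+ i.+1)^-1)) (cs (fun i => (a + b / 2 ^+ i)^-1)).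
set S0 := \sum_(i < N.+1) c i * (a + b / 2 ^+ i)^-1.
set S1 := \sum_(i < N.+1) c i * (a + b / 2 ^+ i.+1)^-1.
set S2 := \sum_(i < N.+1) c i * (a + b / 2 ^+ i.+2)^-1.
have E0 : S1 - S0 = k * b ^+ N.+1 * \prod_(i < N.+2) (a + b / 2 ^+ i)^-1.
  by apply: cE => i iN; apply: ab; exact: leqW.
have half i : b / 2 / 2 ^+ i = b / 2 ^+ i.+1 by rewrite exprS invfM mulrA.
have E1 : S2 - S1 = k * (b / 2) ^+ N.+1 * \prod_(i < N.+2) (a + b / 2 ^+ i.+1)^-1.
  have -> : S2 = \sum_(i < N.+1) c i * (a + b / 2 / 2 ^+ i.+1)^-1.
    by apply: eq_bigr => i _; rewrite half.
  have -> : S1 = \sum_(i < N.+1) c i * (a + b / 2 / 2 ^+ i)^-1.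
    by apply: eq_bigr => i _; rewrite half.
  rewrite cE => [|i iN]; last by rewrite half; exact: ab.
  by congr (_ * _); apply: eq_bigr => i _; rewrite half.
have -> : (2 ^+ N.+1 * S2 - S1) / M - (2 ^+ N.+1 * S1 - S0) / M =
    (2 ^+ N.+1 * (S2 - S1) - (S1 - S0)) / M by field.
set Q := \prod_(i < N.+1) (a + b / 2 ^+ i.+1)^-1.
have Q0 : \prod_(i < N.+2) (a + b / 2 ^+ i)^-1 = (a + b)^-1 * Q.
  by rewrite big_ord_recl /= expr0 divr1.
have Q1 : \prod_(i < N.+2) (a + b / 2 ^+ i.+1)^-1 = Q / (a + b / 2 ^+ N.+2).
  by rewrite big_ord_recr.
have Q2 : \prod_(i < N.+3) (a + b / 2 ^+ i)^-1 = (a + b)^-1 * (Q / (a + b / 2 ^+ N.+2)).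
  by rewrite big_ord_recl /= expr0 divr1 Q1.
rewrite E0 E1 Q0 Q1 Q2.
have h0 := ab 0%N isT; have hN := ab N.+2 (ltnSn _); rewrite expr0 divr1 in h0.
have e1 : 2 ^+ N.+1 * (k * (b / 2) ^+ N.+1 * (Q / (a + b / 2 ^+ N.+2))) =
    k * b ^+ N.+1 * Q / (a + b / 2 ^+ N.+2).
  rewrite expr_div_n -[RHS]mulrA; move: (Q / _) (lt0r_neq0 (two_gt0 N.+1)).
  by move: (2 ^+ N.+1) => t y t0; field.
have e2 := sub_inv h0 hN.
have e3 : a + b - (a + b / 2 ^+ N.+2) = b * (1 - 2 ^- N.+2) by ring.
rewrite e3 in e2.
transitivity (k * b ^+ N.+1 * Q * ((a + b / 2 ^+ N.+2)^-1 - (a + b)^-1) / M).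
  by rewrite e1; ring.
by rewrite e2 [b ^+ N.+2]exprS; ring.
Qed.

End richardson.

(** * Comparing products up to a relative error *)

Section rel_close.
Context {R : realType}.
Local Notation C := (Cx R).
Implicit Types (x y : C) (X d : R).

(* The error is relative to the common bound X, so that the errors of the
   factors of a product add up. *)
Definition rel_close x y X d := [/\ normc x <= X, normc y <= X & normc (x - y) <= d * X].

Lemma rel_close_weaken x y X d X' d' : 0 <= d -> X <= X' -> d <= d' ->
  rel_close x y X d -> rel_close x y X' d'.
Proof.
move=> d0 XX' dd' [xX yX xy]; have X0 := le_trans (normc_ge0 x) xX.
split; [exact: le_trans xX XX' | exact: le_trans yX XX' |].
by apply: le_trans xy _; exact: ler_pM.
Qed.

Lemma rel_closeM x y X d x' y' X' d' : rel_close x y X d -> rel_close x' y' X' d' ->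
  rel_close (x * x') (y * y') (X * X') (d + d').
Proof.
move=> [xX yX xy] [xX' yX' xy']; split; rewrite ?cmodM.
- by apply: ler_pM; rewrite ?normc_ge0.
- by apply: ler_pM; rewrite ?normc_ge0.
have -> : x * x' - y * y' = (x - y) * x' + y * (x' - y') by ring.
apply: le_trans (cmodD _ _) _; rewrite !cmodM mulrDl; apply: lerD.
  by rewrite mulrA; apply: ler_pM; rewrite ?normc_ge0.
by rewrite mulrCA; apply: ler_pM; rewrite ?normc_ge0.
Qed.

Lemma rel_closeZ (c : C) x y X d : rel_close x y X d ->
  rel_close (c * x) (c * y) (normc c * X) d.
Proof.
move=> [xX yX xy]; split; rewrite -?mulrBr cmodM ?ler_wpM2l ?normc_ge0//.
by rewrite mulrCA ler_wpM2l ?normc_ge0.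
Qed.

Lemma rel_close_prod m (x y : nat -> C) X d : (forall i, (i < m)%N -> rel_close (x i) (y i) X d) ->
  rel_close (\prod_(i < m) x i) (\prod_(i < m) y i) (X ^+ m) (m%:R * d).
Proof.
elim: m => [|m ih] xy.
  by rewrite !big_ord0; split; rewrite ?expr0 ?cmod1// subrr cmod0 mul0r mul0r.
rewrite !big_ord_recr /= exprSr -natr1 mulrDl mul1r; apply: rel_closeM; last exact: xy.
by apply: ih => i im; apply: xy; exact: leqW.
Qed.

Lemma rel_closeX m x y X d : rel_close x y X d ->
  rel_close (x ^+ m) (y ^+ m) (X ^+ m) (m%:R * d).
Proof.
by move=> xy; have := @rel_close_prod m (fun=> x) (fun=> y) X d (fun _ _ => xy);
  rewrite !prodr_const !card_ord.
Qed.

Lemma rel_close_sum m (c x y : nat -> C) X d :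
  (forall i, (i < m)%N -> rel_close (x i) (y i) X d) ->
  rel_close (\sum_(i < m) c i * x i) (\sum_(i < m) c i * y i) ((\sum_(i < m) normc (c i)) * X) d.
Proof.
move=> xy; split.
- apply: le_trans (cmod_sum _ _ _) _; rewrite mulr_suml; apply: ler_sum => i _.
  by have [h _ _] := xy i (ltn_ord i); rewrite cmodM ler_wpM2l ?normc_ge0.
- apply: le_trans (cmod_sum _ _ _) _; rewrite mulr_suml; apply: ler_sum => i _.
  by have [_ h _] := xy i (ltn_ord i); rewrite cmodM ler_wpM2l ?normc_ge0.
rewrite -sumrB; apply: le_trans (cmod_sum _ _ _) _.
rewrite mulr_suml mulr_sumr; apply: ler_sum => i _.
have [_ _ h] := xy i (ltn_ord i); rewrite -mulrBr cmodM mulrCA.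
by rewrite ler_wpM2l ?normc_ge0.
Qed.

Lemma rel_close_inv x y D t : 0 < D -> D <= normc x -> D <= normc y ->
  normc (x - y) <= t * D -> rel_close x^-1 y^-1 D^-1 t.
Proof.
move=> D0 Dx Dy xy; have x0 := lt_le_trans D0 Dx; have y0 := lt_le_trans D0 Dy.
split; rewrite ?cmodV ?lef_pV2 ?posrE//.
have -> : x^-1 - y^-1 = (y - x) * (x^-1 * y^-1).
  by rewrite sub_inv ?[y^-1 * _]mulrC// -cmod_gt0.
rewrite !cmodM !cmodV cmodBC; apply: le_trans (_ : t * D * (D^-1 * D^-1) <= _).
  apply: ler_pM; rewrite ?normc_ge0 ?mulr_ge0 ?invr_ge0 ?normc_ge0//.
  by apply: ler_pM; rewrite ?invr_ge0 ?normc_ge0// lef_pV2.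
by rewrite mulrA mulfK ?gt_eqF.
Qed.

End rel_close.

(** * Kernels of the extrapolated dilations *)

Section layers.
Context {R : realType}.
Local Notation C := (Cx R).
Context (b : R) (b0 : 0 < b) (N : nat) (c : nat -> C) (k : C).
Hypothesis cE : forall x y, (forall i, (i < N.+2)%N -> x + y / 2 ^+ i != 0) ->
  \sum_(i < N.+1) c i * (x + y / 2 ^+ i.+1)^-1 - \sum_(i < N.+1) c i * (x + y / 2 ^+ i)^-1 =
    k * y ^+ N.+1 * \prod_(i < N.+2) (x + y / 2 ^+ i)^-1.

(** Chosen beyond n + N: the circle has to enclose all dilations that occur in the n-th piece with
    the margin of [rad_ratio_le]. *)
Definition circ n := (n + N + 3)%N.

(** The i-th summand is the Cauchy kernel that recovers f(rad (j + i) v) from the circle of radius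
    [rad p]. *)
Definition layer p j (xi : C) : bloch b :=
  \sum_(i < N.+1) c i *: little_incl (kern b 1 ((rad (j + i) / rad p)%:C * cj xi)).

(* Integrating f against [piece n] over the circle of radius [rad (circ n)]
   gives the n-th increment of the extrapolated dilations
   v |-> \sum_i c i * f (rad (n + i) * v) of f, with the first dilation itself for n = 0. *)
Definition piece n xi : bloch b :=
  layer (circ n) n xi - (if n is n'.+1 then layer (circ n) n' xi else 0).

Lemma rad_ge_half p : (0 < p)%N -> 1 / 2 <= rad p :> R.
Proof.
case: p => // p _; rewrite /rad.
have : (2 ^- p.+1 : R) <= 2^-1.
  by rewrite lef_pV2 ?posrE ?exprn_gt0// exprS ler_peMr// exprn_ege1// ler1n.
by lra.
Qed.

(** As j < p, 1 - 2^-j <= 1 - 2 2^-p <= (1 - 2^-p)^2. Hence the ratio [rad j / rad p] is at most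
    [rad p], which keeps the kernels comparable with [cdist]. *)
Lemma rad_ratio_le p j : (j < p)%N -> rad j <= rad p * rad p :> R.
Proof.
move=> jp; have p0 : 0 < (2 ^- p : R) by rewrite invr_gt0 exprn_gt0.
have h : 2 * 2 ^- p <= 2 ^- j :> R.
  rewrite -(subnKC jp) exprD exprS !invfM.
  rewrite !mulrA divff// mul1r ler_piMr ?invr_ge0 ?exprn_ge0//.
  by rewrite invf_le1 ?exprn_gt0// exprn_ege1// ler1n.
by rewrite /rad; nra.
Qed.

Lemma layerE p j xi v : (j + N < p)%N -> normc xi = 1 -> disk v ->
  layer p j xi v = \sum_(i < N.+1) c i * (1 - (rad (j + i))%:C * (cj xi * (v / (rad p)%:C)))^-1.
Proof.
move=> jp xi1 dv; rewrite /layer bloch_sumE; apply: eq_bigr => i _.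
rewrite -[LHS]/(c i * _); congr (_ * _) => /=.
have ip : (j + i < p)%N by apply: leq_ltn_trans jp; rewrite leq_add2l -ltnS.
have p0 : 0 < rad p :> R.
  by apply: lt_le_trans (rad_ge_half _); rewrite ?divr_gt0//; exact: leq_ltn_trans ip.
rewrite kernE//; last first.
  rewrite cmodM cmodJ xi1 mulr1 normc_re ger0_norm ?divr_ge0 ?rad_ge0//.
  rewrite ltr_pdivrMr// mul1r; apply: le_lt_trans (rad_ratio_le ip) _.
  by rewrite gtr_pMr// rad_lt1.
rewrite kern_funE// expr1 rmorphM fmorphV; congr (_^-1).
have alg (s r x y : C) : 1 - s * r * x * y = 1 - s * (x * (y * r)) by ring.
exact: alg.
Qed.

Section bounds.
Context (p : nat) (p_gt0 : (0 < p)%N) (v : C) (dv : disk v).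
Let r : R := rad p.
(** This is [kdist] at the point r xi, with v in the place of phi(z). *)
Definition cdist xi := normc (1 - cj (r%:C * xi) * v).

Lemma cdist_ge xi : normc xi = 1 -> 2 ^- p <= cdist xi.
Proof.
move=> x1; have := @cmod_sub1_ge R (cj (r%:C * xi)) v dv.
rewrite cmodJ cmodM x1 mulr1 normc_re ger0_norm ?rad_ge0//.
by apply: le_trans; rewrite /r /rad opprB addrC subrK.
Qed.

Lemma cdist_le xi : normc xi = 1 -> cdist xi <= 2.
Proof.
move=> x1; apply: le_trans (cmodB _ _) _; rewrite cmod1 cmodM cmodJ cmodM x1 mulr1.
rewrite normc_re ger0_norm ?rad_ge0//; have -> : 2 = 1 + 1 * 1 :> R by ring.
by rewrite lerD2l ler_pM ?normc_ge0 ?rad_ge0// ltW// rad_lt1.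
Qed.

Lemma cdist_shift xi xi' : cdist xi <= cdist xi' + normc (xi - xi').
Proof.
rewrite /cdist.
have -> : 1 - cj (r%:C * xi) * v = (1 - cj (r%:C * xi') * v) - cj (r%:C * (xi - xi')) * v.
  by rewrite mulrBr cjB; ring.
apply: le_trans (cmodB _ _) _; rewrite lerD2l cmodM cmodJ cmodM normc_re ger0_norm ?rad_ge0//.
rewrite mulrAC ler_piMl ?normc_ge0// mulr_ile1 ?rad_ge0 ?normc_ge0//; first exact/ltW/rad_lt1.
exact: ltW.
Qed.

(** With a = s / r <= r, |1 - r u| is at most |1 - a u| + (r - a), and r - a <= 1 - a <= |1 - a u|;
    so shrinking the radius at most halves the distance. *)
Lemma factor_ge xi s : 0 <= s -> s <= r * r -> normc xi = 1 ->
  cdist xi / 2 <= normc (1 - s%:C * (cj xi * (v / r%:C))).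
Proof.
move=> s0 sr x1; have r0 : 0 < r by apply: lt_le_trans (rad_ge_half p_gt0); rewrite divr_gt0.
set u := cj xi * v; have u1 : normc u <= 1 by rewrite cmodM cmodJ x1 mul1r ltW.
set a := s / r; have ar : a <= r by rewrite ler_pdivrMr.
have a0 : 0 <= a by rewrite divr_ge0// ltW.
have r1 : r < 1 := rad_lt1 _.
have -> : s%:C * (cj xi * (v / r%:C)) = a%:C * u.
  by rewrite /a /u rmorphM fmorphV; ring.
have -> : cdist xi = normc (1 - r%:C * u).
  by rewrite /cdist cjM (_ : cj r%:C = r%:C) ?mulrA//; exact: conjc_real.
have alg (x y z : C) : 1 - x * z = (1 - y * z) - (x - y) * z by ring.
have h1 : normc (1 - r%:C * u) <= normc (1 - a%:C * u) + (r - a).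
  have -> : 1 - r%:C * u = (1 - a%:C * u) - (r - a)%:C * u by rewrite [(r - a)%:C]rmorphB; exact: alg.
  apply: le_trans (cmodB _ _) _; rewrite lerD2l cmodM normc_re ger0_norm ?subr_ge0//.
  by rewrite ler_piMr ?subr_ge0.
have h2 : 1 - a <= normc (1 - a%:C * u).
  apply: le_trans (cmod_ge_sub _ _); rewrite cmod1 cmodM normc_re ger0_norm// lerB//.
  by rewrite ler_piMr.
by rewrite ler_pdivrMr//; lra.
Qed.

Context (xi xi' : C) (xi1 : normc xi = 1) (xi'1 : normc xi' = 1).
Let t := normc (xi - xi').
Hypothesis t_le : 2 ^+ p * t <= 16.
Let r2 : 1 / 2 <= r := rad_ge_half p_gt0.

Lemma node_close : rel_close (cj xi * (v / r%:C)) (cj xi' * (v / r%:C)) 2 (2 ^+ p * t).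
Proof.
have t0 : 0 <= t := normc_ge0 _.
have h : normc (v / r%:C) <= 2.
  have r0 : 0 < r by apply: lt_le_trans r2; rewrite divr_gt0.
  rewrite cmodM cmodV normc_re (ger0_norm (ltW r0)) ler_pdivrMr//.
  by apply: le_trans (ltW dv) _; move: r2; lra.
split; rewrite -?mulrBl cmodM.
- by rewrite cmodJ xi1 mul1r.
- by rewrite cmodJ xi'1 mul1r.
rewrite -cjB cmodJ; apply: ler_pM; rewrite ?normc_ge0//.
by rewrite ler_peMl// exprn_ege1// ler1n.
Qed.

(** Since |xi - xi'| <= 16 2^-p and [cdist] >= 2^-p, the two distances differ by a factor of at most
    17; with [factor_ge] both denominators are at least [cdist xi / 34]. Their difference is at most
    2 t, that is 68 (2^p t) times this bound at most. *)
Lemma factor_close s : 0 <= s -> s <= r * r ->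
  rel_close (1 - s%:C * (cj xi * (v / r%:C)))^-1 (1 - s%:C * (cj xi' * (v / r%:C)))^-1
    (34 / cdist xi) (68 * (2 ^+ p * t)).
Proof.
move=> s0 sr; have D0 : 2 ^- p <= cdist xi := cdist_ge xi1.
have p0 : 0 < 2 ^+ p :> R by rewrite exprn_gt0.
have D1 : 0 < cdist xi by apply: lt_le_trans D0; rewrite invr_gt0.
have D2 : 1 <= 2 ^+ p * cdist xi.
  by rewrite mulrC -ler_pdivrMr// mul1r.
have t0 : 0 <= t := normc_ge0 _.
have tD : t <= 16 * cdist xi.
  rewrite -(ler_pM2l p0); apply: le_trans t_le _.
  by rewrite mulrCA ler_peMr.
have DD : cdist xi <= 17 * cdist xi'.
  have h := cdist_shift xi xi'; have h' := cdist_ge xi'1.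
  have : t <= 16 * cdist xi'.
    rewrite -(ler_pM2l p0); apply: le_trans t_le _.
    by rewrite mulrCA ler_peMr// mulrC -ler_pdivrMr// mul1r.
  by rewrite -/t in h; lra.
have -> : 34 / cdist xi = (cdist xi / 34)^-1 by rewrite invfM invrK mulrC.
apply: rel_close_inv.
- by rewrite divr_gt0.
- by apply: le_trans (factor_ge s0 sr xi1); lra.
- by apply: le_trans (factor_ge s0 sr xi'1); lra.
have -> : 1 - s%:C * (cj xi * (v / r%:C)) - (1 - s%:C * (cj xi' * (v / r%:C))) =
    - (s%:C * (cj xi * (v / r%:C) - cj xi' * (v / r%:C))) by ring.
rewrite cmodN cmodM normc_re ger0_norm//.
have s1 : s <= 1.
  by apply: le_trans sr _; have := rad_lt1 p : r < 1; have := r2; nra.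
have h : normc (cj xi * (v / r%:C) - cj xi' * (v / r%:C)) <= t * 2.
  rewrite -mulrBl -cjB cmodM cmodJ ler_wpM2l//.
  have r0 : 0 < r by apply: lt_le_trans r2; rewrite divr_gt0.
  rewrite cmodM cmodV normc_re (ger0_norm (ltW r0)) ler_pdivrMr//.
  by apply: le_trans (ltW dv) _; move: r2; lra.
apply: le_trans (_ : 1 * (t * 2) <= _); first by apply: ler_pM; rewrite ?normc_ge0.
by have := mulr_ge0 t0 (ltW D1); nra.
Qed.

End bounds.

Section pieces.
Context (n : nat) (v : C) (dv : disk v).
Local Notation p := (circ n).
Let u xi := cj xi * (v / (rad p)%:C).

Let circ_gt0 : (0 < p)%N. Proof. by rewrite /circ addn3. Qed.

Lemma piece0E xi : n = 0%N -> normc xi = 1 ->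
  piece n xi v = \sum_(i < N.+1) c i * (1 - (rad i)%:C * u xi)^-1.
Proof.
move=> n0 xi1; rewrite /piece n0 subr0 -n0 layerE//; last by rewrite /circ addn3; lia.
by apply: eq_bigr => i _; rewrite [in rad (n + i)]n0.
Qed.

(** Since 1 - rad (m + i) u = (1 - u) + 2^-m u / 2^i, the difference of consecutive layers is the
    Richardson difference at 1 - u and 2^-m u, and collapses to a product of N + 2 Cauchy
    factors. *)
Lemma pieceSE m xi : n = m.+1 -> normc xi = 1 ->
  piece n xi v = k * (2 ^- m) ^+ N.+1 *
    (u xi ^+ N.+1 * \prod_(i < N.+2) (1 - (rad (m + i))%:C * u xi)^-1).
Proof.
move=> nm xi1; rewrite /piece nm -nm.
rewrite -[LHS]/(layer p n xi v - layer p m xi v) !layerE//; try by rewrite /circ addn3; lia.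
have E i : 1 - (rad (m + i))%:C * u xi = (1 - u xi) + (2 ^- m * u xi) / 2 ^+ i.
  rewrite /rad rmorphB rmorph1 fmorphV rmorphXn rmorph_nat exprD.
  by rewrite invfM; ring.
have := @cE (1 - u xi) (2 ^- m * u xi).
have -> : \sum_(i < N.+1) c i * (1 - u xi + 2 ^- m * u xi / 2 ^+ i.+1)^-1 =
    \sum_(i < N.+1) c i * (1 - (rad (n + i))%:C * u xi)^-1.
  by apply: eq_bigr => i _; rewrite nm addSnnS E.
have -> : \sum_(i < N.+1) c i * (1 - u xi + 2 ^- m * u xi / 2 ^+ i)^-1 =
    \sum_(i < N.+1) c i * (1 - (rad (m + i))%:C * u xi)^-1.
  by apply: eq_bigr => i _; rewrite E.
have -> : \prod_(i < N.+2) (1 - u xi + 2 ^- m * u xi / 2 ^+ i)^-1 =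
    \prod_(i < N.+2) (1 - (rad (m + i))%:C * u xi)^-1.
  by apply: eq_bigr => i _; rewrite E.
move=> H; rewrite H; first by rewrite exprMn !mulrA.
move=> i iN; rewrite -E -cmod_gt0; apply: lt_le_trans (factor_ge circ_gt0 dv (rad_ge0 _) _ xi1); last first.
  by apply: rad_ratio_le; rewrite nm /circ addn3; lia.
by rewrite divr_gt0// (lt_le_trans _ (cdist_ge p dv xi1))// invr_gt0 exprn_gt0.
Qed.

(** The first summand serves n = 0, where there is one Cauchy factor and the missing N + 1 are
    supplied by 2 / [cdist] >= 1. The second serves n = m + 1, where 2^-m = 2^(N+4) 2^-p and the
    factors u are bounded by 2. *)
Definition piece_const : R :=
  (\sum_(i < N.+1) normc (c i)) * 34 * (2 ^+ (N + 3) * 2) ^+ N.+1 +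
  normc k * (2 ^+ (N + 4) * 2) ^+ N.+1 * 34 ^+ N.+2.

Lemma piece_const_ge0 : 0 <= piece_const.
Proof.
have P (m : nat) : 0 <= 2 ^+ m * 2 :> R by rewrite mulr_ge0// exprn_ge0.
apply: addr_ge0; apply: mulr_ge0; try exact: exprn_ge0.
- by apply: mulr_ge0 => //; apply: sumr_ge0 => i _; exact: normc_ge0.
- by apply: mulr_ge0; [exact: normc_ge0 | exact: exprn_ge0].
Qed.

(** Relative errors add up over the N + 1 factors u, each with error t, and the N + 2 Cauchy
    factors, each with error 68 t. The size 2^p (2^-p / [cdist])^(N+2) is the one that S_(N+2)
    absorbs. *)
Lemma piece_close xi xi' : normc xi = 1 -> normc xi' = 1 ->
  2 ^+ p * normc (xi - xi') <= 16 ->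
  rel_close (piece n xi v) (piece n xi' v)
    (piece_const * (2 ^+ p * (2 ^- p / cdist p v xi) ^+ N.+2))
    ((N.+1 + N.+2 * 68)%:R * (2 ^+ p * normc (xi - xi'))).
Proof.
move=> xi1 xi'1 t16; set t := 2 ^+ p * normc _.
have P (m : nat) : 0 < 2 ^+ m :> R by rewrite exprn_gt0.
have t0 : 0 <= t by rewrite mulr_ge0 ?normc_ge0// ltW.
have D0 : 0 < cdist p v xi.
  by apply: lt_le_trans (cdist_ge p dv xi1); rewrite invr_gt0.
have D2 := cdist_le p dv xi1.
have fc (i : nat) : (i < p)%N -> rel_close (1 - (rad i)%:C * u xi)^-1 (1 - (rad i)%:C * u xi')^-1
    (34 / cdist p v xi) (68 * t).
  by move=> ip; apply: factor_close => //; rewrite ?rad_ge0//; exact: rad_ratio_le.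
set Y := (cdist p v xi)^-1; have Y0 : 0 < Y by rewrite invr_gt0.
have EY : 2 ^+ p * (2 ^- p * Y) ^+ N.+2 = (2 ^- p) ^+ N.+1 * Y ^+ N.+2.
  by rewrite exprMn exprS; move: (P p); move: (2 ^+ p) => x x0; field; rewrite gt_eqF.
rewrite EY.
have Sc0 : 0 <= \sum_(i < N.+1) normc (c i) by apply: sumr_ge0 => i _; exact: normc_ge0.
have T0 : 0 <= 34 :> R by [].
have YN : 0 <= Y ^+ N.+2 by rewrite exprn_ge0// ltW.
have PV m : 0 <= (2 ^- m) ^+ N.+1 :> R by rewrite exprn_ge0// invr_ge0 ltW.
have PW m : 0 <= (2 ^+ m * 2) ^+ N.+1 :> R by rewrite exprn_ge0// mulr_ge0// ltW.
have [nE|[m nE]] : n = 0%N \/ exists m, n = m.+1 by case: (n) => [|m]; [left | right; exists m].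
  rewrite !piece0E//.
  apply: (@rel_close_weaken _ _ _ ((\sum_(i < N.+1) normc (c i)) * (34 * Y)) (68 * t)).
  - exact: mulr_ge0.
  - rewrite /piece_const [leRHS]mulrDl; apply: le_trans (_ : (\sum_(i < N.+1) normc (c i)) * (34 * Y) * (2 * Y) ^+ N.+1 <= _).
      rewrite ler_peMr//.
        exact: mulr_ge0 Sc0 (mulr_ge0 T0 (ltW Y0)).
      by rewrite exprn_ege1// ler_pdivlMr ?mul1r.
    have -> : p = (N + 3)%N by rewrite /circ nE.
    rewrite -[leLHS]addr0; apply: lerD; last first.
      apply: mulr_ge0; last exact: mulr_ge0 (PV _) YN.
      apply: mulr_ge0; last exact: exprn_ge0.
      exact: mulr_ge0 (normc_ge0 _) (PW _).
    rewrite le_eqVlt; apply/orP; left; apply/eqP.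
    rewrite [in RHS]exprMn [Y ^+ N.+2]exprS [(2 * Y) ^+ _]exprMn exprVn.
    move: (\sum_(i < N.+1) _) (expf_neq0 N.+1 (lt0r_neq0 (P (N + 3)%N))).
    by move: ((2 ^+ (N + 3)) ^+ N.+1) (2 ^+ N.+1) (Y ^+ N.+1) => x y z s x0; field.
  - by rewrite ler_wpM2r// ler_nat; lia.
  - apply: (@rel_close_sum R N.+1 c (fun i => (1 - (rad i)%:C * u xi)^-1)
      (fun i => (1 - (rad i)%:C * u xi')^-1)) => i iN.
    by apply: fc; rewrite /circ addn3; lia.
rewrite !(pieceSE nE)//.
apply: (@rel_close_weaken _ _ _ (normc (k * (2 ^- m) ^+ N.+1) * (2 ^+ N.+1 * (34 * Y) ^+ N.+2))
   (N.+1%:R * t + N.+2%:R * (68 * t))).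
- by rewrite addr_ge0// mulr_ge0// mulr_ge0.
- rewrite /piece_const [leRHS]mulrDl -[leLHS]add0r; apply: lerD.
    apply: mulr_ge0; last exact: mulr_ge0 (PV _) YN.
    exact: mulr_ge0 (mulr_ge0 Sc0 T0) (PW _).
  have alg (s w h x y : R) : x != 0 -> s * w ^+ N.+1 * (2 ^+ N.+1 * (h * y) ^+ N.+2) =
      s * (x * 2) ^+ N.+1 * h ^+ N.+2 * ((w / x) ^+ N.+1 * y ^+ N.+2).
    by move=> x0; rewrite !(exprMn_comm _ (mulrC _ _)) exprVn; field; rewrite expf_neq0.
  rewrite le_eqVlt; apply/orP; left; apply/eqP.
  rewrite (_ : p = (m + (N + 4))%N); last by rewrite /circ nE; lia.
  have -> : 2 ^- (m + (N + 4)) = 2 ^- m / 2 ^+ (N + 4) :> R by rewrite exprD invfM.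
  rewrite cmodM cmodX cmodV cmodX (cmod_nat 2).
  exact: alg (lt0r_neq0 (P _)).
- by rewrite natrD natrM [in leRHS]mulrDl mulrA lexx.
apply: rel_closeZ; apply: rel_closeM.
  by apply: rel_closeX; exact: node_close.
apply: (@rel_close_prod R N.+2 (fun i => (1 - (rad (m + i))%:C * u xi)^-1)
  (fun i => (1 - (rad (m + i))%:C * u xi')^-1)) => i iN.
by apply: fc; rewrite nE /circ addn3; lia.
Qed.

End pieces.

End layers.

(** * Pointwise recovery of f from circle means *)

Section reproducing.
Context {R : realType}.
Local Notation C := (Cx R).
Context (beta : R) (beta1 : 1 < beta) (N : nat) (c : nat -> C) (k : C).
Hypothesis bA : beta < N.+2%:R.
Hypothesis c_sum : \sum_(i < N.+1) c i = 1.
Hypothesis cE : forall x y, (forall i, (i < N.+2)%N -> x + y / 2 ^+ i != 0) ->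
  \sum_(i < N.+1) c i * (x + y / 2 ^+ i.+1)^-1 - \sum_(i < N.+1) c i * (x + y / 2 ^+ i)^-1 =
    k * y ^+ N.+1 * \prod_(i < N.+2) (x + y / 2 ^+ i)^-1.
Implicit Types (f : bloch beta) (v xi : C).

Local Notation circ := (circ N).
Local Notation layer := (layer beta N c).
Local Notation piece := (piece beta N c).
Local Notation q := (2 `^ beta / 2).

Let b0 : 0 < beta. Proof. exact: lt_trans ltr01 beta1. Qed.

Definition dilation f v j : C := \sum_(i < N.+1) c i * f ((rad (j + i))%:C * v).

Lemma circle_mean_ext M (F G : C -> C) : (forall x, normc x = 1 -> F x = G x) ->
  circle_mean M F = circle_mean M G.
Proof.
by move=> FG; congr (_ * _); apply: eq_bigr => l _; rewrite FG// cmod_omegaX.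
Qed.

Lemma circle_mean_sum M (d : nat -> C) (G : nat -> C -> C) m :
  circle_mean M (fun x => \sum_(i < m) d i * G i x) = \sum_(i < m) d i * circle_mean M (G i).
Proof.
rewrite /circle_mean exchange_big mulr_sumr; apply: eq_bigr => i _.
by rewrite -mulr_sumr mulrCA.
Qed.

Lemma circle_meanB M (F G : C -> C) :
  circle_mean M (fun x => F x - G x) = circle_mean M F - circle_mean M G.
Proof. by rewrite /circle_mean sumrB mulrBr. Qed.

Lemma cvg_cmod (u : nat -> C) (l : C) : (forall e : R, 0 < e -> exists n0, forall n, (n0 <= n)%N ->
  normc (u n - l) < e) -> u @ \oo --> l.
Proof.
move=> ul; apply/cvgrPdist_lt => _ /complex_gt0[e e0 ->].
have [n0 n0P] := ul e e0; exists n0 => // n /= nn0.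
by rewrite normE ltcR cmodBC n0P.
Qed.

Lemma layer_cvg f v p j : disk v -> (j + N < p)%N ->
  circle_mean M (fun x => f ((rad p)%:C * x) * layer p j x v) @[M --> \oo] --> dilation f v j.
Proof.
move=> dv jp.
have E M : circle_mean M (fun x => f ((rad p)%:C * x) * layer p j x v) =
  \sum_(i < N.+1) c i * circle_mean M (fun x => f ((rad p)%:C * x) *
      (1 - cj x * ((rad (j + i))%:C * v / (rad p)%:C))^-1).
  rewrite -(@circle_mean_sum M c (fun i x => f ((rad p)%:C * x) *
      (1 - cj x * ((rad (j + i))%:C * v / (rad p)%:C))^-1)).
  apply: circle_mean_ext => x x1; rewrite layerE// mulr_sumr; apply: eq_bigr => i _.
  rewrite mulrCA; congr (_ * (_ * (1 - _)^-1)).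
  by move: (_%:C) (_^-1) (cj x) => r s y; rewrite mulrCA !mulrA.
rewrite (_ : (fun M => _) = fun M => \sum_(i < N.+1) c i * circle_mean M (fun x => f ((rad p)%:C * x) *
      (1 - cj x * ((rad (j + i))%:C * v / (rad p)%:C))^-1)); last exact: boolp.funext.
rewrite /dilation; apply: cvg_big => [|i _]; first by move=> [x y]; exact: add_continuous.
apply: cvgM; first exact: cvg_cst.
have ip : (j + i < p)%N by apply: leq_ltn_trans jp; rewrite leq_add2l -ltnS.
apply: cvg_cmod => e e0; apply: cauchy_circle_mean => //.
- exact: analytic_bloch.
- rewrite cmodM normc_re ger0_norm ?rad_ge0//.
  apply: le_lt_trans (_ : rad p * rad p * 1 < _).
    by apply: ler_pM; rewrite ?rad_ge0 ?normc_ge0 ?(ltW dv)//; exact: rad_ratio_le.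
  rewrite mulr1 gtr_pMr ?rad_lt1//.
  by apply: lt_le_trans (rad_ge_half _); rewrite ?divr_gt0//; exact: leq_ltn_trans ip.
- exact: rad_lt1.
Qed.

Definition integrand f v n x : C := f ((rad (circ n))%:C * x) * piece n x v.

Lemma integrand_cvg f v n : disk v -> circle_mean M (integrand f v n) @[M --> \oo] -->
  dilation f v n - (if n is n'.+1 then dilation f v n' else 0).
Proof.
move=> dv; have nN : (n + N < circ n)%N by rewrite /circ addn3; lia.
case: n nN => [|n] nN.
  rewrite subr0; have -> : (fun M => circle_mean M (integrand f v 0)) =
      fun M => circle_mean M (fun x => f ((rad (circ 0))%:C * x) * layer (circ 0) 0 x v).
    by apply: boolp.funext => M; apply: circle_mean_ext => x _; rewrite /integrand /piece subr0.
  exact: layer_cvg.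
have -> : (fun M => circle_mean M (integrand f v n.+1)) =
    fun M => circle_mean M (fun x => f ((rad (circ n.+1))%:C * x) * layer (circ n.+1) n.+1 x v) -
             circle_mean M (fun x => f ((rad (circ n.+1))%:C * x) * layer (circ n.+1) n x v).
  apply: boolp.funext => M; rewrite -circle_meanB; apply: circle_mean_ext => x _.
  by rewrite /integrand /piece -mulrBr.
by apply: cvgB; apply: layer_cvg => //; lia.
Qed.

Lemma partial_cvg f v m : disk v ->
  \sum_(n < m.+1) circle_mean M (integrand f v n) @[M --> \oo] --> dilation f v m.
Proof.
move=> dv; have E : \sum_(n < m.+1) (dilation f v n -
    (if n : nat is n'.+1 then dilation f v n' else 0)) = dilation f v m.
  elim: m => [|m ih]; first by rewrite big_ord1 subr0.
  by rewrite big_ord_recr ih /= addrC subrK.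
rewrite -E; apply: cvg_big => [|n _]; first by move=> [x y]; exact: add_continuous.
exact: integrand_cvg.
Qed.

Definition growth_const : R := q / (q - 1).

Lemma growth_const_ge0 : 0 <= growth_const.
Proof.
have q1 : 1 < q := q_gt1 beta1.
by rewrite divr_ge0// ?subr_ge0 ltW// (lt_trans ltr01).
Qed.

Lemma bloch_growth_circle f p x : normc x = 1 ->
  normc (f ((rad p)%:C * x)) <= bnorm beta f * growth_const * q ^+ p.
Proof.
move=> x1; apply: bloch_growth => //.
by rewrite cmodM x1 mulr1 normc_re ger0_norm ?rad_ge0.
Qed.

(** Equal to 2^(beta - N - 2): the growth q^p of f on a circle times the size 2^p 2^(-p (N + 2)) of
    the kernel, per level. *)
Let x := q * 2 / 2 ^+ N.+2.

Let x01 : 0 <= x < 1.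
Proof.
have q0 : 0 < q := q_gt0 beta1.
have P : 0 < 2 ^+ N.+2 :> R by rewrite exprn_gt0.
apply/andP; split; first exact: divr_ge0 (mulr_ge0 (ltW q0) (ler0n _ 2)) (ltW P).
rewrite /x ltr_pdivrMr// mul1r.
by rewrite divfK ?pnatr_eq0// -powR_mulrn// ltr_pow2R.
Qed.

Lemma circ_pred K : (circ K).-1 = (K + N + 2)%N.
Proof. by rewrite /circ addn3 addn2. Qed.

(** Uniform in the number of nodes, so that the limit in M is needed for finitely many n only. *)
Lemma integrand_le f v n M : disk v -> normc (circle_mean M (integrand f v n)) <=
  bnorm beta f * growth_const * (piece_const N c k / (1 - normc v) ^+ N.+2) * x ^+ n.
Proof.
move=> dv; have /andP[x0 x1] := x01; have v0 : 0 < 1 - normc v by rewrite subr_gt0.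
have q0 : 0 < q := q_gt0 beta1.
have P0 := piece_const_ge0 N c k; have G0 := growth_const_ge0.
apply: circle_mean_le => y y1; rewrite cmodM.
have yy : 2 ^+ circ n * normc (y - y) <= 16 by rewrite subrr cmod0 mulr0.
have [h _ _] := piece_close b0 cE dv y1 y1 yy.
have D0 : 0 < cdist (circ n) v y.
  by apply: lt_le_trans (cdist_ge _ dv y1); rewrite invr_gt0.
have D1 : 1 - normc v <= cdist (circ n) v y.
  have := @cmod_sub1_ge R v (cj ((rad (circ n))%:C * y)).
  rewrite [v * _]mulrC; apply; rewrite /disk /mkset cmodJ cmodM y1 mulr1 normc_re ger0_norm ?rad_ge0 ?rad_lt1//.
apply: le_trans (ler_pM (normc_ge0 _) (normc_ge0 _) (bloch_growth_circle f (circ n) y1) h) _.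
rewrite -[leLHS]mulrA -[leRHS]mulrA; apply: ler_wpM2l; first by rewrite mulr_ge0 ?bnorm_ge0.
have alg (K s t d : R) p m : s ^+ p * (K * (t ^+ p * (t ^- p * d) ^+ m)) =
    K * (d ^+ m * (s * t / t ^+ m) ^+ p).
  rewrite [(_ * d) ^+ m]exprMn exprVn -exprM mulnC exprM expr_div_n exprMn.
  by move: ((t ^+ m) ^+ p)^-1 => z; ring.
rewrite alg -/x -mulrA.
rewrite ler_wpM2l//; apply: ler_pM; rewrite ?exprn_ge0 ?invr_ge0 ?(ltW D0)//.
  by rewrite exprVn lef_pV2 ?posrE ?exprn_gt0// lerXn2r ?nnegrE ?(ltW v0) ?(ltW D0).
by apply: ler_wiXn2l => //; [exact: ltW | rewrite /circ -addnA leq_addr].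
Qed.

Lemma dilation_dist f v : disk v -> exists2 B : R, 0 <= B &
  forall n, normc (f v - dilation f v n) <= B * 2 ^- n.
Proof.
move=> dv.
have [m vm] : exists m, normc v <= rad m.
  have v0 : 0 < 1 - normc v by rewrite subr_gt0.
  have h : `|2^-1 : R| < 1 by rewrite ger0_norm// invf_lt1// ltr1n.
  have /cvgrPdist_lt/(_ _ v0)[m _ mP] := cvg_expr h.
  exists m; have := mP m (leqnn m); rewrite /= sub0r normrN ger0_norm ?exprn_ge0//.
  by rewrite /rad exprVn; lra.
pose D := bnorm beta f * (2 `^ beta) ^+ m.
have D0 : 0 <= D by rewrite mulr_ge0 ?bnorm_ge0 ?exprn_ge0 ?powR_ge0.
exists ((\sum_(i < N.+1) normc (c i)) * D).
  by rewrite mulr_ge0//; apply: sumr_ge0 => i _; exact: normc_ge0.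
move=> n; have -> : f v - dilation f v n = \sum_(i < N.+1) c i * (f v - f ((rad (n + i))%:C * v)).
  by under eq_bigr do rewrite mulrBr; rewrite sumrB -mulr_suml c_sum mul1r.
apply: le_trans (cmod_sum _ _ _) _; rewrite -mulrA mulr_suml; apply: ler_sum => i _.
rewrite cmodM ler_wpM2l ?normc_ge0//.
have p0 j : 0 < 2 ^- j :> R by rewrite invr_gt0 exprn_gt0.
have rv j : normc ((rad j)%:C * v) <= rad m.
  rewrite cmodM normc_re ger0_norm ?rad_ge0//; apply: le_trans vm.
  by rewrite ler_piMl ?normc_ge0// ltW// rad_lt1.
apply: le_trans (analytic_mean_value (analytic_bloch f) (rad_lt1 m) (rv _) vm
  (fun w wr => bloch_derive_bound f (ltW b0) wr)) _.
rewrite -/D ler_wpM2l//.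
have -> : v - (rad (n + i))%:C * v = (2 ^- (n + i))%:C * v.
  by rewrite /rad rmorphB rmorph1 mulrBl mul1r opprB addrC subrK.
rewrite cmodM normc_re ger0_norm ?(ltW (p0 _))//.
apply: le_trans (_ : 2 ^- (n + i) * 1 <= _); first by rewrite ler_wpM2l ?(ltW (p0 _)) ?(ltW dv).
by rewrite mulr1 lef_pV2 ?posrE ?exprn_gt0// ler_weXn2l ?ler1n// leq_addr.
Qed.

(** Three errors of d / 3: the m-th extrapolated dilation against f v, the first m + 1 means against
    that dilation, and the geometric tail of the other means. The order [(circ K).-1] is the one
    left by K stages, see [stages_partial]. *)
Lemma reproducing f v (d : R) : disk v -> 0 < d -> exists K0, forall K, (K0 <= K)%N ->
  normc (f v - \sum_(n < K) circle_mean (circ K).-1 (integrand f v n)) < d.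
Proof.
move=> dv d0; have /andP[x0 x1] := x01; have d30 : 0 < d / 3 by rewrite divr_gt0.
have [B B0 BP] := dilation_dist f dv.
pose B' := bnorm beta f * growth_const * (piece_const N c k / (1 - normc v) ^+ N.+2).
have B'0 : 0 <= B'.
  apply: mulr_ge0; first by rewrite mulr_ge0 ?bnorm_ge0 ?growth_const_ge0.
  by rewrite divr_ge0 ?piece_const_ge0// exprn_ge0// subr_ge0 ltW.
have x10 : 0 < 1 - x by rewrite subr_gt0.
have small (a D : R) : 0 <= a < 1 -> 0 <= D -> exists m0, forall m, (m0 <= m)%N -> D * a ^+ m < d / 3.
  move=> /andP[a0 a1] D0; have D1 : 0 < D + 1 by rewrite ltr_wpDl.
  have h : `|a| < 1 by rewrite ger0_norm.
  have e0 : 0 < d / 3 / (D + 1) by rewrite divr_gt0.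
  have /cvgrPdist_lt/(_ _ e0)[m0 _ mP] := cvg_expr h.
  exists m0 => m mm; have := mP m mm; rewrite /= sub0r normrN ger0_norm ?exprn_ge0//.
  rewrite ltr_pdivlMr// mulrC; apply: le_lt_trans.
  by rewrite ler_wpM2r ?exprn_ge0// lerDl.
have half01 : 0 <= (2^-1 : R) < 1 by rewrite invr_ge0 ler0n/= invf_lt1// ltr1n.
have [m1 m1P] := small 2^-1 B half01 B0.
have [m2 m2P] := small x (B' / (1 - x)) x01 (divr_ge0 B'0 (ltW x10)).
pose m := (m1 + m2)%N.
have h1 : normc (f v - dilation f v m) < d / 3.
  apply: le_lt_trans (BP m) _; rewrite -exprVn; apply: m1P; rewrite ?leq_addr//.
have /cvgrPdist_lt := @partial_cvg f v m dv.
have d3C : 0 < ((d / 3)%:C : C) by rewrite ltcR.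
move=> /(_ _ d3C)[K1 _ K1P].
exists (K1 + m.+1)%N => K KK.
have h2 : normc (dilation f v m - \sum_(n < m.+1) circle_mean (circ K).-1 (integrand f v n)) < d / 3.
  have := K1P (circ K).-1; rewrite /= normE ltcR; apply.
  by apply: leq_trans (leq_trans (leq_addr _ _) KK) _; rewrite /= circ_pred -addnA leq_addr.
set S := \sum_(n < m.+1) _ in h2.
have -> : \sum_(n < K) circle_mean (circ K).-1 (integrand f v n) =
    S + \sum_(m.+1 <= n < K) circle_mean (circ K).-1 (integrand f v n).
  rewrite -(big_mkord xpredT (fun n => circle_mean _ (integrand f v n))).
  by rewrite (@big_cat_nat _ _ _ m.+1)/= ?big_mkord// (leq_trans (leq_addl _ _) KK).
set S' := \sum_(m.+1 <= n < K) _.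
have h3 : normc S' < d / 3.
  apply: le_lt_trans (_ : B' / (1 - x) * x ^+ m.+1 < _); last first.
    exact: m2P (leq_trans (leq_addl m1 m2) (leqnSn m)).
  apply: le_trans (cmod_sum _ _ _) _.
  apply: le_trans (_ : \sum_(m.+1 <= n < K) B' * x ^+ n <= _).
    by apply: ler_sum => n _; exact: integrand_le.
  rewrite -mulr_sumr -mulrA ler_wpM2l// -{1}[m.+1]add0n big_addn big_mkord.
  under eq_bigr do rewrite exprD.
  by rewrite -mulr_suml ler_wpM2r ?exprn_ge0// geometric_sum_le.
have -> : f v - (S + S') = (f v - dilation f v m) + (dilation f v m - S) - S' by ring.
apply: le_lt_trans (cmodB _ _) _; apply: le_lt_trans (lerD (cmodD _ _) (lexx _)) _.
have -> : d = d / 3 + d / 3 + d / 3 by field.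
by rewrite !ltrD.
Qed.

End reproducing.

(** * Functionals combining two point evaluations *)

Section point_evaluations.
Context {R : realType}.
Local Notation C := (Cx R).
Context (b : R) (a1 z1 a2 z2 : C).

Definition eval2 (f : bloch b) : C := a1 * f z1 + a2 * f z2.

Lemma eval2_linear : linear eval2.
Proof.
move=> c f g; rewrite /eval2.
have E z : (c *: f + g : bloch b) z = c * f z + g z by [].
rewrite !E -[c *: _]/(c * _); move: (f z1) (f z2) (g z1) (g z2) => x y s t.
by ring.
Qed.

HB.instance Definition _ := GRing.isLinear.Build C (bloch b) C _ eval2 eval2_linear.

End point_evaluations.

(** * Stages of the expansion and their norms *)

Section stages.
Context {R : realType}.
Local Notation C := (Cx R).
Context (beta gamma : R) (g phi : C -> C) (T : bloch beta -> bloch gamma).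
Context (beta1 : 1 < beta).
Context (ag : analytic g) (aphi : analytic phi) (phi_disk : forall z, disk z -> disk (phi z)).
Context (TE : forall f z, disk z -> T f z = volterra g phi f z).
Context (N : nat) (c : nat -> C) (k : C).
Hypothesis bA : beta < N.+2%:R.
Hypothesis c_sum : \sum_(i < N.+1) c i = 1.
Hypothesis cE : forall x y, (forall i, (i < N.+2)%N -> x + y / 2 ^+ i != 0) ->
  \sum_(i < N.+1) c i * (x + y / 2 ^+ i.+1)^-1 - \sum_(i < N.+1) c i * (x + y / 2 ^+ i)^-1 =
    k * y ^+ N.+1 * \prod_(i < N.+2) (x + y / 2 ^+ i)^-1.

Local Notation circ := (circ N).
Local Notation piece := (piece beta N c).
Local Notation q := (2 `^ beta / 2).
Local Notation w := (bloch_weight gamma g).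
Local Notation S := (ksup w phi N.+2%:R).
Local Notation term := (carleson_term w phi beta N.+2%:R).

Let b0 : 0 < beta. Proof. exact: lt_trans ltr01 beta1. Qed.
Let w0 : forall z, disk z -> 0 <= w z. Proof. by move=> z _; exact: weight_ge0. Qed.
Let w_le := fun z => @weight_le_bound R beta gamma g phi T beta1 ag aphi phi_disk TE z.

(* Stage K integrates piece n, n <= K, over the 2^(circ K)-th roots of unity;
   subtracting stage K - 1 pairs each root with the even one just below it. *)
Definition node K l : C := omega (circ K) ^+ l.
Definition base_node K l : C := omega (circ K) ^+ (l./2.*2).

Lemma node_dist K l : normc (node K l - base_node K l) <= 16 / 2 ^+ circ K.
Proof.
apply: le_trans (omegaX_dist _ _) _; first by rewrite -[leqRHS]odd_double_half leq_addl.
rewrite ler_piMl ?divr_ge0 ?exprn_ge0//.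
have : ((l - l./2.*2)%:R : R) <= 1%:R; last exact.
by rewrite ler_nat -[X in (X - _)%N]odd_double_half addnK leq_b1.
Qed.

Local Notation idx := (nat * nat * nat * bool)%type.

Definition stage K : seq idx :=
  [seq (i, s) | i <- [seq (K, n, l) | n <- iota 0 K.+1, l <- iota 0 (2 ^ circ K)],
                s <- [:: false; true]].

Lemma big_stage (V : nmodType) K (F : idx -> V) : \sum_(i <- stage K) F i =
  \sum_(n < K.+1) \sum_(l < 2 ^ circ K) (F (K, (n : nat), (l : nat), false) + F (K, (n : nat), (l : nat), true)).
Proof.
rewrite big_allpairs_dep big_allpairs_dep.
rewrite -(big_mkord xpredT (fun n => \sum_(l < 2 ^ circ K) (F (K, n, (l : nat), false) + F (K, n, (l : nat), true)))).
rewrite /index_iota subn0; apply: eq_bigr => n _.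
rewrite -(big_mkord xpredT (fun l => F (K, n, l, false) + F (K, n, l, true))).
rewrite /index_iota subn0; apply: eq_bigr => l _.
by rewrite !big_cons big_nil /= addr0.
Qed.

(** With P the kernel, f(x) P(x) - f(y) P(y) = (f(x) - f(y)) P(x) + f(y) (P(x) - P(y)) splits the
    change at a node x with base node y into two rank one terms: [false] is the first and [true] the
    second. The factor [(n < K)%:R] drops y when n = K, as the previous stage has no such piece. *)
Definition functional (i : idx) : {linear bloch beta -> C} :=
  let: (K, n, l, s) := i in
  let r : C := (rad (circ n))%:C in
  let sg : C := 2 ^- circ K * (n < K)%:R in
  if s then (@eval2 R beta sg (r * base_node K l) 0 0 : {linear bloch beta -> C})
  else (@eval2 R beta (2 ^- circ K) (r * node K l) (- sg) (r * base_node K l) : {linear bloch beta -> C}).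

Definition atom (i : idx) : bloch beta :=
  let: (K, n, l, s) := i in
  if s then piece n (node K l) - piece n (base_node K l) else piece n (node K l).

(** For [false] the difference of evaluations gains 2^-(K - n), with 16 from [node_dist] and the
    growth constant for n = K. For [true] the gain is in the atom instead. *)
Definition fnorm (i : idx) : R :=
  let: (K, n, l, s) := i in
  if s then 2 ^- circ K * (growth_const beta * q ^+ circ n)
  else 2 ^- circ K * ((growth_const beta + 16) * q ^+ circ n * 2 ^- (K - n)).

Let P2 (m : nat) : 0 < 2 ^+ m :> R. Proof. exact: exprn_gt0. Qed.
Let V2 (m : nat) : 0 <= 2 ^- m :> R. Proof. by rewrite invr_ge0 ltW. Qed.
Let q0 : 0 < q. Proof. exact: q_gt0. Qed.
Let G0 : 0 <= growth_const beta. Proof. exact: growth_const_ge0. Qed.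

Lemma fnorm_ge0 i : 0 <= fnorm i.
Proof.
have Q n : 0 <= q ^+ n by rewrite exprn_ge0// ltW.
case: i => [[[K n] l] []] /=; apply: mulr_ge0 => //; first exact: mulr_ge0.
by apply: mulr_ge0 => //; apply: mulr_ge0 => //; exact: addr_ge0.
Qed.

Lemma cmod_pow2V m : normc (2 ^- m : C) = 2 ^- m.
Proof. by rewrite cmodV cmodX (cmod_nat 2). Qed.

Lemma functional_le i f : normc (functional i f) <= fnorm i * bnorm beta f.
Proof.
case: i => [[[K n] l] s]; rewrite /functional /fnorm.
have u1 : normc (node K l) = 1 by exact: cmod_omegaX.
have u2 : normc (base_node K l) = 1 by exact: cmod_omegaX.
have g1 := bloch_growth_circle beta1 f (circ n) u1.
have g2 := bloch_growth_circle beta1 f (circ n) u2.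
have N0 := bnorm_ge0 f.
have Q0 : 0 <= q ^+ circ n by rewrite exprn_ge0// ltW.
have s1 : normc ((n < K)%:R : C) <= 1 by case: (n < K)%N; rewrite ?cmod1 ?cmod0.
case: s; rewrite /= /eval2.
  rewrite mul0r addr0 cmodM cmodM cmod_pow2V -[leLHS]mulrA -[leRHS]mulrA ler_wpM2l//.
  apply: le_trans (_ : 1 * (bnorm beta f * growth_const beta * q ^+ circ n) <= _).
    by apply: ler_pM; rewrite ?normc_ge0.
  by rewrite mul1r [leRHS]mulrC [leRHS]mulrA.
have alg (p s x y : C) : p * x + - (p * s) * y = p * (x - s * y) by ring.
rewrite alg cmodM cmod_pow2V -[leRHS]mulrA ler_wpM2l//.
have [nK|nK] := ltnP n K; last first.
  have -> : (K - n = 0)%N by apply/eqP; rewrite subn_eq0.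
  rewrite mul0r subr0 expr0 invr1 mulr1; apply: le_trans g1 _.
  by rewrite -mulrA mulrC ler_wpM2r// ler_wpM2r// lerDl.
rewrite mul1r; apply: le_trans (bloch_dist f (circ n) (ltW b0) u1 u2) _.
apply: le_trans (ler_wpM2l _ (node_dist K l)) _.
  by rewrite mulr_ge0// exprn_ge0// powR_ge0.
have -> : circ K = (circ n + (K - n))%N by rewrite /circ !addn3; lia.
rewrite exprD; apply: le_trans (_ : 16 * q ^+ circ n * 2 ^- (K - n) * bnorm beta f <= _).
  rewrite expr_div_n invfM le_eqVlt; apply/orP; left; apply/eqP.
  by ring.
by rewrite ler_wpM2r// ler_wpM2r// ler_wpM2r// lerDr.
Qed.

(** At v = phi(z) the power of [cdist] in the bound is a power of [kdist], and the definition of S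
    cancels it against w(z). *)
Lemma bnorm_T_close (u : bloch beta) n xi (M : R) : normc xi = 1 -> 0 <= M ->
  (forall v, disk v -> normc (u v) <= M * (2 ^+ circ n * (2 ^- circ n / cdist (circ n) v xi) ^+ N.+2)) ->
  bnorm gamma (T u) <= M * (2 ^+ circ n * (2 ^- circ n) ^+ N.+2 * S ((rad (circ n))%:C * xi)).
Proof.
move=> xi1 M0 uM; apply: (bnorm_T_le ag aphi phi_disk TE) => z dz.
set v := (rad (circ n))%:C * xi.
have dv : disk v by rewrite /disk /mkset cmodM xi1 mulr1 normc_re ger0_norm ?rad_ge0 ?rad_lt1.
have A0 : 0 <= N.+2%:R :> R by [].
have D0 : 0 < kdist phi v z := kdist_gt0 phi_disk dv dz.
have h := ksup_ub w0 w_le phi_disk A0 dv dz.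
rewrite powR_mulrn ?(ltW D0)// in h.
apply: le_trans (ler_pM (w0 dz) (normc_ge0 _) h (uM _ (phi_disk dz))) _.
have -> : cdist (circ n) (phi z) xi = kdist phi v z by [].
rewrite le_eqVlt; apply/orP; left; apply/eqP.
rewrite [(_ / kdist phi v z) ^+ _]expr_div_n.
have K0 : kdist phi v z ^+ N.+2 != 0 by rewrite expf_neq0// gt_eqF.
have alg (x s t M' y : R) : x != 0 -> s * x * (M' * (y * (t / x))) = M' * (y * t * s).
  by move=> x0; field.
exact: alg.
Qed.

(** The nodes of stage K are finer than the dyadic points on the n-th circle; each is within 16
    2^-(circ n) of its ancestor, and 17 = 1 + 16 in [ksup_shift]. *)
Lemma ksup_node K n l : (n <= K)%N -> S ((rad (circ n))%:C * node K l) <=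
  17 `^ N.+2%:R * S (zeta (circ n) (l %/ 2 ^ (K - n))).
Proof.
move=> nK; have u1 : normc (node K l) = 1 by exact: cmod_omegaX.
have dv : normc ((rad (circ n))%:C * node K l) = rad (circ n).
  by rewrite cmodM u1 mulr1 normc_re ger0_norm ?rad_ge0.
have E : circ K = (circ n + (K - n))%N by rewrite /circ !addn3; lia.
have -> : 17 = 1 + 16 :> R by ring.
apply: (ksup_shift w0 w_le phi_disk) => //; first by rewrite /disk /mkset dv rad_lt1.
  exact: zeta_disk.
rewrite dv /zeta -mulrBr cmodM normc_re ger0_norm ?rad_ge0//.
apply: le_trans (_ : normc (node K l - omega (circ n) ^+ (l %/ 2 ^ (K - n))) <= _).
  by rewrite ler_piMl ?normc_ge0// ltW ?rad_lt1.
have -> : 1 - rad (circ n) = 2 ^- circ n :> R by rewrite /rad opprB addrC subrK.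
rewrite /node E; apply: rad_omega_dist.
by rewrite leq_trunc_div ltn_ceil// expn_gt0.
Qed.

Definition stage_const : R :=
  (growth_const beta + 16) * piece_const N c k +
  growth_const beta * (16 * (N.+1 + N.+2 * 68)%:R * piece_const N c k).

Lemma stage_const_ge0 : 0 <= stage_const.
Proof.
have p0 := piece_const_ge0 N c k; apply: addr_ge0; apply: mulr_ge0 => //.
  exact: addr_ge0.
by apply: mulr_ge0 => //; apply: mulr_ge0.
Qed.

Lemma node_sum_le K n l : (n <= K)%N ->
  fnorm (K, n, l, false) * bnorm gamma (T (atom (K, n, l, false))) +
  fnorm (K, n, l, true) * bnorm gamma (T (atom (K, n, l, true))) <=
  stage_const * 17 `^ N.+2%:R * (2 ^- circ K * q ^+ circ n * 2 ^- (K - n) *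
     (2 ^+ circ n * (2 ^- circ n) ^+ N.+2) * S (zeta (circ n) (l %/ 2 ^ (K - n)))).
Proof.
move=> nK; have u1 : normc (node K l) = 1 by exact: cmod_omegaX.
have u2 : normc (base_node K l) = 1 by exact: cmod_omegaX.
have E : circ K = (circ n + (K - n))%N by rewrite /circ !addn3; lia.
have p0 := piece_const_ge0 N c k.
have t16 : 2 ^+ circ n * normc (node K l - base_node K l) <= 16 * 2 ^- (K - n).
  apply: le_trans (ler_wpM2l (ltW (P2 _)) (node_dist K l)) _.
  by rewrite E exprD invfM mulrCA mulVKf ?gt_eqF.
have j1 : 2 ^- (K - n) <= 1 :> R by rewrite invf_le1// exprn_ege1// ler1n.
have t16' : 2 ^+ circ n * normc (node K l - base_node K l) <= 16.
  by apply: le_trans t16 _; rewrite ler_piMr.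
set Z := 2 ^+ circ n * (2 ^- circ n) ^+ N.+2 * S ((rad (circ n))%:C * node K l).
have h1 : bnorm gamma (T (piece n (node K l))) <= piece_const N c k * Z.
  apply: bnorm_T_close => // v dv.
  by have [] := piece_close b0 cE dv u1 u2 t16'.
have h2 : bnorm gamma (T (piece n (node K l) - piece n (base_node K l))) <=
    16 * (N.+1 + N.+2 * 68)%:R * piece_const N c k * 2 ^- (K - n) * Z.
  apply: bnorm_T_close => //; first by apply: mulr_ge0 => //; apply: mulr_ge0.
  move=> v dv; have [_ _ h] := piece_close b0 cE dv u1 u2 t16'.
  apply: le_trans h _; rewrite mulrA ler_wpM2r//.
    have D0 : 0 < cdist (circ n) v (node K l).
      by apply: lt_le_trans (cdist_ge _ dv u1); rewrite invr_gt0.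
    by rewrite mulr_ge0 ?(ltW (P2 _))// exprn_ge0// divr_ge0 ?(ltW D0).
  rewrite [leRHS]mulrAC ler_wpM2r// [16 * _]mulrC -[leRHS]mulrA ler_wpM2l//.
have Q0 : 0 <= q ^+ circ n by rewrite exprn_ge0// ltW.
apply: le_trans (lerD (ler_wpM2l (fnorm_ge0 _) h1) (ler_wpM2l (fnorm_ge0 _) h2)) _.
rewrite /fnorm.
apply: le_trans (_ : stage_const * (2 ^- circ K * q ^+ circ n * 2 ^- (K - n) * Z) <= _).
  rewrite /stage_const le_eqVlt; apply/orP; left; apply/eqP.
  have alg (d x y z s t r : R) : x * ((r + 16) * z * y) * (t * s) + x * (r * z) * (16 * d * t * y * s) =
      ((r + 16) * t + r * (16 * d * t)) * (x * z * y * s) by ring.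
  exact: alg.
apply: le_trans (_ : stage_const * (2 ^- circ K * q ^+ circ n * 2 ^- (K - n) *
    (2 ^+ circ n * (2 ^- circ n) ^+ N.+2 * (17 `^ N.+2%:R * S (zeta (circ n) (l %/ 2 ^ (K - n)))))) <= _).
  rewrite ler_wpM2l ?stage_const_ge0// ler_wpM2l//.
  by rewrite ler_wpM2l ?ksup_node.
rewrite le_eqVlt; apply/orP; left; apply/eqP.
have alg (a d x y z : R) : a * (x * (y * (d * z))) = a * d * (x * y * z) by ring.
exact: alg.
Qed.

(** The 2^(K-n) nodes below one dyadic point turn the weight 2^-(circ K) into 2^-(circ n); the
    Lipschitz gain 2^-(K-n) is left over, and makes the sum over K converge. *)
Lemma stage_sum_le K n : (n <= K)%N ->
  \sum_(l < 2 ^ circ K) (fnorm (K, n, (l : nat), false) * bnorm gamma (T (atom (K, n, (l : nat), false))) +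
    fnorm (K, n, (l : nat), true) * bnorm gamma (T (atom (K, n, (l : nat), true)))) <=
  stage_const * 17 `^ N.+2%:R * (2^-1 ^+ (K - n) * term (circ n)).
Proof.
move=> nK; have E : circ K = (circ n + (K - n))%N by rewrite /circ !addn3; lia.
apply: le_trans (_ : \sum_(l < 2 ^ circ K) stage_const * 17 `^ N.+2%:R *
  (2 ^- circ K * q ^+ circ n * 2 ^- (K - n) * (2 ^+ circ n * (2 ^- circ n) ^+ N.+2) *
     S (zeta (circ n) (l %/ 2 ^ (K - n)))) <= _).
  by apply: ler_sum => l _; exact: node_sum_le.
rewrite -mulr_sumr ler_wpM2l ?mulr_ge0 ?stage_const_ge0 ?powR_ge0//.
rewrite -mulr_sumr E (sum_divn_pow2 (circ n) (K - n) (fun l => S (zeta (circ n) l))).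
rewrite /carleson_term -E powR_mulrn// [(q / 2 ^+ N.+2) ^+ _]expr_div_n.
set s := \sum_(l < _) _; rewrite le_eqVlt; apply/orP; left; apply/eqP.
rewrite E exprD invfM [(2 ^- circ n) ^+ _]exprVn -exprM mulnC exprM [2^-1 ^+ (K - n)]exprVn.
have alg (x y z t u : R) : x != 0 -> y != 0 ->
    x^-1 * y^-1 * z * y^-1 * (x * t) * (y * u) = y^-1 * (z * t * u).
  by move=> x0 y0; field; rewrite x0 y0.
by apply: alg; rewrite gt_eqF.
Qed.

Lemma stages_bounded : carleson w phi beta N.+2%:R -> exists B, forall m,
  \sum_(K < m) \sum_(i <- stage K) fnorm i * bnorm gamma (T (atom i)) <= B.
Proof.
move=> [B BP]; pose D := stage_const * 17 `^ N.+2%:R.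
have D0 : 0 <= D by rewrite mulr_ge0 ?stage_const_ge0 ?powR_ge0.
have A0 : 0 <= N.+2%:R :> R by [].
have t0 n : 0 <= term n := carleson_term_ge0 w0 w_le phi_disk beta n A0.
exists (D * (2 * B)) => m.
apply: le_trans (_ : \sum_(K < m) \sum_(n < K.+1) D * (2^-1 ^+ (K - n) * term (circ n)) <= _).
  apply: ler_sum => K _; rewrite big_stage; apply: ler_sum => n _.
  by apply: stage_sum_le; rewrite -ltnS.
rewrite (triangular_sum (fun K n => D * (2^-1 ^+ (K - n) * term (circ n)))).
apply: le_trans (_ : \sum_(n < m) D * (2 * term (circ n)) <= _).
  apply: ler_sum => n _; rewrite -mulr_sumr ler_wpM2l//.
  under eq_bigr do rewrite addKn.
  rewrite -mulr_suml ler_wpM2r//; have h2 : (1 - 2^-1)^-1 = 2 :> R by field.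
  apply: le_trans (geometric_sum_le _ _) _; last by rewrite h2.
  by rewrite invr_ge0 ler0n/= invf_lt1// ltr1n.
rewrite -!mulr_sumr ler_wpM2l// ler_wpM2l//.
(* The indices [circ n] with n < m are the last m ones below N + 3 + m; the others add nonnegative
   terms. *)
apply: le_trans (BP (N + 3 + m)%N); rewrite big_split_ord /= -[leLHS]add0r.
apply: lerD; first by apply: sumr_ge0 => n _.
by apply: ler_sum => n _; rewrite /circ -addnA addnC.
Qed.

Lemma sum_half (V : nmodType) (u : nat -> V) m : \sum_(l < m.*2) u l./2 = (\sum_(l < m) u l) *+ 2.
Proof.
elim: m => [|m ih]; first by rewrite !big_ord0 mul0rn.
rewrite doubleS !big_ord_recr /= ih uphalf_double doubleK.
by rewrite mulrnDl mulr2n addrA.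
Qed.

(** Each even node is the base node of itself and of the odd node after it, so this is the mean over
    the roots of half the order. *)
Lemma base_node_mean K (G : C -> C) :
  2 ^- circ K * \sum_(l < 2 ^ circ K) G (base_node K l) = circle_mean (circ K).-1 G.
Proof.
have E : circ K = ((circ K).-1 + 1)%N by rewrite circ_pred /circ addn3 addn2 addn1.
rewrite /circle_mean; set M := (circ K).-1.
have h l : base_node K l = omega M ^+ l./2.
  by rewrite /base_node E -(omega_pow M 1) -exprM mul2n.
under eq_bigr do rewrite h.
rewrite E addn1 expnS mul2n (sum_half (fun l => G (omega M ^+ l))).
by rewrite -[(\sum_(_ < _) _) *+ 2]mulr_natl exprS invfM mulrACA mulVf ?mul1r ?pnatr_eq0.
Qed.

Lemma stage_pair K n l f v :
  functional (K, n, l, false) f * atom (K, n, l, false) v +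
  functional (K, n, l, true) f * atom (K, n, l, true) v =
  2 ^- circ K * integrand N c f v n (node K l) -
  (n < K)%:R * (2 ^- circ K * integrand N c f v n (base_node K l)).
Proof.
have alg (s p x y z t r : C) : (p * x + - (p * s) * y) * t + (p * s * y + 0 * z) * (t - r) =
    p * (x * t) - s * (p * (y * r)) by ring.
exact: alg.
Qed.

(** Stage m replaces the means with n < m by those over twice as many roots, and adds the mean for n
    = m; the sum telescopes. *)
Lemma stages_partial m f v : \sum_(K < m) \sum_(i <- stage K) functional i f * atom i v =
  \sum_(n < m) circle_mean (circ m).-1 (integrand N c f v n).
Proof.
elim: m => [|m ih]; first by rewrite !big_ord0.
rewrite big_ord_recr ih /= big_stage.
set G := integrand N c f v.
have -> : \sum_(n < m.+1) \sum_(l < 2 ^ circ m)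
    (functional (m, (n : nat), (l : nat), false) f * atom (m, (n : nat), (l : nat), false) v +
     functional (m, (n : nat), (l : nat), true) f * atom (m, (n : nat), (l : nat), true) v) =
    \sum_(n < m.+1) (circle_mean (circ m) (G n) - (n < m)%:R * circle_mean (circ m).-1 (G n)).
  apply: eq_bigr => n _; rewrite -base_node_mean /circle_mean !mulr_sumr -sumrB.
  by apply: eq_bigr => l _; exact: stage_pair.
(* [(circ m.+1).-1] computes to [circ m], which identifies the order on the right with that of stage
   m. *)
rewrite -/(circ m) sumrB addrCA.
rewrite [X in _ + (_ - X)]big_ord_recr /= ltnn mul0r addr0.
under [X in _ + (_ - X)]eq_bigr do rewrite ltn_ord mul1r.
by rewrite subrr addr0.
Qed.

Lemma nuclear_of_carleson_aux : carleson w phi beta N.+2%:R -> nuclear T.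
Proof.
move=> /stages_bounded[B BP].
apply: (nuclear_blocks ag aphi phi_disk TE (0, 0, 0, false)%N _ fnorm_ge0 functional_le BP).
  by move=> K; rewrite !size_allpairs !size_iota !muln_gt0 expn_gt0.
move=> f v d dv d0; have [K0 K0P] := reproducing beta1 bA c_sum cE f dv d0.
by exists K0 => K KK; rewrite stages_partial; exact: K0P.
Qed.

End stages.

Lemma nuclear_of_carleson {R : realType} (beta gamma : R) (g phi : Cx R -> Cx R)
    (T : bloch beta -> bloch gamma) (N : nat) :
  1 < beta -> beta < N.+2%:R -> analytic g -> analytic phi ->
  (forall z, disk z -> disk (phi z)) ->
  (forall f z, disk z -> T f z = volterra g phi f z) ->
  carleson (bloch_weight gamma g) phi beta N.+2%:R -> nuclear T.
Proof.
move=> beta1 bA ag aphi phi_disk TE; have [c [k [c_sum cE]]] := @richardson (Cx R) N.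
move=> car; apply: (nuclear_of_carleson_aux beta1 ag aphi phi_disk TE bA c_sum _ car).
exact: cE.
Qed.

(** * Restriction to the little Bloch space *)

Section restriction.
Context {R : realType}.
Local Notation C := (Cx R).
Context (beta gamma : R) (T : bloch beta -> bloch gamma).

Lemma little_incl_dist (u v : little_bloch beta) : `|little_incl u - little_incl v| = `|u - v|.
Proof. by rewrite -little_incl_norm; congr (`|_|); exact: val_inj. Qed.

Lemma little_incl_continuous : continuous (@little_incl R beta).
Proof.
move=> f; apply/(@cvgrPdist_lt _ _ _ (nbhs f)) => e e0.
apply: filterS (@nbhsx_ballx _ _ f _ e0) => h; rewrite -ball_normE /=.
by move=> fh; have := little_incl_dist f h => ->.
Qed.

(** The inclusion is isometric, so restricted functionals have no larger dual norms and the same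
    vectors y_k serve. *)
Lemma nuclear_little : nuclear T -> nuclear (T \o @little_incl R beta).
Proof.
move=> [x' [y [x'c sumoo cv]]].
exists (fun k => x' k \o @little_incl R beta : {linear little_bloch beta -> C}), y; split.
- move=> k f; apply: continuous_comp; [exact: little_incl_continuous | exact: x'c].
- apply: le_lt_trans sumoo; apply: lee_nneseries => k _.
    by rewrite mule_ge0 ?dual_norm_ge0// lee_fin bloch_norm_real /= bnorm_ge0.
  rewrite lee_wpmul2r//; first by rewrite lee_fin bloch_norm_real /= bnorm_ge0.
  by apply: le_ereal_sup => _ [f f1 <-]; exists (little_incl f).
- by move=> f; exact: cv (little_incl f).
Qed.

End restriction.

(** * The implications from (a) to (c), from (c) to (b) and from (b) to (a) *)

Theorem corollary14 (R : realType) (alpha beta gamma : R)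
    (g phi : Cx R -> Cx R) (T : bloch beta -> bloch gamma) :
  1 < beta -> 0 < gamma -> beta - 2 < alpha ->
  analytic g -> analytic phi -> (forall z, disk z -> disk (phi z)) ->
  (forall f z, disk z -> T f z = volterra g phi f z) ->
  (exists M : R, forall f, `|T f| <= M%:C * `|f|) ->
  (nuclear (T \o @little_incl R beta) <-> nuclear T) /\
  (nuclear T <->
   (disk_integral (fun zeta =>
      ereal_sup [set ((1 - normc z ^+ 2) `^ gamma * normc (derive1 g z) /
                      normc (1 - zeta^* * phi z) `^ (alpha + 2))%:E | z in disk]
      * ((1 - normc zeta ^+ 2) `^ (alpha - beta + 1))%:E) < +oo)%E).
Proof.
move=> beta1 gamma0 ba ag aphi phi_disk TE _.
pose w := bloch_weight gamma g; pose a := alpha + 2.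
have w0 z : disk z -> 0 <= w z by move=> _; exact: weight_ge0.
have wW z : disk z -> w z <= weight_bound T.
  exact: (weight_le_bound beta1 ag aphi phi_disk TE).
have {}ba : beta < a by rewrite /a -ltrBlDr.
have a0 : 0 <= a by rewrite ltW// (lt_trans ltr01)// (lt_trans beta1).
(* An integer exponent N + 2 above a = alpha + 2: [carleson_exponent_le] passes from a up to it, and
   [carleson_exponent] back down. *)
have [N aN] : exists N : nat, a <= N.+2%:R.
  exists (Num.bound a); apply: le_trans (ltW (archi_boundP a0)) _.
  by rewrite ler_nat -addn2 leq_addr.
have bN : beta < N.+2%:R := lt_le_trans ba aN.
have densityE : (fun zeta : Cx R =>
      ereal_sup [set ((1 - normc z ^+ 2) `^ gamma * normc (derive1 g z) /
                      normc (1 - zeta^* * phi z) `^ (alpha + 2))%:E | z in disk]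
      * ((1 - normc zeta ^+ 2) `^ (alpha - beta + 1))%:E)%E = carleson_density w phi beta a.
  apply: boolp.funext => v; rewrite /carleson_density; congr (_ * (_ `^ _)%:E)%E.
  by rewrite /a; ring.
rewrite densityE.
have c_of_car : carleson w phi beta N.+2%:R -> (disk_integral (carleson_density w phi beta a) < +oo)%E.
  move=> h; apply: (integral_of_carleson w0 wW phi_disk beta1 ba).
  exact: (carleson_exponent w0 wW phi_disk beta1 _ ba h).
have nuc_of_c : (disk_integral (carleson_density w phi beta a) < +oo)%E -> nuclear T.
  move=> h; apply: (nuclear_of_carleson beta1 bN ag aphi phi_disk TE).
  apply: (carleson_exponent_le w0 wW phi_disk beta1 a0 aN).
  exact: (carleson_of_integral w0 wW phi_disk beta1 ba h).
have car_of_nuc : nuclear (T \o @little_incl R beta) -> carleson w phi beta N.+2%:R.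
  exact: (carleson_of_nuclear beta1 ag aphi phi_disk TE bN).
split; split.
- by move=> h; exact/nuc_of_c/c_of_car/car_of_nuc.
- exact: nuclear_little.
- by move=> h; exact/c_of_car/car_of_nuc/nuclear_little.
- exact: nuc_of_c.
Qed.
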